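(* Let $(X,\mathcal{O}_X)$ be a topological ringed space, let $\mathcal{L}$ be a Lie algebroid over $(X,\mathcal{O}_X)$ that is locally free of finite rank as an $\mathcal{O}_X$-module, and let $\mathcal{L}'$ be a locally free $\mathcal{O}_X$-module of finite rank. Then the pair $(\mathcal{L}',\mathcal{L}'^* )$ forms an $\mathcal{L}$-Lie bialgebroid over $(X,\mathcal{O}_X)$ if and only if there is a strong differential $\mathcal{G}_{\mathcal{L}}$-Gerstenhaber algebra structure on $\wedge^\bullet_{\mathcal{O}_X}\mathcal{L}'$ over $(X,\mathcal{O}_X)$.
   Context: $\mathbb{K}$ is $\mathbb{R}$, $\mathbb{C}$, or an algebraically closed field of characteristic $0$; $\mathbb{K}_X$ is the constant sheaf. A topological ringed space $(X,\mathcal{O}_X)$ is a topological space with a $\mathbb{K}_X$-subalgebra $\mathcal{O}_X$ of the sheaf of continuous $\mathbb{K}$-valued functions ($\mathbb{K}$ with Euclidean or Zariski topology). $\mathcal{T}_X=\mathcal{D}er_{\mathbb{K}_X}(\mathcal{O}_X)$ with commutator bracket; $\mathcal{F}^*=\mathcal{H}om_{\mathcal{O}_X}(\mathcal{F},\mathcal{O}_X)$. A Lie algebroid $(\mathcal{L},[\cdot,\cdot]_{\mathcal{L}},\mathfrak{a})$ is an $\mathcal{O}_X$-module that is also a sheaf of $\mathbb{K}$-Lie algebras, with an $\mathcal{O}_X$-linear Lie algebra homomorphism $\mathfrak{a}:\mathcal{L}\to\mathcal{T}_X$ (anchor) satisfying $[D,fD']=f[D,D']+\mathfrak{a}(D)(f)D'$.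 Morphisms are $\mathcal{O}_X$-linear Lie algebra homomorphisms commuting with anchors. An $\mathcal{L}$-Lie algebroid is a Lie algebroid with a Lie algebroid morphism to $\mathcal{L}$. A Gerstenhaber algebra over $(X,\mathcal{O}_X)$ is $(\mathcal{A}=\bigoplus_i\mathcal{A}^i,\wedge,[\cdot,\cdot])$ with $(\mathcal{A},\wedge)$ a graded commutative associative $\mathcal{O}_X$-algebra, $(\mathcal{A}[1],[\cdot,\cdot])$ ($\mathcal{A}[1]^i=\mathcal{A}^{i+1}$) a graded $\mathbb{K}_X$-Lie algebra, and $[a,b\wedge c]=[a,b]\wedge c+(-1)^{(i-1)j}b\wedge[a,c]$ for $a\in\mathcal{A}^i,b\in\mathcal{A}^j$. Morphisms are graded $\mathcal{O}_X$-algebra and graded $\mathbb{K}_X$-Lie algebra homomorphisms. For a Lie algebroid $\mathcal{M}$, $\mathcal{G}_{\mathcal{M}}=(\wedge^\bullet_{\mathcal{O}_X}\mathcal{M},\wedge,[\cdot,\cdot]^{\mathcal{M}})$ is its exterior algebra with the generalized Schouten–Nijenhuis bracket, i.e. the Gerstenhaber bracket extending the Lie bracket of $\mathcal{M}$ with $[D,f]^{\mathcal{M}}=\mathfrak{a}_{\mathcal{M}}(D)(f)$, $[f,g]^{\mathcal{M}}=0$. A $\mathcal{G}_{\mathcal{L}}$-Gerstenhaber algebra is a Gerstenhaber algebra with a morphism of Gerstenhaber algebras to $\mathcal{G}_{\mathcal{L}}$. For a locally free finite rank Lie algebroid $\mathcal{M}$, $\Omega^\bullet_{\mathcal{M}}=(\wedge^\bullet_{\mathcal{O}_X}\mathcal{M}^*,{\rm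 d}_{\mathcal{M}})$ is the Chevalley–Eilenberg–de Rham differential graded algebra, ${\rm d}_{\mathcal{M}}\omega(D_1\wedge\cdots\wedge D_{k+1})=\sum_i(-1)^{i+1}\mathfrak{a}(D_i)(\omega(\cdots\widehat{D_i}\cdots))+\sum_{i<j}(-1)^{i+j}\omega([D_i,D_j]\wedge\cdots\widehat{D_i}\cdots\widehat{D_j}\cdots)$. An $\mathcal{L}$-Lie bialgebroid is a pair $(\mathcal{L}',\mathcal{L}'^* )$ of $\mathcal{L}$-Lie algebroids over $(X,\mathcal{O}_X)$ in duality (Lie algebroid structures on $\mathcal{L}'$ and on its dual, each with a Lie algebroid morphism to $\mathcal{L}$) such that ${\rm d}'_*[D_1,D_2]'=[{\rm d}'_*D_1,D_2]'+[D_1,{\rm d}'_*D_2]'$ for all sections $D_1,D_2$ of $\mathcal{L}'$, where $[\cdot,\cdot]'=[\cdot,\cdot]^{\mathcal{L}'}$ is the Gerstenhaber bracket on $\wedge^\bullet_{\mathcal{O}_X}\mathcal{L}'$ and ${\rm d}'_*={\rm d}_{\mathcal{L}'^*}$ is the differential on $\wedge^\bullet_{\mathcal{O}_X}\mathcal{L}'\cong\wedge^\bullet_{\mathcal{O}_X}(\mathcal{L}'^* )^*$ defined by the Lie algebroid structure of $\mathcal{L}'^*$. A strong differential Gerstenhaber algebra over $(X,\mathcal{O}_X)$ is a Gerstenhaber algebra $(\bigoplus_{i\ge0}\mathcal{A}^i,\wedge,[\cdot,\cdot])$ with a $\mathbb{K}_X$-linear map $\tilde{\rm d}$ of degree $1$,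 $\tilde{\rm d}^2=0$, that is a graded derivation of $\wedge$ and of the graded Lie bracket $[\cdot,\cdot]$. A strong differential $\mathcal{G}_{\mathcal{L}}$-Gerstenhaber algebra is a $\mathcal{G}_{\mathcal{L}}$-Gerstenhaber algebra $\mathcal{A}^\bullet$ with a differential $\tilde{\rm d}$ making $(\mathcal{A}^\bullet,\tilde{\rm d})$ a strong differential Gerstenhaber algebra, together with a differential graded algebra homomorphism (graded $\mathcal{O}_X$-algebra map commuting with differentials) $\psi:\Omega^\bullet_{\mathcal{L}}=(\wedge^\bullet_{\mathcal{O}_X}\mathcal{L}^*,{\rm d}_{\mathcal{L}})\to(\mathcal{A}^\bullet,\tilde{\rm d})$. On $\wedge^\bullet_{\mathcal{O}_X}\mathcal{L}'$ the product $\wedge$ is the exterior product.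
   Formalization: The equivalence is proved as existence of structures in all ranks; that each bialgebroid structure itself induces the strong differential structure (same bracket and differential) is proved only where L' nowhere has rank 1, since it fails in rank 1 (e.g. L = L' = T on the real line). *)

(* Defs.v *)
(* MathComp + MathComp-Analysis. *)
From HB Require Import structures.
From mathcomp Require Import all_boot all_order all_algebra.
From mathcomp Require Import boolp classical_sets reals topology normedtype.
From mathcomp Require Import complex.

Set Implicit Arguments.
Unset Strict Implicit.
Unset Printing Implicit Defensive.

Import GRing.Theory.
Import numFieldNormedType.Exports.
Local Open Scope classical_set_scope.
Local Open Scope ring_scope.

(** * The base field and its topology *)

Definition euclidean_open (F : numFieldType) : set (set F) := @open F.

(* The closed sets are the zero loci of sets of polynomials. *)
Definition zariski_open (K : fieldType) : set (set K) :=
  [set A | exists S : set {poly K},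
     ~` A = [set x | forall p, S p -> p.[x] = 0]].

Inductive base_field : forall K : fieldType, set (set K) -> Prop :=
| real_euclidean (R : realType) : base_field (@euclidean_open R)
| complex_euclidean (R : realType) : base_field (@euclidean_open R[i])
| real_zariski (R : realType) : base_field (@zariski_open R)
| closed_zariski (K : closedFieldType) :
    [pchar K] =i pred0 -> base_field (@zariski_open K).

(** * Sheaves *)

Record opn (X : topologicalType) := Opn { oset :> set X; opn_open : open oset }.

Definition opnI (X : topologicalType) (U V : opn X) : opn X :=
  Opn (openI (opn_open U) (opn_open V)).

Record is_sheaf (X : topologicalType) (S : opn X -> Type)
    (r : forall U V : opn X, V `<=` U -> S U -> S V) : Prop := {
  sheaf_id : forall (U : opn X) (h : U `<=` U) s, r U U h s = s;
  sheaf_comp : forall (U V W : opn X) (hV : V `<=` U) (hW : W `<=` V)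
      (h : W `<=` U) s,
    r V W hW (r U V hV s) = r U W h s;
  sheaf_sep : forall (U : opn X) (I : Type) (W : I -> opn X)
      (hW : forall i, W i `<=` U) (s t : S U),
    U `<=` \bigcup_i W i ->
    (forall i, r U (W i) (hW i) s = r U (W i) (hW i) t) -> s = t;
  sheaf_glue : forall (U : opn X) (I : Type) (W : I -> opn X)
      (hW : forall i, W i `<=` U) (s : forall i, S (W i)),
    U `<=` \bigcup_i W i ->
    (forall i j (V : opn X) (hi : V `<=` W i) (hj : V `<=` W j),
       r (W i) V hi (s i) = r (W j) V hj (s j)) ->
    exists t : S U, forall i, r U (W i) (hW i) t = s i }.

(** * Topological ringed spaces *)

(* A sheaf of K-subalgebras of the sheaf of continuous K-valued functions: a
   section f over U is determined by its values [oval f x] for x in U; the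
   value of [oval f x] outside U is irrelevant.  The rings are [comPzRingType]
   because the ring of sections over the empty set is zero. *)
Record ringed_space (K : fieldType) (tau : set (set K))
    (X : topologicalType) := {
  osec :> opn X -> comPzRingType;
  ores : forall U V : opn X, V `<=` U -> osec U -> osec V;
  osheaf : is_sheaf ores;
  oval : forall U : opn X, osec U -> X -> K;
  ocst : forall U : opn X, K -> osec U;
  oval_inj : forall (U : opn X) (f g : osec U),
    (forall x, oset U x -> oval f x = oval g x) -> f = g;
  oval1 : forall (U : opn X) x, oset U x -> oval (1 : osec U) x = 1;
  ovalD : forall (U : opn X) (f g : osec U) x, oset U x ->
    oval (f + g) x = oval f x + oval g x;
  ovalM : forall (U : opn X) (f g : osec U) x, oset U x ->
    oval (f * g) x = oval f x * oval g x;
  oval_cst : forall (U : opn X) c x, oset U x -> oval (ocst U c) x = c;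
  oval_res : forall (U V : opn X) (h : V `<=` U) f x, oset V x ->
    oval (ores h f) x = oval f x;
  oval_continuous : forall (U : opn X) (f : osec U) (A : set K),
    tau A -> open [set x | oset U x /\ A (oval f x)] }.

Arguments ocst {K tau X} r {U} c.

(** * Sheaves of modules *)

Section Modules.
Context {K : fieldType} {tau : set (set K)} {X : topologicalType}.
Variable O : ringed_space tau X.

Record omod := {
  msec :> forall U : opn X, lmodType (O U);
  mres : forall U V : opn X, V `<=` U -> msec U -> msec V;
  msheaf : is_sheaf mres;
  mres_lin : forall (U V : opn X) (h : V `<=` U) (f : O U) (m n : msec U),
    mres h (f *: m + n) = ores h f *: mres h m + mres h n }.

Record omod_hom (M N : omod) := {
  happ :> forall U : opn X, M U -> N U;
  happ_lin : forall (U : opn X) (f : O U) (m n : M U),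
    happ (f *: m + n) = f *: happ m + happ n;
  happ_res : forall (U V : opn X) (h : V `<=` U) (m : M U),
    happ (mres h m) = mres h (happ m) }.

(* Every point has an open neighbourhood V such that M restricted to V is free
   with a basis whose cardinality satisfies P. *)
Definition locally_free_rank (P : nat -> Prop) (M : omod) : Prop :=
  forall x : X, exists (V : opn X) (n : nat) (e : 'I_n -> M V),
    [/\ oset V x, P n & forall (W : opn X) (h : W `<=` V) (m : M W),
      exists! c : {ffun 'I_n -> O W}, m = \sum_i c i *: mres h (e i)].

Definition locally_free_finite_rank : omod -> Prop :=
  locally_free_rank (fun=> True).

End Modules.

Arguments locally_free_rank {K tau X O} P M.
Arguments locally_free_finite_rank {K tau X O} M.

(** * The dual sheaf Hom(M, O) *)

Section OresTheory.
Context {K : fieldType} {tau : set (set K)} {X : topologicalType}.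
Variable O : ringed_space tau X.

Lemma oresD (U V : opn X) (h : V `<=` U) (f g : O U) :
  ores h (f + g) = ores h f + ores h g.
Proof.
by apply: oval_inj => x Vx; rewrite oval_res// !ovalD ?oval_res//; apply: h.
Qed.

Lemma oresM (U V : opn X) (h : V `<=` U) (f g : O U) :
  ores h (f * g) = ores h f * ores h g.
Proof.
by apply: oval_inj => x Vx; rewrite oval_res// !ovalM ?oval_res//; apply: h.
Qed.

Lemma ores1 (U V : opn X) (h : V `<=` U) : ores h (1 : O U) = 1.
Proof. by apply: oval_inj => x Vx; rewrite oval_res// !oval1//; apply: h. Qed.

Lemma ores_id (U : opn X) (h : U `<=` U) (f : O U) : ores h f = f.
Proof. exact: (sheaf_id (osheaf O)). Qed.

Lemma ores_comp (U V W : opn X) (hV : V `<=` U) (hW : W `<=` V) (h : W `<=` U)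
  (f : O U) : ores hW (ores hV f) = ores h f.
Proof. exact: (sheaf_comp (osheaf O)). Qed.

Lemma ores0 (U V : opn X) (h : V `<=` U) : ores h (0 : O U) = 0.
Proof. by apply: (addrI (ores h 0)); rewrite -oresD !addr0. Qed.

Lemma oresN (U V : opn X) (h : V `<=` U) (f : O U) : ores h (- f) = - ores h f.
Proof. by apply: (addrI (ores h f)); rewrite -oresD !subrr ores0. Qed.

Lemma mres_id (M : omod O) (U : opn X) (h : U `<=` U) (m : M U) : mres h m = m.
Proof. exact: (sheaf_id (msheaf M)). Qed.

Lemma mres_comp (M : omod O) (U V W : opn X) (hV : V `<=` U) (hW : W `<=` V)
  (h : W `<=` U) (m : M U) : mres hW (mres hV m) = mres h m.
Proof. exact: (sheaf_comp (msheaf M)). Qed.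

End OresTheory.

Section Dual.
Context {K : fieldType} {tau : set (set K)} {X : topologicalType}.
Context {O : ringed_space tau X}.
Variable M : omod O.

Record dual_sec (U : opn X) := DualSec {
  dev : forall V : opn X, V `<=` U -> M V -> O V;
  dev_lin : forall (V : opn X) (h : V `<=` U) (f : O V) (m n : M V),
    dev h (f *: m + n) = f * dev h m + dev h n;
  dev_res : forall (V W : opn X) (h : V `<=` U) (hW : W `<=` V) (h' : W `<=` U)
      (m : M V),
    dev h' (mres hW m) = ores hW (dev h m) }.

Lemma dual_secP (U : opn X) (a b : dual_sec U) :
  (forall (V : opn X) (h : V `<=` U) m, dev a h m = dev b h m) -> a = b.
Proof.
case: a => a al ar; case: b => b bl br /= ab.
have E : a = b.
  apply: functional_extensionality_dep => V.
  by apply: functional_extensionality_dep => h; apply: funext => m; apply: ab.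
by subst b; congr DualSec; apply: Prop_irrelevance.
Qed.

Section Ops.
Variable U : opn X.

HB.instance Definition _ := gen_eqMixin (dual_sec U).
HB.instance Definition _ := gen_choiceMixin (dual_sec U).

Program Definition dual_zero : dual_sec U := @DualSec U (fun _ _ _ => 0) _ _.
Next Obligation. by move=> * /=; rewrite mulr0 addr0. Qed.
Next Obligation. by move=> * /=; rewrite ores0. Qed.

Program Definition dual_add (a b : dual_sec U) : dual_sec U :=
  @DualSec U (fun V h m => dev a h m + dev b h m) _ _.
Next Obligation. by move=> * /=; rewrite !dev_lin mulrDr addrACA. Qed.
Next Obligation.
move=> a b V W h hW h' m /=.
by rewrite oresD (dev_res a h hW h') (dev_res b h hW h').
Qed.

Program Definition dual_opp (a : dual_sec U) : dual_sec U :=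
  @DualSec U (fun V h m => - dev a h m) _ _.
Next Obligation. by move=> * /=; rewrite dev_lin opprD mulrN. Qed.
Next Obligation.
by move=> a V W h hW h' m /=; rewrite oresN (dev_res a h hW h').
Qed.

Program Definition dual_scale (f : O U) (a : dual_sec U) : dual_sec U :=
  @DualSec U (fun V h m => ores h f * dev a h m) _ _.
Next Obligation. by move=> * /=; rewrite dev_lin mulrDr mulrCA. Qed.
Next Obligation.
move=> f a V W h hW h' m /=.
by rewrite oresM (ores_comp h hW h') (dev_res a h hW h').
Qed.

Fact dual_addA : associative dual_add.
Proof. by move=> a b c; apply: dual_secP => V h m /=; rewrite addrA. Qed.
Fact dual_addC : commutative dual_add.
Proof. by move=> a b; apply: dual_secP => V h m /=; rewrite addrC. Qed.
Fact dual_add0 : left_id dual_zero dual_add.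
Proof. by move=> a; apply: dual_secP => V h m /=; rewrite add0r. Qed.
Fact dual_addN : left_inverse dual_zero dual_opp dual_add.
Proof. by move=> a; apply: dual_secP => V h m /=; rewrite addNr. Qed.

HB.instance Definition _ :=
  GRing.isZmodule.Build (dual_sec U) dual_addA dual_addC dual_add0 dual_addN.

Fact dual_scaleA f g (a : dual_sec U) :
  dual_scale f (dual_scale g a) = dual_scale (f * g) a.
Proof. by apply: dual_secP => V h m /=; rewrite oresM mulrA. Qed.
Fact dual_scale1 : left_id 1 dual_scale.
Proof. by move=> a; apply: dual_secP => V h m /=; rewrite ores1 mul1r. Qed.
Fact dual_scaleDr : right_distributive dual_scale +%R.
Proof. by move=> f a b; apply: dual_secP => V h m /=; rewrite mulrDr. Qed.
Fact dual_scaleDl (a : dual_sec U) :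
  {morph dual_scale^~ a : f g / f + g}.
Proof. by move=> f g; apply: dual_secP => V h m /=; rewrite oresD mulrDl. Qed.

HB.instance Definition _ := GRing.Zmodule_isLmodule.Build (O U) (dual_sec U)
  dual_scaleA dual_scale1 dual_scaleDr dual_scaleDl.

End Ops.

Program Definition dual_res (U V : opn X) (h : V `<=` U) (a : dual_sec U) :
    dual_sec V :=
  @DualSec V (fun W hW m => dev a (subset_trans hW h) m) _ _.
Next Obligation. by move=> *; exact: dev_lin. Qed.
Next Obligation. by move=> *; exact: dev_res. Qed.

Lemma dual_sheaf : is_sheaf dual_res.
Proof.
have devi (U : opn X) (a : dual_sec U) (V : opn X) (h h' : V `<=` U) m :
  dev a h m = dev a h' m by rewrite (Prop_irrelevance h h').
split.
- by move=> U h s; apply: dual_secP => V hV m /=; apply: devi.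
- by move=> U V W hV hW h s; apply: dual_secP => Z hZ m /=; apply: devi.
- move=> U I W hW s t cov st; apply: dual_secP => V h m.
  have subV i : opnI V (W i) `<=` V by move=> x [].
  have subW i : opnI V (W i) `<=` W i by move=> x [].
  apply: (sheaf_sep (osheaf O) (W := fun i => opnI V (W i)) (hW := subV)).
    by move=> x Vx; have [i _ Wx] := cov x (h x Vx); exists i.
  move=> i; have hi : opnI V (W i) `<=` U := subset_trans (subW i) (hW i).
  rewrite -(dev_res s h (subV i) hi) -(dev_res t h (subV i) hi).
  have /(congr1 (fun a => dev a (subW i) (mres (subV i) m))) := st i.
  by rewrite /= !(devi _ _ _ _ hi).
- move=> U I W hW s cov compat.
  have subV (V : opn X) i : opnI V (W i) `<=` V by move=> x [].
  have subW (V : opn X) i : opnI V (W i) `<=` W i by move=> x [].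
  have covV (V : opn X) (h : V `<=` U) : V `<=` \bigcup_i opnI V (W i).
    by move=> x Vx; have [i _ Wx] := cov x (h x Vx); exists i.
  have glue (V : opn X) (h : V `<=` U) (m : M V) : exists t : O V, forall i,
      ores (subV V i) t = dev (s i) (subW V i) (mres (subV V i) m).
    have := @sheaf_glue _ _ _ (osheaf O) V I (fun i => opnI V (W i)) (subV V)
      (fun i => dev (s i) (subW V i) (mres (subV V i) m)) (covV V h).
    apply=> i j Z hi hj.
    have hZi : Z `<=` W i := subset_trans hi (subW V i).
    have hZj : Z `<=` W j := subset_trans hj (subW V j).
    have hZ : Z `<=` V := subset_trans hi (subV V i).
    rewrite -(dev_res (s i) (subW V i) hi hZi).
    rewrite -(dev_res (s j) (subW V j) hj hZj).
    rewrite (mres_comp (subV V i) hi hZ) (mres_comp (subV V j) hj hZ).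
    have /(congr1 (fun a => dev a (@subset_refl _ Z) (mres hZ m))) :=
      compat i j Z hZi hZj.
    by rewrite /= (devi _ _ _ _ hZi) (devi _ _ _ _ hZj).
  pose t (V : opn X) (h : V `<=` U) (m : M V) : O V := sval (cid (glue V h m)).
  have tE V h m i : ores (subV V i) (t V h m) =
      dev (s i) (subW V i) (mres (subV V i) m).
    exact: (svalP (cid (glue V h m))).
  have tlin (V : opn X) (h : V `<=` U) (f : O V) (m n : M V) :
      t V h (f *: m + n) = f * t V h m + t V h n.
    apply: (sheaf_sep (osheaf O) (hW := subV V)) (covV V h) _ => i.
    by rewrite oresD oresM !tE mres_lin dev_lin.
  have tres (V Z : opn X) (h : V `<=` U) (hZ : Z `<=` V) (h' : Z `<=` U)
      (m : M V) : t Z h' (mres hZ m) = ores hZ (t V h m).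
    apply: (sheaf_sep (osheaf O) (hW := subV Z)) (covV Z h') _ => i.
    have hi : opnI Z (W i) `<=` opnI V (W i) by move=> x [/hZ].
    have hiV : opnI Z (W i) `<=` V := subset_trans (subV Z i) hZ.
    rewrite tE (ores_comp hZ (subV Z i) hiV) (mres_comp hZ (subV Z i) hiV).
    rewrite -(ores_comp (subV V i) hi hiV) tE.
    by rewrite -(dev_res _ _ hi (subW Z i)) (mres_comp (subV V i) hi hiV).
  exists (DualSec tlin tres) => i; apply: dual_secP => V h m /=.
  have hU : V `<=` U := subset_trans h (hW i).
  apply: (sheaf_sep (osheaf O) (hW := subV V)) (covV V hU) _.
  move=> j; rewrite tE.
  have hi : opnI V (W j) `<=` W i := subset_trans (subV V j) h.
  rewrite -(dev_res (s i) h (subV V j) hi).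
  have /(congr1 (fun a => dev a (@subset_refl _ _) (mres (subV V j) m))) :=
    compat j i _ (subW V j) hi.
  by rewrite /= (devi _ _ _ _ (subW V j)) (devi _ _ _ _ hi).
Qed.

Fact dual_res_lin (U V : opn X) (h : V `<=` U) (f : O U) (a b : dual_sec U) :
  dual_res h (f *: a + b) = ores h f *: dual_res h a + dual_res h b.
Proof.
apply: dual_secP => W hW m /=.
by rewrite (ores_comp h hW (subset_trans hW h)).
Qed.

Definition dual : omod O :=
  {| msec := fun U => dual_sec U : lmodType (O U);
     mres := dual_res; msheaf := dual_sheaf; mres_lin := dual_res_lin |}.

Definition dual_pair (U : opn X) (a : dual U) (m : M U) : O U :=
  dev (a : dual_sec U) (@subset_refl _ U) m.

End Dual.

(** * Lie algebroids *)

Section LieAlgebroids.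
Context {K : fieldType} {tau : set (set K)} {X : topologicalType}.
Context {O : ringed_space tau X}.

(* The sections over U of the tangent sheaf: K-linear derivations of the
   restriction of O to U. *)
Record der (U : opn X) := {
  dapp : forall V : opn X, V `<=` U -> O V -> O V;
  dapp_add : forall (V : opn X) (h : V `<=` U) (f g : O V),
    dapp h (f + g) = dapp h f + dapp h g;
  dapp_cst : forall (V : opn X) (h : V `<=` U) (c : K) (f : O V),
    dapp h (ocst O c * f) = ocst O c * dapp h f;
  dapp_mul : forall (V : opn X) (h : V `<=` U) (f g : O V),
    dapp h (f * g) = dapp h f * g + f * dapp h g;
  dapp_res : forall (V W : opn X) (h : V `<=` U) (hW : W `<=` V)
      (h' : W `<=` U) (f : O V),
    dapp h' (ores hW f) = ores hW (dapp h f) }.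

(* [anchor_res], [anchor_lin] and [anchor_lie] say that the anchor is a morphism
   of sheaves of O-modules and of Lie algebras to the tangent sheaf. *)
Record lie_algebroid_on (M : omod O) := {
  lbr : forall U : opn X, M U -> M U -> M U;
  anchor : forall U : opn X, M U -> der U;
  lbr_res : forall (U V : opn X) (h : V `<=` U) (D D' : M U),
    lbr (mres h D) (mres h D') = mres h (lbr D D');
  lbr_linl : forall (U : opn X) (c : K) (D D' E : M U),
    lbr (ocst O c *: D + D') E = ocst O c *: lbr D E + lbr D' E;
  lbr_linr : forall (U : opn X) (c : K) (D D' E : M U),
    lbr E (ocst O c *: D + D') = ocst O c *: lbr E D + lbr E D';
  lbr_alt : forall (U : opn X) (D : M U), lbr D D = 0;
  lbr_jacobi : forall (U : opn X) (D E F : M U),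
    lbr D (lbr E F) + lbr E (lbr F D) + lbr F (lbr D E) = 0;
  anchor_res : forall (U V : opn X) (h : V `<=` U) (D : M U)
      (W : opn X) (hW : W `<=` V) (hW' : W `<=` U) (f : O W),
    dapp (anchor (mres h D)) hW f = dapp (anchor D) hW' f;
  anchor_lin : forall (U : opn X) (g : O U) (D D' : M U)
      (V : opn X) (h : V `<=` U) (f : O V),
    dapp (anchor (g *: D + D')) h f =
      ores h g * dapp (anchor D) h f + dapp (anchor D') h f;
  anchor_lie : forall (U : opn X) (D D' : M U)
      (V : opn X) (h : V `<=` U) (f : O V),
    dapp (anchor (lbr D D')) h f =
      dapp (anchor D) h (dapp (anchor D') h f) -
      dapp (anchor D') h (dapp (anchor D) h f);
  lbr_leibniz : forall (U : opn X) (D D' : M U) (f : O U),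
    lbr D (f *: D') =
      f *: lbr D D' + dapp (anchor D) (@subset_refl _ U) f *: D' }.

Definition anchor_act (M : omod O) (A : lie_algebroid_on M) (U : opn X)
    (D : M U) (f : O U) : O U :=
  dapp (anchor A D) (@subset_refl _ U) f.

Record lie_algebroid := {
  la_mod :> omod O;
  la_str :> lie_algebroid_on la_mod }.

Record is_lie_mor (M N : omod O) (A : lie_algebroid_on M)
    (B : lie_algebroid_on N) (phi : omod_hom M N) : Prop := {
  lie_mor_br : forall (U : opn X) (D D' : M U),
    phi U (lbr A D D') = lbr B (phi U D) (phi U D');
  lie_mor_anchor : forall (U : opn X) (D : M U) (V : opn X) (h : V `<=` U)
      (f : O V),
    dapp (anchor B (phi U D)) h f = dapp (anchor A D) h f }.

Record rel_lie_algebroid_on (L : lie_algebroid) (M : omod O) := {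
  rla_str :> lie_algebroid_on M;
  rla_map : omod_hom M L;
  rla_mor : is_lie_mor rla_str L rla_map }.

End LieAlgebroids.

Arguments lie_algebroid {K tau X} O.

(** * Graded algebras and exterior algebras *)

Section Algebras.
Context {K : fieldType} {tau : set (set K)} {X : topologicalType}.
Variable O : ringed_space tau X.

(* Associative unital O-algebras, not necessarily commutative. *)
Record oalg := {
  alg_mod :> omod O;
  amul : forall U : opn X, alg_mod U -> alg_mod U -> alg_mod U;
  aone : forall U : opn X, alg_mod U;
  amul_linl : forall (U : opn X) (f : O U) (a b c : alg_mod U),
    amul (f *: a + b) c = f *: amul a c + amul b c;
  amul_linr : forall (U : opn X) (f : O U) (a b c : alg_mod U),
    amul c (f *: a + b) = f *: amul c a + amul c b;
  amulA : forall (U : opn X) (a b c : alg_mod U),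
    amul a (amul b c) = amul (amul a b) c;
  amul1l : forall (U : opn X) (a : alg_mod U), amul (aone U) a = a;
  amul1r : forall (U : opn X) (a : alg_mod U), amul a (aone U) = a;
  amul_res : forall (U V : opn X) (h : V `<=` U) (a b : alg_mod U),
    amul (mres h a) (mres h b) = mres h (amul a b);
  aone_res : forall (U V : opn X) (h : V `<=` U), mres h (aone U) = aone V }.

Record oalg_hom (A B : oalg) := {
  ahom :> omod_hom A B;
  ahomM : forall (U : opn X) (a b : A U),
    ahom U (amul a b) = amul (ahom U a) (ahom U b);
  ahom1 : forall U : opn X, ahom U (aone A U) = aone B U }.

(* A grading of A as the direct sum of sheaves A^0 + A^1 + ..., given by the
   projections [gpr i] onto A^i; a section of an infinite direct sum of sheaves
   is only locally a finite sum of homogeneous components. *)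
Record galg := {
  galg_alg :> oalg;
  gpr : nat -> omod_hom galg_alg galg_alg;
  gprK : forall i j (U : opn X) (a : galg_alg U),
    gpr i U (gpr j U a) = if i == j then gpr i U a else 0;
  gpr_sum : forall (U : opn X) (a : galg_alg U) (x : X), oset U x ->
    exists (V : opn X) (h : V `<=` U) (n : nat),
      oset V x /\ mres h a = \sum_(i < n) gpr i V (mres h a);
  gpr_one : forall U : opn X, gpr 0 U (aone galg_alg U) = aone galg_alg U;
  gpr_mul : forall i j (U : opn X) (a b : galg_alg U),
    gpr i U a = a -> gpr j U b = b -> gpr (i + j) U (amul a b) = amul a b }.

Definition homog (A : galg) (i : nat) (U : opn X) (a : A U) : Prop :=
  gpr A i U a = a.

Record galg_hom (A B : galg) := {
  ghom :> oalg_hom A B;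
  ghom_pr : forall i (U : opn X) (a : A U),
    ghom U (gpr A i U a) = gpr B i U (ghom U a) }.

(* The exterior algebra of M, by its universal property among sheaves of
   associative O-algebras, with its grading. *)
Record exterior (M : omod O) := {
  ext_alg :> galg;
  iota : omod_hom M ext_alg;
  iota_deg : forall (U : opn X) (m : M U), homog 1 (iota U m);
  iota_sq : forall (U : opn X) (m : M U), amul (iota U m) (iota U m) = 0;
  ext_univ : forall (B : oalg) (f : omod_hom M B),
    (forall (U : opn X) (m : M U), amul (f U m) (f U m) = 0) ->
    exists g : oalg_hom ext_alg B,
      (forall (U : opn X) (m : M U), g U (iota U m) = f U m) /\
      forall g' : oalg_hom ext_alg B,
        (forall (U : opn X) (m : M U), g' U (iota U m) = f U m) ->
        forall (U : opn X) (a : ext_alg U), g' U a = g U a }.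

End Algebras.

(** * Gerstenhaber algebras *)

Section Gerstenhaber.
Context {K : fieldType} {tau : set (set K)} {X : topologicalType}.
Context {O : ringed_space tau X}.

(* Gerstenhaber algebra structures on a graded algebra concentrated in degrees
   i >= 0.  The exponents i - 1 of the definition appear as i.+1, which has the
   same parity. *)
Record gerstenhaber_on (A : galg O) := {
  gmulC : forall i j (U : opn X) (a b : A U), homog i a -> homog j b ->
    amul a b = (-1) ^+ (i * j) *: amul b a;
  gbr : forall U : opn X, A U -> A U -> A U;
  gbr_res : forall (U V : opn X) (h : V `<=` U) (a b : A U),
    gbr (mres h a) (mres h b) = mres h (gbr a b);
  gbr_linl : forall (U : opn X) (k : K) (a b c : A U),
    gbr (ocst O k *: a + b) c = ocst O k *: gbr a c + gbr b c;
  gbr_linr : forall (U : opn X) (k : K) (a b c : A U),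
    gbr c (ocst O k *: a + b) = ocst O k *: gbr c a + gbr c b;
  gbr_deg : forall i j (U : opn X) (a b : A U), homog i a -> homog j b ->
    if (i + j)%N is k.+1 then homog k (gbr a b) else gbr a b = 0;
  gbr_anti : forall i j (U : opn X) (a b : A U), homog i a -> homog j b ->
    gbr a b = - ((-1) ^+ (i.+1 * j.+1) *: gbr b a);
  gbr_jacobi : forall i j (U : opn X) (a b c : A U), homog i a -> homog j b ->
    gbr a (gbr b c) =
      gbr (gbr a b) c + (-1) ^+ (i.+1 * j.+1) *: gbr b (gbr a c);
  gbr_leibniz : forall i j (U : opn X) (a b c : A U), homog i a -> homog j b ->
    gbr a (amul b c) =
      amul (gbr a b) c + (-1) ^+ (i.+1 * j) *: amul b (gbr a c) }.

Definition is_gerstenhaber_mor (A B : galg O) (GA : gerstenhaber_on A)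
    (GB : gerstenhaber_on B) (phi : galg_hom A B) : Prop :=
  forall (U : opn X) (a b : A U),
    phi U (gbr GA a b) = gbr GB (phi U a) (phi U b).

(* The Gerstenhaber algebra G_M: the (unique) Gerstenhaber bracket on the
   exterior algebra of the Lie algebroid M extending bracket and anchor. *)
Record schouten (M : omod O) (A : lie_algebroid_on M) (E : exterior M) := {
  sn_gerst :> gerstenhaber_on E;
  sn_br : forall (U : opn X) (D D' : M U),
    gbr sn_gerst (iota E U D) (iota E U D') = iota E U (lbr A D D');
  sn_anchor : forall (U : opn X) (D : M U) (f : O U),
    gbr sn_gerst (iota E U D) (f *: aone E U) = anchor_act A D f *: aone E U;
  sn_fun : forall (U : opn X) (f g : O U),
    gbr sn_gerst (f *: aone E U) (g *: aone E U) = 0 }.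

(** * The Chevalley-Eilenberg-de Rham differential *)

(* Let N be paired with M.  [det_pairing] is the evaluation of a section w of
   the exterior algebra of N at D_1 /\ ... /\ D_k, for sections D_i of M:
   (n_1 /\ ... /\ n_k)(D_1 /\ ... /\ D_k) = det (<n_i, D_j>). *)
Record det_pairing (M N : omod O) (b : forall U : opn X, N U -> M U -> O U)
    (E : exterior N) := {
  dp :> forall U : opn X, E U -> seq (M U) -> O U;
  dp_lin : forall (U : opn X) (f : O U) (v w : E U) (s : seq (M U)),
    dp (f *: v + w) s = f * dp v s + dp w s;
  dp_res : forall (U V : opn X) (h : V `<=` U) (w : E U) (s : seq (M U)),
    dp (mres h w) (map (mres h) s) = ores h (dp w s);
  dp_deg : forall k (U : opn X) (w : E U) (s : seq (M U)),
    homog k w -> size s != k -> dp w s = 0;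
  dp_det : forall (U : opn X) (t : seq (N U)) (s : seq (M U)),
    size t = size s ->
    dp (\big[@amul _ _ _ _ E U/aone E U]_(n <- t) iota E U n) s =
    \det (\matrix_(i < size s, j < size s) b U (nth 0 t i) (nth 0 s j)) }.

Definition omit (T : Type) (i : nat) (s : seq T) : seq T :=
  take i s ++ drop i.+1 s.

(* The differential d_M on the exterior algebra of N, where N is the dual of M
   through the pairing b.  Indices start from 0, so that the signs (-1)^(i+1)
   and (-1)^(i+j) of the usual formula become (-1)^i and (-1)^(i+j). *)
Record ce_differential (M N : omod O) (b : forall U : opn X, N U -> M U -> O U)
    (A : lie_algebroid_on M) (E : exterior N) := {
  ce_pairing : det_pairing b E;
  ced :> forall U : opn X, E U -> E U;
  ced_res : forall (U V : opn X) (h : V `<=` U) (w : E U),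
    ced (mres h w) = mres h (ced w);
  ced_lin : forall (U : opn X) (c : K) (v w : E U),
    ced (ocst O c *: v + w) = ocst O c *: ced v + ced w;
  ced_deg : forall k (U : opn X) (w : E U), homog k w -> homog k.+1 (ced w);
  ced_formula : forall k (U : opn X) (w : E U) (s : seq (M U)),
    homog k w -> size s = k.+1 ->
    ce_pairing U (ced w) s =
      \sum_(i < k.+1)
        (-1) ^+ i * anchor_act A (nth 0 s i) (ce_pairing U w (omit i s)) +
      \sum_(j < k.+1) \sum_(i < j)
        (-1) ^+ (i + j) *
        ce_pairing U w (lbr A (nth 0 s i) (nth 0 s j) :: omit i (omit j s)) }.

(* Omega_M, on the exterior algebra of the dual of M. *)
Definition de_rham (M : omod O) (A : lie_algebroid_on M)
    (E : exterior (dual M)) :=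
  ce_differential (@dual_pair _ _ _ _ M) A E.

(* The differential on the exterior algebra of N, identified with the exterior
   algebra of the bidual of N, for a Lie algebroid structure on the dual. *)
Definition codifferential (N : omod O) (A : lie_algebroid_on (dual N))
    (E : exterior N) :=
  ce_differential (fun U (D : N U) (a : dual N U) => dual_pair a D) A E.

(** * Lie bialgebroids and strong differential Gerstenhaber algebras *)

(* L-Lie bialgebroid structures on N and its dual.  The bracket [lb_bracket] and
   the differential [lb_diff] on the exterior algebra E of N are no additional
   data: they are determined by [lb_alg] and [lb_coalg]. *)
Record lie_bialgebroid_on (L : lie_algebroid O) (N : omod O)
    (E : exterior N) := {
  lb_alg : rel_lie_algebroid_on L N;
  lb_coalg : rel_lie_algebroid_on L (dual N);
  lb_bracket : schouten lb_alg E;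
  lb_diff : codifferential lb_coalg E;
  lb_compat : forall (U : opn X) (D D' : N U),
    lb_diff U (iota E U (lbr lb_alg D D')) =
      gbr lb_bracket (lb_diff U (iota E U D)) (iota E U D') +
      gbr lb_bracket (iota E U D) (lb_diff U (iota E U D')) }.

Record strong_differential (A : galg O) (G : gerstenhaber_on A) := {
  sd :> forall U : opn X, A U -> A U;
  sd_res : forall (U V : opn X) (h : V `<=` U) (a : A U),
    sd (mres h a) = mres h (sd a);
  sd_lin : forall (U : opn X) (c : K) (a b : A U),
    sd (ocst O c *: a + b) = ocst O c *: sd a + sd b;
  sd_deg : forall i (U : opn X) (a : A U), homog i a -> homog i.+1 (sd a);
  sd_sq : forall (U : opn X) (a : A U), sd (sd a) = 0;
  sd_mul : forall i (U : opn X) (a b : A U), homog i a ->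
    sd (amul a b) = amul (sd a) b + (-1) ^+ i *: amul a (sd b);
  sd_br : forall i (U : opn X) (a b : A U), homog i a ->
    sd (gbr G a b) = gbr G (sd a) b + (-1) ^+ i.+1 *: gbr G a (sd b) }.

(* Strong differential G_L-Gerstenhaber algebra structures on the graded
   algebra A, where GL is G_L and dL is the differential of Omega_L. *)
Record strong_gerstenhaber_on (L : lie_algebroid O) (EL : exterior L)
    (GL : schouten L EL) (ELd : exterior (dual L)) (dL : de_rham L ELd)
    (A : galg O) := {
  sg_gerst : gerstenhaber_on A;
  sg_phi : galg_hom A EL;
  sg_phi_mor : is_gerstenhaber_mor sg_gerst GL sg_phi;
  sg_diff : strong_differential sg_gerst;
  sg_psi : galg_hom ELd A;
  sg_psi_mor : forall (U : opn X) (w : ELd U),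
    sg_psi U (dL U w) = sg_diff U (sg_psi U w) }.

(* The two kinds of structure correspond to each other: same bracket, same
   differential, phi extends N -> L, and psi extends the transpose of the map
   from the dual of N to L.
   Where N has rank 1, [lb_compat] is an equation between sections of the zero
   sheaf and does not imply [sd_br] in degree 0: on the real line, take
   L = N = T and any isomorphism from the dual of N to T, with the Lie algebroid
   structure of T transported to the dual of N.  This bialgebroid corresponds
   to no strong differential Gerstenhaber algebra. *)
Record corresponds (L : lie_algebroid O) (EL : exterior L) (GL : schouten L EL)
    (ELd : exterior (dual L)) (dL : de_rham L ELd) (N : omod O) (E : exterior N)
    (B : lie_bialgebroid_on L E) (S : strong_gerstenhaber_on GL dL E) :
    Prop := {
  corr_br : forall (U : opn X) (a b : E U),
    gbr (lb_bracket B) a b = gbr (sg_gerst S) a b;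
  corr_diff : forall (U : opn X) (a : E U), lb_diff B U a = sg_diff S U a;
  corr_phi : forall (U : opn X) (D : N U),
    sg_phi S U (iota E U D) = iota EL U (rla_map (lb_alg B) U D);
  corr_psi : forall (U : opn X) (l : dual L U), exists D : N U,
    sg_psi S U (iota ELd U l) = iota E U D /\
    forall (V : opn X) (h : V `<=` U) (a : dual N V),
      dual_pair a (mres h D) =
      dual_pair (mres h l) (rla_map (lb_coalg B) V a) }.

End Gerstenhaber.

(* Main.v *)
(* A bracket and an anchor on L' are the same thing as a Gerstenhaber bracket on
   the exterior algebra E of L', and a bracket and an anchor on the dual of L'
   are the same thing as a differential d on E.  For the second correspondence
   let i_a be the interior product by a section a of the dual, and
   L_a = i_a d + d i_a.  Both the Chevalley-Eilenberg formula for d and the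
   derivation property of d amount to Cartan's relations
   [L_a, i_c] = i_[a,c] and i_a d f = a(f); together with d^2 = 0 they yield the
   Jacobi identity, and conversely.  As a section of positive degree killed by
   all i_a vanishes (the Euler operator sum_i e_i i_(a_i) of a local basis is k
   in degree k), identities on E can be proved by induction on the degree.
   The compatibility of d with the bracket on L' extends to E because its defect
   is a biderivation: compatibility for D and f D' shows that
   defect(D, f) D' = 0, hence defect(D, f) = 0 when the rank is not 1.  In rank
   1 the mere existence of a strong structure is still granted by the zero
   bracket and the zero differential.
   The two structure maps to and from L correspond by transposition, L and L'
   being reflexive. *)
From HB Require Import structures.
From mathcomp Require Import all_boot all_order all_algebra.
From mathcomp Require Import boolp classical_sets reals topology.
From mathcomp Require Import complex ring.
Require Import Defs.

Set Implicit Arguments.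
Unset Strict Implicit.
Unset Printing Implicit Defensive.

Import GRing.Theory Num.Theory.
Local Open Scope classical_set_scope.
Local Open Scope ring_scope.

(** The exterior algebra is given by its universal property alone, and a sheaf of modules may have
    few sections over a given open set, so nothing can be defined or checked on a global basis.
    Interior products are therefore produced by the universal property too, and identities on E are
    proved by inductions that contain a locality clause. Such a clause also serves the grading,
    because a section is only locally a finite sum of homogeneous ones. Characteristic 0 is what
    allows dividing by the degree in the Euler argument. The calculus is set up for an abstract
    pairing because it is applied to two pairs: the dual of L' acting on the exterior algebra of L',
    where it links a differential to an algebroid, and L acting on that of its dual, where it
    describes the de Rham differential which psi has to respect. Two exterior algebras are compared
    by evaluating on sequences of sections: there psi becomes the pullback along the map from the
    dual of L' to L. *)

Section SquareZero.
Variable V : zmodType.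

(* The commutative ring Z (+) V with V.V = 0: through the injection of V in it,
   [ring] decides the identities of abelian groups. *)
Definition sqz := (int * V)%type.

HB.instance Definition _ := GRing.Zmodule.on sqz.

Definition sqz_mul (x y : sqz) : sqz := (x.1 * y.1, y.2 *~ x.1 + x.2 *~ y.1).

Fact sqz_mulA : associative sqz_mul.
Proof.
move=> [a u] [b v] [c w]; congr pair => /=; first by rewrite mulrA.
by rewrite !mulrzDl -!mulrzA addrA [b * a]mulrC [c * a]mulrC.
Qed.

Fact sqz_mulC : commutative sqz_mul.
Proof. by move=> [a u] [b v]; congr pair => /=; rewrite (mulrC, addrC). Qed.

Fact sqz_mul1 : left_id ((1, 0) : sqz) sqz_mul.
Proof. by move=> [a u]; congr pair => /=; rewrite ?mul1r// mul0rz addr0. Qed.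

Fact sqz_mulDl : left_distributive sqz_mul +%R.
Proof.
move=> [a u] [b v] [c w]; congr pair => /=; first by rewrite mulrDl.
by rewrite mulrzDr mulrzDl addrACA addrA.
Qed.

HB.instance Definition _ :=
  GRing.Zmodule_isComPzRing.Build sqz sqz_mulA sqz_mulC sqz_mul1 sqz_mulDl.

Definition sqz_in (v : V) : sqz := (0, v).

Fact sqz_in_is_additive : zmod_morphism sqz_in.
Proof. by move=> x y; congr pair; rewrite /= subrr. Qed.

HB.instance Definition _ :=
  GRing.isZmodMorphism.Build V sqz sqz_in sqz_in_is_additive.

Lemma sqz_in_inj : injective sqz_in.
Proof. by move=> x y []. Qed.

End SquareZero.

Ltac abel := apply: sqz_in_inj; ring.

(** * Sheaves of modules and algebras *)

Lemma base_field_pchar0 (K : fieldType) (tau : set (set K)) :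
  base_field tau -> [pchar K] =i pred0.
Proof. by case=> // R; apply: pchar_num. Qed.

Section Sheaves.
Context {K : fieldType} {tau : set (set K)} {X : topologicalType}.
Context {O : ringed_space tau X}.
Implicit Types (U V W : opn X) (M N : omod O) (A B : oalg O).

Lemma sub_opnIl U V : opnI U V `<=` U.
Proof. by move=> x []. Qed.

Lemma sub_opnIr U V : opnI U V `<=` V.
Proof. by move=> x []. Qed.

Lemma ocst1 U : ocst O (U := U) 1 = 1.
Proof. by apply: oval_inj => x Ux; rewrite oval_cst// oval1. Qed.

Lemma ocstD U a b : ocst O (U := U) (a + b) = ocst O a + ocst O b.
Proof. by apply: oval_inj => x Ux; rewrite ovalD// !oval_cst. Qed.

Lemma ocstM U a b : ocst O (U := U) (a * b) = ocst O a * ocst O b.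
Proof. by apply: oval_inj => x Ux; rewrite ovalM// !oval_cst. Qed.

Lemma ocst_res U V (h : V `<=` U) a : ores h (ocst O a) = ocst O a.
Proof.
by apply: oval_inj => x Vx; rewrite oval_res// !oval_cst//; apply: h.
Qed.

Lemma ocst0 U : ocst O (U := U) 0 = 0.
Proof. by apply: (addrI (ocst O 0)); rewrite -ocstD !addr0. Qed.

Lemma ocst_nat U n : ocst O (U := U) n%:R = n%:R.
Proof.
by elim: n => [|n IH]; rewrite ?ocst0// -!natr1 ocstD IH ocst1.
Qed.

(** Characteristic 0 enters here: n + 1 is invertible in K, hence among the constant sections. *)
Lemma natmul_eq0 (hK : base_field tau) M U n (m : M U) :
  n.+1%:R *: m = 0 -> m = 0.
Proof.
move=> E; rewrite -[m]scale1r -(ocst1 U).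
rewrite -(mulVf (x := (n.+1%:R : K))); last first.
  by rewrite (pcharf0P _).1 //; apply: base_field_pchar0 hK.
by rewrite ocstM ocst_nat -scalerA E scaler0.
Qed.

Section Restriction.
Variables (M : omod O) (U V : opn X) (h : V `<=` U).

Lemma mresD : {morph @mres _ _ _ _ M U V h : m n / m + n}.
Proof. by move=> m n; rewrite -[m]scale1r mres_lin ores1 !scale1r. Qed.

Lemma mres0 : mres h (0 : M U) = 0.
Proof. by apply: (addrI (mres h 0)); rewrite -mresD !addr0. Qed.

Lemma mresN : {morph @mres _ _ _ _ M U V h : m / - m}.
Proof. by move=> m; apply: (addrI (mres h m)); rewrite -mresD !subrr mres0. Qed.

Lemma mresB : {morph @mres _ _ _ _ M U V h : m n / m - n}.
Proof. by move=> m n; rewrite mresD mresN. Qed.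

Lemma mresZ f (m : M U) : mres h (f *: m) = ores h f *: mres h m.
Proof. by rewrite -[f *: m]addr0 mres_lin mres0 addr0. Qed.

Lemma mres_sum I (r : seq I) P (F : I -> M U) :
  mres h (\sum_(i <- r | P i) F i) = \sum_(i <- r | P i) mres h (F i).
Proof. exact: (big_morph _ mresD mres0). Qed.

Lemma ores_sign n : ores h ((-1) ^+ n : O U) = (-1) ^+ n.
Proof.
by elim: n => [|n IH]; rewrite ?expr0 ?ores1// !exprS oresM oresN ores1 IH.
Qed.

Lemma mres_irr (h' : V `<=` U) (m : M U) : mres h m = mres h' m.
Proof. by rewrite (Prop_irrelevance h h'). Qed.

End Restriction.

Lemma mres_compE M U V W (hV : V `<=` U) (hW : W `<=` V) (m : M U) :
  mres hW (mres hV m) = mres (subset_trans hW hV) m.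
Proof. exact: mres_comp. Qed.

(** The cover demanded by the sheaf axiom is indexed by the opens on which s and t agree, which
    avoids choosing a neighbourhood of each point. *)
Lemma msep M U (s t : M U) :
  (forall x, oset U x -> exists (V : opn X) (h : V `<=` U),
     oset V x /\ mres h s = mres h t) -> s = t.
Proof.
move=> H; pose I := {V : opn X | exists h : V `<=` U, mres h s = mres h t}.
have hI (i : I) : sval i `<=` U by case: i => V [].
apply: (sheaf_sep (msheaf M) (hW := hI)).
  move=> x /H[V [h [Vx E]]].
  by exists (exist (fun V : opn X => exists h : V `<=` U, mres h s = mres h t) V
    (ex_intro _ h E)).
by move=> [V [h E]]; move: (hI _) => /= k; rewrite (Prop_irrelevance k h).
Qed.

Lemma osep U (f g : O U) :
  (forall x, oset U x -> exists (V : opn X) (h : V `<=` U),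
     oset V x /\ ores h f = ores h g) -> f = g.
Proof.
move=> H; apply: oval_inj => x Ux; have [V [h [Vx E]]] := H x Ux.
by rewrite -(oval_res h _ Vx) E oval_res.
Qed.

(** Gluing by a characteristic property: P passes to smaller opens and determines a section, so
    local solutions agree on overlaps without further checks. *)
Lemma mglue M U (P : forall V : opn X, V `<=` U -> M V -> Prop) :
  (forall V W (h : V `<=` U) (hW : W `<=` V) (h' : W `<=` U) s,
     P V h s -> P W h' (mres hW s)) ->
  (forall V (h : V `<=` U) s t, P V h s -> P V h t -> s = t) ->
  (forall x, oset U x -> exists V (h : V `<=` U) s, oset V x /\ P V h s) ->
  exists s : M U, forall x, oset U x ->
    exists V (h : V `<=` U), oset V x /\ P V h (mres h s).
Proof.
move=> Pres Puniq cov.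
pose I := {V : opn X | exists (h : V `<=` U) s, P V h s}.
have hI (i : I) : sval i `<=` U by case: i => V [].
have sI (i : I) : {s : M (sval i) | P (sval i) (hI i) s}.
  apply: cid; case: i (hI i) => V [h [s p]] /= k; exists s.
  by rewrite (Prop_irrelevance k h).
have [||t tE] := @sheaf_glue _ _ _ (msheaf M) U I (fun i => sval i)
    hI (fun i => sval (sI i)).
- move=> x /cov[V [h [s [Vx p]]]].
  by exists (exist (fun V => exists h s, P V h s) V
    (ex_intro _ h (ex_intro _ s p))).
- move=> i j V hi hj; apply: (Puniq _ (subset_trans hi (hI i))).
    exact: (Pres _ _ (hI i)) (svalP (sI i)).
  exact: (Pres _ _ (hI j)) (svalP (sI j)).
exists t => x /cov[V [h [s [Vx p]]]].
pose i : I := exist (fun V => exists h s, P V h s) V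
  (ex_intro _ h (ex_intro _ s p)).
exists V, h; split=> //; have := svalP (sI i); rewrite -(tE i).
by rewrite (Prop_irrelevance (hI i) h).
Qed.

Section HomTheory.
Variables (M N : omod O) (F : omod_hom M N) (U : opn X).

Lemma happD : {morph F U : m n / m + n}.
Proof. by move=> m n; rewrite -[m]scale1r happ_lin !scale1r. Qed.

Lemma happ0 : F U 0 = 0.
Proof. by apply: (addrI (F U 0)); rewrite -happD !addr0. Qed.

Lemma happN : {morph F U : m / - m}.
Proof. by move=> m; apply: (addrI (F U m)); rewrite -happD !subrr happ0. Qed.

Lemma happB : {morph F U : m n / m - n}.
Proof. by move=> m n; rewrite happD happN. Qed.

Lemma happZ f (m : M U) : F U (f *: m) = f *: F U m.
Proof. by rewrite -[f *: m]addr0 happ_lin happ0 addr0. Qed.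

Lemma happ_sum I (r : seq I) P (G : I -> M U) :
  F U (\sum_(i <- r | P i) G i) = \sum_(i <- r | P i) F U (G i).
Proof. exact: (big_morph _ happD happ0). Qed.

End HomTheory.

Section AlgTheory.
Variables (A : oalg O) (U : opn X).
Implicit Types a b c : A U.

Lemma amulDl a b c : amul (a + b) c = amul a c + amul b c.
Proof. by rewrite -[a]scale1r amul_linl !scale1r. Qed.

Lemma amulDr a b c : amul c (a + b) = amul c a + amul c b.
Proof. by rewrite -[a]scale1r amul_linr !scale1r. Qed.

Lemma amul0l a : amul 0 a = 0.
Proof. by apply: (addrI (amul 0 a)); rewrite -amulDl !addr0. Qed.

Lemma amul0r a : amul a 0 = 0.
Proof. by apply: (addrI (amul a 0)); rewrite -amulDr !addr0. Qed.

Lemma amulNl a b : amul (- a) b = - amul a b.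
Proof. by apply: (addrI (amul a b)); rewrite -amulDl !subrr amul0l. Qed.

Lemma amulNr a b : amul a (- b) = - amul a b.
Proof. by apply: (addrI (amul a b)); rewrite -amulDr !subrr amul0r. Qed.

Lemma amulZl f a b : amul (f *: a) b = f *: amul a b.
Proof. by rewrite -[f *: a]addr0 amul_linl amul0l addr0. Qed.

Lemma amulZr f a b : amul a (f *: b) = f *: amul a b.
Proof. by rewrite -[f *: b]addr0 amul_linr amul0r addr0. Qed.

Lemma amul_sumr I (r : seq I) P (G : I -> A U) a :
  amul a (\sum_(i <- r | P i) G i) = \sum_(i <- r | P i) amul a (G i).
Proof. exact: (big_morph _ (fun x y => amulDr x y a) (amul0r a)). Qed.

Lemma amul_suml I (r : seq I) P (G : I -> A U) a :
  amul (\sum_(i <- r | P i) G i) a = \sum_(i <- r | P i) amul (G i) a.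
Proof. exact: (big_morph _ (fun x y => amulDl x y a) (amul0l a)). Qed.

End AlgTheory.

End Sheaves.

(** * Induction on exterior algebras *)

Section Subalgebra.
Context {K : fieldType} {tau : set (set K)} {X : topologicalType}.
Context {O : ringed_space tau X}.
Variable A : oalg O.

(** [sa_res] and [sa_loc] make the sections satisfying the predicate a subsheaf, which can then be
    the target of the universal property. *)
Record subalg := {
  sa_pred :> forall U : opn X, A U -> Prop;
  sa_res : forall (U V : opn X) (h : V `<=` U) (a : A U),
    sa_pred a -> sa_pred (mres h a);
  sa_loc : forall (U : opn X) (a : A U),
    (forall x, oset U x -> exists (V : opn X) (h : V `<=` U),
      oset V x /\ sa_pred (mres h a)) -> sa_pred a;
  sa_lin : forall (U : opn X) f (a b : A U),
    sa_pred a -> sa_pred b -> sa_pred (f *: a + b);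
  sa_mul : forall (U : opn X) (a b : A U),
    sa_pred a -> sa_pred b -> sa_pred (amul a b);
  sa_one : forall U : opn X, sa_pred (aone A U) }.

Variable P : subalg.

Record sub_sec (U : opn X) := SubSec { ssval : A U; ssvalP : P U ssval }.

Lemma sub_secP (U : opn X) (a b : sub_sec U) : ssval a = ssval b -> a = b.
Proof.
case: a b => [a pa] [b pb] /= E; subst b.
by rewrite (Prop_irrelevance pa pb).
Qed.

Section Ops.
Variable U : opn X.

HB.instance Definition _ := gen_eqMixin (sub_sec U).
HB.instance Definition _ := gen_choiceMixin (sub_sec U).

Fact sub_zero_subproof : P U 0.
Proof.
by rewrite -(addNr (aone A U)) -scaleN1r; apply: sa_lin; apply: sa_one.
Qed.
Definition sub_zero := SubSec sub_zero_subproof.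

Fact sub_add_subproof (a b : sub_sec U) : P U (ssval a + ssval b).
Proof.
by rewrite -[ssval a]scale1r; apply: sa_lin; apply: ssvalP.
Qed.
Definition sub_add a b := SubSec (sub_add_subproof a b).

Fact sub_scale_subproof f (a : sub_sec U) : P U (f *: ssval a).
Proof.
rewrite -[_ *: _]addr0; apply: sa_lin; first exact: ssvalP.
exact: sub_zero_subproof.
Qed.
Definition sub_scale f a := SubSec (sub_scale_subproof f a).

Fact sub_addA : associative sub_add.
Proof. by move=> a b c; apply: sub_secP; rewrite /= addrA. Qed.
Fact sub_addC : commutative sub_add.
Proof. by move=> a b; apply: sub_secP; rewrite /= addrC. Qed.
Fact sub_add0 : left_id sub_zero sub_add.
Proof. by move=> a; apply: sub_secP; rewrite /= add0r. Qed.
Fact sub_addN : left_inverse sub_zero (sub_scale (-1)) sub_add.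
Proof. by move=> a; apply: sub_secP; rewrite /= scaleN1r addNr. Qed.

HB.instance Definition _ :=
  GRing.isZmodule.Build (sub_sec U) sub_addA sub_addC sub_add0 sub_addN.

Fact sub_scaleA f g a : sub_scale f (sub_scale g a) = sub_scale (f * g) a.
Proof. by apply: sub_secP; rewrite /= scalerA. Qed.
Fact sub_scale1 : left_id 1 sub_scale.
Proof. by move=> a; apply: sub_secP; rewrite /= scale1r. Qed.
Fact sub_scaleDr : right_distributive sub_scale +%R.
Proof. by move=> f a b; apply: sub_secP; rewrite /= scalerDr. Qed.
Fact sub_scaleDl a : {morph sub_scale^~ a : f g / f + g}.
Proof. by move=> f g; apply: sub_secP; rewrite /= scalerDl. Qed.

HB.instance Definition _ := GRing.Zmodule_isLmodule.Build (O U) (sub_sec U)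
  sub_scaleA sub_scale1 sub_scaleDr sub_scaleDl.

End Ops.

Definition sub_res (U V : opn X) (h : V `<=` U) (a : sub_sec U) : sub_sec V :=
  SubSec (sa_res h (ssvalP a)).

Lemma sub_sheaf : is_sheaf sub_res.
Proof.
split=> [U h s|U V W hV hW h s|U I W hW s t cov st|U I W hW s cov compat].
- by apply: sub_secP; apply: mres_id.
- by apply: sub_secP; apply: mres_comp.
- apply: sub_secP; apply: (sheaf_sep (msheaf A) (hW := hW)) cov _ => i.
  by have /(congr1 (@ssval _)) := st i.
have [||t tE] := @sheaf_glue _ _ _ (msheaf A) U I W hW (fun i => ssval (s i)).
- exact: cov.
- by move=> i j V hi hj; have /(congr1 (@ssval _)) := compat i j V hi hj.
have Pt : P U t.
  apply: sa_loc => x /cov[i _ Wx]; exists (W i), (hW i); split=> //.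
  by rewrite tE; apply: ssvalP.
by exists (SubSec Pt) => i; apply: sub_secP; apply: tE.
Qed.

Fact sub_res_lin (U V : opn X) (h : V `<=` U) (f : O U) (a b : sub_sec U) :
  sub_res h (f *: a + b) = ores h f *: sub_res h a + sub_res h b.
Proof. by apply: sub_secP; apply: mres_lin. Qed.

Definition sub_omod : omod O :=
  {| msec := fun U => sub_sec U : lmodType (O U);
     mres := sub_res; msheaf := sub_sheaf; mres_lin := sub_res_lin |}.

Definition sub_oalg : oalg O.
Proof.
refine {| alg_mod := sub_omod;
  amul := fun U (a b : sub_sec U) => SubSec (sa_mul (ssvalP a) (ssvalP b));
  aone := fun U => SubSec (sa_one P U) |}.
- by move=> *; apply: sub_secP; apply: amul_linl.
- by move=> *; apply: sub_secP; apply: amul_linr.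
- by move=> *; apply: sub_secP; apply: amulA.
- by move=> *; apply: sub_secP; apply: amul1l.
- by move=> *; apply: sub_secP; apply: amul1r.
- by move=> *; apply: sub_secP; apply: amul_res.
- by move=> *; apply: sub_secP; apply: aone_res.
Defined.

Definition sub_incl : oalg_hom sub_oalg A :=
  @Build_oalg_hom _ _ _ _ sub_oalg A
    (@Build_omod_hom _ _ _ _ sub_omod A (fun U => @ssval U)
      (fun _ _ _ _ => erefl) (fun _ _ _ _ => erefl))
    (fun _ _ _ => erefl) (fun=> erefl).

End Subalgebra.

Section ExteriorInduction.
Context {K : fieldType} {tau : set (set K)} {X : topologicalType}.
Context {O : ringed_space tau X}.
Implicit Types (U V W : opn X).

Definition oalg_id (A : oalg O) : oalg_hom A A :=
  @Build_oalg_hom _ _ _ _ A A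
    (@Build_omod_hom _ _ _ _ A A (fun U a => a)
      (fun _ _ _ _ => erefl) (fun _ _ _ _ => erefl))
    (fun _ _ _ => erefl) (fun=> erefl).

Definition omod_comp (M N P : omod O) (g : omod_hom N P) (f : omod_hom M N) :
  omod_hom M P.
Proof.
refine (@Build_omod_hom _ _ _ _ M P (fun U m => g U (f U m)) _ _).
- by move=> U r m n; rewrite !happ_lin.
- by move=> U V h m; rewrite !happ_res.
Defined.

Definition oalg_comp (A B C : oalg O) (g : oalg_hom B C) (f : oalg_hom A B) :
  oalg_hom A C.
Proof.
apply: (@Build_oalg_hom _ _ _ _ A C (omod_comp g f)).
- by move=> U a b /=; rewrite !ahomM.
- by move=> U /=; rewrite !ahom1.
Defined.

Variables (M : omod O) (E : exterior M).

(** The universal property gives a morphism from E to the subalgebra P. Followed by the inclusion it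
    fixes all [iota E U m], so by uniqueness it is the identity, and every section lies in P. *)
Lemma ext_subalg (P : subalg E) :
  (forall U (m : M U), P U (iota E U m)) -> forall U (w : E U), P U w.
Proof.
move=> Pi.
have lin : forall (U : opn X) (f : O U) (m n : M U),
    SubSec (Pi U (f *: m + n)) = f *: SubSec (Pi U m) + SubSec (Pi U n).
  by move=> U f m n; apply: sub_secP; apply: happ_lin.
have res : forall (U V : opn X) (h : V `<=` U) (m : M U),
    SubSec (Pi V (mres h m)) = sub_res h (SubSec (Pi U m)).
  by move=> U V h m; apply: sub_secP; apply: happ_res.
pose f : omod_hom M (sub_oalg P) :=
  @Build_omod_hom _ _ _ _ M (sub_omod P) (fun U m => SubSec (Pi U m)) lin res.
have [|g [gE _]] := @ext_univ _ _ _ _ _ E _ f.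
  by move=> U m; apply: sub_secP; apply: iota_sq.
have [|k [kE ku]] := @ext_univ _ _ _ _ _ E _ (iota E).
  exact: iota_sq.
move=> U w.
have -> : w = oalg_comp (sub_incl P) g U w.
  transitivity (k U w); first exact: (ku (oalg_id E)).
  apply/esym/(ku (oalg_comp (sub_incl P) g)) => V m.
  exact: (congr1 (@ssval _ _ _ _ _ P V) (gE V m)).
exact: ssvalP.
Qed.

(* Closing P under restriction, and then under left multiplications, makes it a
   subalgebra. *)
Lemma ext_ind (P : forall U, E U -> Prop) :
  (forall U (w : E U), (forall x, oset U x -> exists (V : opn X) (h : V `<=` U),
     oset V x /\ P V (mres h w)) -> P U w) ->
  (forall U f (v w : E U), P U v -> P U w -> P U (f *: v + w)) ->
  (forall U, P U (aone E U)) ->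
  (forall U (m : M U) (w : E U), P U w -> P U (amul (iota E U m) w)) ->
  forall U (w : E U), P U w.
Proof.
move=> Ploc Plin P1 PM.
pose Q U (w : E U) := forall V (h : V `<=` U), P V (mres h w).
have Qloc U (w : E U) : (forall x, oset U x ->
    exists (V : opn X) (h : V `<=` U), oset V x /\ Q V (mres h w)) -> Q U w.
  move=> H V h; apply: Ploc => x Vx; have [W [k [Wx q]]] := H x (h x Vx).
  exists (opnI V W), (@sub_opnIl _ V W); split=> //.
  rewrite mres_compE; have := q _ (@sub_opnIr _ V W).
  by rewrite mres_compE; congr P; apply: mres_irr.
have Qlin U f (v w : E U) : Q U v -> Q U w -> Q U (f *: v + w).
  by move=> qv qw V h; rewrite mres_lin; apply: Plin.
have Q1 U : Q U (aone E U) by move=> V h; rewrite aone_res.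
have QM U (m : M U) (w : E U) : Q U w -> Q U (amul (iota E U m) w).
  by move=> q V h; rewrite -amul_res -happ_res; apply: PM.
have Qres U V (h : V `<=` U) (w : E U) : Q U w -> Q V (mres h w).
  by move=> q W k; rewrite mres_compE.
pose R U (w : E U) := forall V (h : V `<=` U) (v : E V),
  Q V v -> Q V (amul (mres h w) v).
suff RT : forall U (w : E U), R U w.
  move=> U w; have := RT U w U (@subset_refl _ U) (aone E U) (Q1 U).
  move=> /(_ U (@subset_refl _ U)).
  by rewrite amul1r !mres_id.
have Rres U V (h : V `<=` U) (w : E U) : R U w -> R V (mres h w).
  by move=> r W k v q; rewrite mres_compE; apply: r.
have Rloc U (w : E U) : (forall x, oset U x ->
    exists (V : opn X) (h : V `<=` U), oset V x /\ R V (mres h w)) -> R U w.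
  move=> H V h v q; apply: Qloc => x Vx; have [W [k [Wx r]]] := H x (h x Vx).
  exists (opnI V W), (@sub_opnIl _ V W); split=> //.
  rewrite -amul_res mres_compE.
  rewrite (mres_irr _ (subset_trans (@sub_opnIr _ V W) k)) -mres_compE.
  by apply: r; apply: Qres.
have Rlin U f (v w : E U) : R U v -> R U w -> R U (f *: v + w).
  by move=> rv rw V h z q; rewrite mres_lin amul_linl; apply: Qlin; auto.
have RM U (v w : E U) : R U v -> R U w -> R U (amul v w).
  by move=> rv rw V h z q; rewrite -amul_res -amulA; auto.
have R1 U : R U (aone E U) by move=> V h z q; rewrite aone_res amul1l.
apply: (@ext_subalg (Build_subalg Rres Rloc Rlin RM R1)) => V m W h z q.
by rewrite -happ_res; apply: QM.
Qed.

Fixpoint extprod U (t : seq (M U)) : E U :=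
  if t is m :: t' then amul (iota E U m) (extprod t') else aone E U.

Lemma extprodE U (t : seq (M U)) :
  \big[@amul _ _ _ _ E U/aone E U]_(m <- t) iota E U m = extprod t.
Proof. by elim: t => [|m t IH]; rewrite ?big_nil// big_cons IH. Qed.

Lemma extprod_rcons U (t : seq (M U)) m :
  extprod (rcons t m) = amul (extprod t) (iota E U m).
Proof.
by elim: t => [|n t IH] /=; rewrite ?amul1l ?amul1r// IH amulA.
Qed.

Lemma extprod_res U V (h : V `<=` U) (t : seq (M U)) :
  mres h (extprod t) = extprod (map (mres h) t).
Proof.
by elim: t => [|n t IH] /=; rewrite ?aone_res// -amul_res IH happ_res.
Qed.

Lemma ext_span (P : forall U, E U -> Prop) :
  (forall U (w : E U), (forall x, oset U x -> exists (V : opn X) (h : V `<=` U),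
     oset V x /\ P V (mres h w)) -> P U w) ->
  (forall U f (v w : E U), P U v -> P U w -> P U (f *: v + w)) ->
  (forall U (t : seq (M U)), P U (extprod t)) ->
  forall U (w : E U), P U w.
Proof.
move=> Ploc Plin PT.
(* P is not assumed stable under multiplication by a generator, so the left factors met by [ext_ind]
   are accumulated in t. *)
suff H : forall U (w : E U) t, P U (amul (extprod t) w).
  by move=> U w; have := H U w [::]; rewrite /= amul1l.
apply: ext_ind.
- move=> U w H t; apply: Ploc => x /H[V [h [Vx p]]]; exists V, h; split=> //.
  by rewrite -amul_res extprod_res.
- by move=> U f v w pv pw t; rewrite amul_linr; apply: Plin.
- by move=> U t; rewrite amul1r.
- by move=> U m w p t; rewrite amulA -extprod_rcons.
Qed.
End ExteriorInduction.

(** * Homogeneous sections and induction on the degree *)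

Section Graded.
Context {K : fieldType} {tau : set (set K)} {X : topologicalType}.
Context {O : ringed_space tau X}.
Variable A : galg O.
Implicit Types (U V W : opn X).

Lemma homogZ i U f (a : A U) : homog i a -> homog i (f *: a).
Proof. by rewrite /homog happZ => ->. Qed.

Lemma homogD i U (a b : A U) : homog i a -> homog i b -> homog i (a + b).
Proof. by rewrite /homog happD => -> ->. Qed.

Lemma homogB i U (a b : A U) : homog i a -> homog i b -> homog i (a - b).
Proof. by rewrite /homog happB => -> ->. Qed.

Lemma homog0 i U : homog i (0 : A U).
Proof. exact: happ0. Qed.

Lemma homog_one U : homog 0 (aone A U).
Proof. exact: gpr_one. Qed.

Lemma homog_fun U f : homog 0 (f *: aone A U).
Proof. exact/homogZ/homog_one. Qed.

Lemma homog_res i U V (h : V `<=` U) (a : A U) :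
  homog i a -> homog i (mres h a).
Proof. by rewrite /homog happ_res => ->. Qed.

Lemma homogM i j U (a b : A U) :
  homog i a -> homog j b -> homog (i + j) (amul a b).
Proof. exact: gpr_mul. Qed.

Lemma homog_gpr i U (a : A U) : homog i (gpr A i U a).
Proof. by rewrite /homog gprK eqxx. Qed.

Lemma gpr_homog i j U (a : A U) :
  homog j a -> gpr A i U a = if i == j then a else 0.
Proof. by move=> ha; rewrite -{1}ha gprK; case: eqP => // ->. Qed.

Lemma homog_local i U (a : A U) :
  (forall x, oset U x -> exists (V : opn X) (h : V `<=` U),
     oset V x /\ homog i (mres h a)) -> homog i a.
Proof.
move=> H; apply: msep => x /H[V [h [Vx p]]]; exists V, h; split=> //.
by rewrite -happ_res.
Qed.

Lemma homog_ind (P : forall U, A U -> Prop) :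
  (forall U (w : A U), (forall x, oset U x -> exists (V : opn X) (h : V `<=` U),
     oset V x /\ P V (mres h w)) -> P U w) ->
  (forall U (v w : A U), P U v -> P U w -> P U (v + w)) ->
  (forall i U (w : A U), homog i w -> P U w) ->
  forall U (w : A U), P U w.
Proof.
move=> Ploc PD Ph U w; apply: Ploc => x Ux.
have [V [h [n [Vx E]]]] := gpr_sum w Ux; exists V, h; split=> //.
rewrite E {E}.
apply: big_ind => [||i _]; [exact: Ph (homog0 0 V)|exact: PD|].
exact: Ph (homog_gpr _ _).
Qed.

Lemma gpr_amul i k U (a b : A U) : homog i a ->
  gpr A (i + k) U (amul a b) = amul a (gpr A k U b).
Proof.
move: U b a; apply: (@homog_ind (fun U b => forall a : A U, homog i a -> _)).
- move=> U b H a ha; apply: msep => x /H[V [h [Vx p]]]; exists V, h; split=> //.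
  by rewrite -!happ_res -!amul_res -!happ_res p//; apply: homog_res.
- by move=> U v w pv pw a ha; rewrite amulDr !happD amulDr pv ?pw.
- move=> j U w hw a ha.
  rewrite (gpr_homog _ (homogM ha hw)) (gpr_homog _ hw) eqn_add2l.
  by case: eqP => // _; rewrite amul0r.
Qed.

Lemma gpr_amul_lt i k U (a b : A U) : homog i a -> (k < i)%N ->
  gpr A k U (amul a b) = 0.
Proof.
move: U b a; apply: (@homog_ind (fun U b => forall a : A U, homog i a -> _)).
- move=> U b H a ha ki; apply: msep => x /H[V [h [Vx p]]]; exists V, h.
  split=> //.
  by rewrite -!happ_res -!amul_res mres0 p//; apply: homog_res.
- by move=> U v w pv pw a ha ki; rewrite amulDr !happD pv ?pw ?addr0.
- move=> j U w hw a ha ki.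
  by rewrite (gpr_homog _ (homogM ha hw)) ltn_eqF// ltn_addr.
Qed.

End Graded.

Section GradedInduction.
Context {K : fieldType} {tau : set (set K)} {X : topologicalType}.
Context {O : ringed_space tau X}.
Variables (N : omod O) (E : exterior N).
Implicit Types (U V W : opn X).

(** [ext_ind] is applied to the claim that all components of w satisfy P: the component of degree k
    + 1 of a product n w is n times the component of degree k of w, and its component of degree 0
    vanishes. *)
Lemma ext_ind_homog (P : nat -> forall U, E U -> Prop) :
  (forall k U (w : E U), (forall x, oset U x ->
     exists (V : opn X) (h : V `<=` U), oset V x /\ P k V (mres h w)) ->
     P k U w) ->
  (forall k U f (v w : E U), P k U v -> P k U w -> P k U (f *: v + w)) ->
  (forall U, P 0 U (aone E U)) ->
  (forall k U (n : N U) (w : E U), homog k w -> P k U w ->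
     P k.+1 U (amul (iota E U n) w)) ->
  forall k U (w : E U), homog k w -> P k U w.
Proof.
move=> Ploc Plin P1 PM.
have P0 k U : P k U 0.
  elim: k => [|k IH].
    by rewrite -(addNr (aone E U)) -scaleN1r; apply: Plin.
  by rewrite -(amul0r (iota E U 0)); apply: PM => //; apply: homog0.
move=> k U w <-; move: k.
move: U w; apply: (@ext_ind _ _ _ _ _ _
  (fun U w => forall k, P k U (gpr E k U w))).
- move=> U w H k; apply: Ploc => x /H[V [h [Vx p]]]; exists V, h; split=> //.
  by rewrite -happ_res.
- by move=> U f v w pv pw k; rewrite happ_lin; apply: Plin.
- move=> U k; rewrite (gpr_homog _ (homog_one E U)).
  by case: eqP => // ->.
- move=> U n w p [|k].
    by rewrite (gpr_amul_lt _ (iota_deg _ n)).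
  rewrite -[k.+1]/(1 + k)%N (gpr_amul _ _ (iota_deg _ n)).
  by apply: PM => //; apply: homog_gpr.
Qed.

End GradedInduction.

(** * The augmentation and the parity automorphism *)

Section Augmentation.
Context {K : fieldType} {tau : set (set K)} {X : topologicalType}.
Context {O : ringed_space tau X}.
Implicit Types (U V W : opn X).

Definition O_omod : omod O.
Proof.
refine (@Build_omod _ _ _ O (fun U => (O U)^o) (@ores _ _ _ O) (osheaf O) _).
by move=> U V h f m n; rewrite oresD oresM.
Defined.

Definition O_oalg : oalg O.
Proof.
refine (@Build_oalg _ _ _ O O_omod (fun U (f g : O U) => f * g)
  (fun U => (1 : O U)) _ _ _ _ _ _ _).
- by move=> U f a b c; rewrite mulrDl; congr (_ + _); apply/esym/mulrA.
- by move=> U f a b c; rewrite mulrDr; congr (_ + _); apply: mulrCA.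
- by move=> U a b c; rewrite mulrA.
- by move=> U a; rewrite mul1r.
- by move=> U a; rewrite mulr1.
- by move=> U V h a b; rewrite -oresM.
- by move=> U V h; apply: ores1.
Defined.

Definition zero_hom (M N : omod O) : omod_hom M N.
Proof.
refine (@Build_omod_hom _ _ _ _ M N (fun U m => 0) _ _).
- by move=> U f m n; rewrite scaler0 addr0.
- by move=> U V h m; rewrite mres0.
Defined.

Definition opp_hom (M N : omod O) (F : omod_hom M N) : omod_hom M N.
Proof.
refine (@Build_omod_hom _ _ _ _ M N (fun U m => - F U m) _ _).
- by move=> U f m n; rewrite happ_lin scalerN opprD.
- by move=> U V h m; rewrite happ_res mresN.
Defined.

Variables (N : omod O) (E : exterior N).

Fact eps_exists : exists g : oalg_hom E O_oalg,
  forall U (n : N U), g U (iota E U n) = 0.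
Proof.
have [|g [gE _]] := @ext_univ _ _ _ _ _ E O_oalg (zero_hom N O_omod).
  by move=> U m; apply: mulr0.
by exists g.
Qed.

(* The augmentation of the exterior algebra. *)
Definition eps U (w : E U) : O U := sval (cid eps_exists) U w.

Lemma eps_lin U f (v w : E U) : eps (f *: v + w) = f * eps v + eps w.
Proof. exact: (happ_lin (sval (cid eps_exists))). Qed.

Lemma epsD U (v w : E U) : eps (v + w) = eps v + eps w.
Proof. exact: (happD (sval (cid eps_exists))). Qed.

Lemma epsN U (v : E U) : eps (- v) = - eps v.
Proof. exact: (happN (sval (cid eps_exists))). Qed.

Lemma eps0 U : eps (0 : E U) = 0.
Proof. exact: (happ0 (sval (cid eps_exists))). Qed.

Lemma epsZ U f (v : E U) : eps (f *: v) = f * eps v.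
Proof. exact: (happZ (sval (cid eps_exists))). Qed.

Lemma eps_res U V (h : V `<=` U) (w : E U) : eps (mres h w) = ores h (eps w).
Proof. exact: (happ_res (sval (cid eps_exists))). Qed.

Lemma epsM U (v w : E U) : eps (amul v w) = eps v * eps w.
Proof. exact: (ahomM (sval (cid eps_exists))). Qed.

Lemma eps1 U : eps (aone E U) = 1.
Proof. exact: (ahom1 (sval (cid eps_exists))). Qed.

Lemma eps_fun U f : eps (f *: aone E U) = f.
Proof. by rewrite epsZ eps1 mulr1. Qed.

Lemma eps_iota U (n : N U) : eps (iota E U n) = 0.
Proof. exact: (svalP (cid eps_exists)). Qed.

Lemma eps_homogS k U (w : E U) : homog k.+1 w -> eps w = 0.
Proof.
suff H : forall k U (w : E U), homog k w -> (0 < k)%N -> eps w = 0.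
  by move=> hw; apply: (H k.+1).
apply: (@ext_ind_homog _ _ _ _ _ _ (fun k U w => (0 < k)%N -> eps w = 0)) => //.
- move=> j V v H j0; apply: osep => x /H[W [h [Wx p]]]; exists W, h.
  by rewrite -eps_res p// ores0.
- by move=> j V f v u pv pu j0; rewrite eps_lin pv// pu// mulr0 addr0.
- by move=> j V n v _ _ _; rewrite epsM eps_iota mul0r.
Qed.

Lemma homog0E U (w : E U) : homog 0 w -> w = eps w *: aone E U.
Proof.
suff H : forall k U (w : E U), homog k w -> k = 0%N -> w = eps w *: aone E U.
  by move=> hw; apply: (H 0%N).
apply: (@ext_ind_homog _ _ _ _ _ _ (fun k U w => k = 0%N -> w = _)) => //.
- move=> j V v H j0; apply: msep => x /H[W [h [Wx p]]]; exists W, h.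
  by rewrite {1}p// mresZ aone_res eps_res.
- move=> j V f v u pv pu j0.
  by rewrite eps_lin {1}pv// {1}pu// scalerDl scalerA.
- by move=> V _; rewrite eps1 scale1r.
Qed.

Lemma eps_inj U (v w : E U) : homog 0 v -> homog 0 w -> eps v = eps w -> v = w.
Proof. by move=> /homog0E {2}-> /homog0E {2}-> ->. Qed.

Fact hat_exists : exists g : oalg_hom E E,
  forall U (n : N U), g U (iota E U n) = - iota E U n.
Proof.
have [|g [gE _]] := @ext_univ _ _ _ _ _ E E (opp_hom (iota E)).
  by move=> U m /=; rewrite amulNl amulNr iota_sq !oppr0.
by exists g.
Qed.

(* The automorphism (-1)^k in degree k. *)
Definition hat : oalg_hom E E := sval (cid hat_exists).

Lemma hat_iota U (n : N U) : hat U (iota E U n) = - iota E U n.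
Proof. exact: (svalP (cid hat_exists)). Qed.

Lemma hat_homog k U (w : E U) : homog k w -> hat U w = (-1) ^+ k *: w.
Proof.
move: k U w.
apply: (@ext_ind_homog _ _ _ _ _ _ (fun k U w => hat U w = (-1) ^+ k *: w)).
- move=> j V v H; apply: msep => x /H[W [h [Wx p]]]; exists W, h.
  by rewrite -happ_res p mresZ ores_sign.
- by move=> j V f v u pv pu; rewrite happ_lin pv pu scalerDr !scalerA mulrC.
- by move=> V; rewrite ahom1 scale1r.
- move=> k V n w _ p.
  by rewrite ahomM hat_iota p amulNl amulZr exprS mulN1r scaleNr.
Qed.

End Augmentation.

(** * Interior products *)

Section Families.
Context {K : fieldType} {tau : set (set K)} {X : topologicalType}.
Context {O : ringed_space tau X}.
Variables (M N : omod O).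

(* Maps of sheaves of sets from M to N over U; contrary to linear maps they can
   be multiplied pointwise when N is an algebra. *)
Record fam (U : opn X) := Fam {
  fev : forall V : opn X, V `<=` U -> M V -> N V;
  fev_res : forall (V W : opn X) (h : V `<=` U) (hW : W `<=` V) (h' : W `<=` U)
    (m : M V), fev h' (mres hW m) = mres hW (fev h m) }.

Lemma famP (U : opn X) (a b : fam U) :
  (forall (V : opn X) (h : V `<=` U) m, fev a h m = fev b h m) -> a = b.
Proof.
case: a => a ar; case: b => b br /= ab.
have E : a = b.
  apply: functional_extensionality_dep => V.
  by apply: functional_extensionality_dep => h; apply: funext => m; apply: ab.
by subst b; congr Fam; apply: Prop_irrelevance.
Qed.

Lemma fev_irr (U V : opn X) (a : fam U) (h h' : V `<=` U) m :
  fev a h m = fev a h' m.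
Proof. by rewrite (Prop_irrelevance h h'). Qed.

Section Ops.
Variable U : opn X.

HB.instance Definition _ := gen_eqMixin (fam U).
HB.instance Definition _ := gen_choiceMixin (fam U).

Program Definition fam_zero : fam U := @Fam U (fun _ _ _ => 0) _.
Next Obligation. by move=> * /=; rewrite mres0. Qed.

Program Definition fam_add (a b : fam U) : fam U :=
  @Fam U (fun V h m => fev a h m + fev b h m) _.
Next Obligation.
by move=> a b V W h hW h' m /=; rewrite mresD !(fev_res _ h hW h').
Qed.

Program Definition fam_scale (f : O U) (a : fam U) : fam U :=
  @Fam U (fun V h m => ores h f *: fev a h m) _.
Next Obligation.
move=> f a V W h hW h' m /=.
by rewrite mresZ (ores_comp h hW h') (fev_res a h hW h').
Qed.

Fact fam_addA : associative fam_add.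
Proof. by move=> a b c; apply: famP => V h m /=; rewrite addrA. Qed.
Fact fam_addC : commutative fam_add.
Proof. by move=> a b; apply: famP => V h m /=; rewrite addrC. Qed.
Fact fam_add0 : left_id fam_zero fam_add.
Proof. by move=> a; apply: famP => V h m /=; rewrite add0r. Qed.
Fact fam_addN : left_inverse fam_zero (fam_scale (-1)) fam_add.
Proof.
by move=> a; apply: famP => V h m /=; rewrite oresN ores1 scaleN1r addNr.
Qed.

HB.instance Definition _ :=
  GRing.isZmodule.Build (fam U) fam_addA fam_addC fam_add0 fam_addN.

Fact fam_scaleA f g a : fam_scale f (fam_scale g a) = fam_scale (f * g) a.
Proof. by apply: famP => V h m /=; rewrite oresM scalerA. Qed.
Fact fam_scale1 : left_id 1 fam_scale.
Proof. by move=> a; apply: famP => V h m /=; rewrite ores1 scale1r. Qed.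
Fact fam_scaleDr : right_distributive fam_scale +%R.
Proof. by move=> f a b; apply: famP => V h m /=; rewrite scalerDr. Qed.
Fact fam_scaleDl a : {morph fam_scale^~ a : f g / f + g}.
Proof. by move=> f g; apply: famP => V h m /=; rewrite oresD scalerDl. Qed.

HB.instance Definition _ := GRing.Zmodule_isLmodule.Build (O U) (fam U)
  fam_scaleA fam_scale1 fam_scaleDr fam_scaleDl.

End Ops.

Program Definition fam_res (U V : opn X) (h : V `<=` U) (a : fam U) : fam V :=
  @Fam V (fun W hW m => fev a (subset_trans hW h) m) _.
Next Obligation. by move=> *; exact: fev_res. Qed.

Lemma fam_sheaf : is_sheaf fam_res.
Proof.
split=> [U h s|U V W hV hW h s|U I W hW s t cov st|U I W hW s cov compat].
- by apply: famP => V hV m /=; apply: fev_irr.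
- by apply: famP => Z hZ m /=; apply: fev_irr.
- apply: famP => V h m; apply: msep => x Vx.
  have [i _ Wx] := cov x (h x Vx).
  exists (opnI V (W i)), (@sub_opnIl _ V (W i)); split=> //.
  have hi := subset_trans (@sub_opnIr _ V (W i)) (hW i).
  rewrite -!(fev_res _ h (@sub_opnIl _ V (W i)) hi).
  have /(congr1 (fun a => fev a (@sub_opnIr _ V (W i))
    (mres (@sub_opnIl _ V (W i)) m))) := st i.
  by rewrite /= !(fev_irr _ _ hi).
have compatE i j (V : opn X) (hi : V `<=` W i) (hj : V `<=` W j) m :
    fev (s i) hi m = fev (s j) hj m.
  have /(congr1 (fun a => fev a (@subset_refl _ V) m)) := compat i j V hi hj.
  by rewrite /= (fev_irr _ _ hi) (fev_irr _ _ hj).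
(* The value at m of the glued family is itself glued, inside N, from the values of the [s i] at the
   restrictions of m. *)
have glue (V : opn X) (h : V `<=` U) (m : M V) : exists t : N V,
    forall i (Z : opn X) (hZ : Z `<=` V) (hi : Z `<=` W i),
    mres hZ t = fev (s i) hi (mres hZ m).
  have [|||t tE] := @mglue _ _ _ _ N V (fun Z (hZ : Z `<=` V) u =>
    forall i (Y : opn X) (hY : Y `<=` Z) (hi : Y `<=` W i),
      mres hY u = fev (s i) hi (mres (subset_trans hY hZ) m)).
  - move=> Z Y hZ hY hYV u H i Y' hY' hi; rewrite mres_compE (H i _ _ hi).
    by congr fev; apply: mres_irr.
  - move=> Z hZ u v Hu Hv; apply: msep => x Zx.
    have [i _ Wx] := cov x (h x (hZ x Zx)).
    exists (opnI Z (W i)), (@sub_opnIl _ Z (W i)); split=> //.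
    by rewrite (Hu i _ _ (@sub_opnIr _ _ _)) (Hv i _ _ (@sub_opnIr _ _ _)).
  - move=> x Vx; have [i _ Wx] := cov x (h x Vx).
    pose Z := opnI V (W i).
    exists Z, (@sub_opnIl _ V (W i)),
      (fev (s i) (@sub_opnIr _ V (W i)) (mres (@sub_opnIl _ V (W i)) m)).
    split=> // j Y hY hj.
    have hi : Y `<=` W i := subset_trans hY (@sub_opnIr _ V (W i)).
    rewrite -(fev_res _ _ _ hi) mres_compE (compatE i j _ hi hj).
    by congr fev; apply: mres_irr.
  exists t => i Z hZ hi; apply: msep => x Zx.
  have [Y [hY [Yx H]]] := tE x (hZ x Zx).
  exists (opnI Z Y), (@sub_opnIl _ Z Y); split=> //.
  have hi' : opnI Z Y `<=` W i := subset_trans (@sub_opnIl _ Z Y) hi.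
  have := H i (opnI Z Y) (@sub_opnIr _ Z Y) hi'; rewrite !mres_compE.
  rewrite (mres_irr _ (subset_trans (@sub_opnIl _ Z Y) hZ)) => ->.
  rewrite -(fev_res _ _ _ hi') mres_compE.
  by congr fev; apply: mres_irr.
pose t (V : opn X) (h : V `<=` U) (m : M V) : N V := sval (cid (glue V h m)).
have tE (V : opn X) (h : V `<=` U) m :
    forall i (Z : opn X) (hZ : Z `<=` V) (hi : Z `<=` W i),
    mres hZ (t V h m) = fev (s i) hi (mres hZ m).
  exact: (svalP (cid (glue V h m))).
have tres (V Z : opn X) (h : V `<=` U) (hZ : Z `<=` V) (h' : Z `<=` U)
    (m : M V) : t Z h' (mres hZ m) = mres hZ (t V h m).
  apply: msep => x Zx; have [i _ Wx] := cov x (h' x Zx).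
  exists (opnI Z (W i)), (@sub_opnIl _ Z (W i)); split=> //.
  rewrite mres_compE !(tE _ _ _ i _ _ (@sub_opnIr _ _ _)) mres_compE //.
exists (Fam tres) => i; apply: famP => V h m /=.
rewrite -[LHS](mres_id (@subset_refl _ V)) (tE _ _ _ i _ _ h) mres_id.
by [].
Qed.

Fact fam_res_lin (U V : opn X) (h : V `<=` U) (f : O U) (a b : fam U) :
  fam_res h (f *: a + b) = ores h f *: fam_res h a + fam_res h b.
Proof.
apply: famP => W hW m /=.
by rewrite (ores_comp h hW (subset_trans hW h)).
Qed.

Definition fam_omod : omod O :=
  {| msec := fun U => fam U : lmodType (O U);
     mres := fam_res; msheaf := fam_sheaf; mres_lin := fam_res_lin |}.

Definition prod_res (U V : opn X) (h : V `<=` U) (a : M U * N U) : M V * N V :=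
  (mres h a.1, mres h a.2).

Lemma prod_sheaf : is_sheaf prod_res.
Proof.
split=> [U h s|U V W hV hW h s|U I W hW s t cov st|U I W hW s cov compat].
- by rewrite /prod_res !mres_id; case: s.
- by rewrite /prod_res /= !(mres_comp hV hW h).
- case: s t st => [s1 s2] [t1 t2] st; congr pair.
    apply: (sheaf_sep (msheaf M) (hW := hW)) cov _ => i.
    by have [] := st i.
  apply: (sheaf_sep (msheaf N) (hW := hW)) cov _ => i.
  by have [] := st i.
have [||t1 t1E] := @sheaf_glue _ _ _ (msheaf M) U I W hW (fun i => (s i).1).
- exact: cov.
- by move=> i j V hi hj; have [] := compat i j V hi hj.
have [||t2 t2E] := @sheaf_glue _ _ _ (msheaf N) U I W hW (fun i => (s i).2).
- exact: cov.
- by move=> i j V hi hj; have [] := compat i j V hi hj.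
by exists (t1, t2) => i; rewrite /prod_res /= t1E t2E; case: (s i).
Qed.

Fact prod_res_lin (U V : opn X) (h : V `<=` U) (f : O U) (a b : M U * N U) :
  prod_res h (f *: a + b) = ores h f *: prod_res h a + prod_res h b.
Proof. by rewrite /prod_res /= !mres_lin. Qed.

Definition prod_omod : omod O :=
  {| msec := fun U => (M U * N U)%type : lmodType (O U);
     mres := prod_res; msheaf := prod_sheaf; mres_lin := prod_res_lin |}.

End Families.

Section Contraction.
Context {K : fieldType} {tau : set (set K)} {X : topologicalType}.
Context {O : ringed_space tau X}.
Implicit Types (U V W : opn X).

(** Stated for abstract M and N so that the same calculus covers both [dual_pairing] and
    [eval_pairing]. *)
Record pairing (M N : omod O) := Pairing {
  pair_fun :> forall U : opn X, N U -> M U -> O U;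
  pair_linl : forall (U : opn X) f (n n' : N U) (a : M U),
    pair_fun (f *: n + n') a = f * pair_fun n a + pair_fun n' a;
  pair_linr : forall (U : opn X) f (n : N U) (a a' : M U),
    pair_fun n (f *: a + a') = f * pair_fun n a + pair_fun n a';
  pair_res : forall (U V : opn X) (h : V `<=` U) (n : N U) (a : M U),
    pair_fun (mres h n) (mres h a) = ores h (pair_fun n a) }.

Variables (M N : omod O) (b : pairing M N) (E : exterior N).
Local Notation ctr_mod := (prod_omod E (fam_omod M E)).

(* As the interior products are antiderivations, this is the product for which
   w |-> (w, a |-> i_a w) is multiplicative. *)
Program Definition ctr_mul U (x y : ctr_mod U) : ctr_mod U :=
  (amul x.1 y.1,
   @Fam _ _ _ _ M E U (fun V h a => amul (fev x.2 h a) (mres h y.1) +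
      amul (mres h (hat E U x.1)) (fev y.2 h a)) _).
Next Obligation.
move=> U x y V W h hW h' a /=.
by rewrite mresD -!amul_res !(mres_comp h hW h') !(fev_res _ h hW h').
Qed.

Definition ctr_alg : oalg O.
Proof.
refine (@Build_oalg _ _ _ O ctr_mod ctr_mul (fun U => (aone E U, 0))
  _ _ _ _ _ _ _).
- move=> U f x y z; congr pair => /=; first exact: amul_linl.
  apply: famP => V h a /=.
  rewrite amul_linl happ_lin mres_lin amul_linl scalerDr.
  by rewrite addrACA.
- move=> U f x y z; congr pair => /=; first exact: amul_linr.
  apply: famP => V h a /=.
  rewrite mres_lin !amul_linr scalerDr.
  by rewrite addrACA.
- move=> U x y z; congr pair => /=; first exact: amulA.
  apply: famP => V h a /=.
  by rewrite amulDr amulDl ahomM -!amul_res !amulA addrA.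
- move=> U [w p]; congr pair => /=; first exact: amul1l.
  apply: famP => V h a /=.
  by rewrite amul0l add0r ahom1 aone_res amul1l.
- move=> U [w p]; congr pair => /=; first exact: amul1r.
  apply: famP => V h a /=.
  by rewrite amul0r addr0 aone_res amul1r.
- move=> U V h x y; congr pair => /=; first exact: amul_res.
  apply: famP => W k a /=.
  by rewrite happ_res !mres_compE.
- move=> U V h; congr pair; first exact: aone_res.
  by apply: famP => W k a.
Defined.

Program Definition ctr_gen U (n : N U) : ctr_mod U :=
  (iota E U n, @Fam _ _ _ _ M E U
    (fun V h a => b V (mres h n) a *: aone E V) _).
Next Obligation.
move=> U n V W h hW h' a /=.
by rewrite -(mres_comp h hW h') pair_res mresZ aone_res.
Qed.

Definition ctr_gen_hom : omod_hom N ctr_alg.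
Proof.
refine (@Build_omod_hom _ _ _ _ N ctr_alg ctr_gen _ _).
- move=> U f m n; congr pair => /=; first exact: happ_lin.
  apply: famP => V h a /=.
  by rewrite mres_lin pair_linl scalerDl scalerA.
- move=> U V h n; congr pair; first exact: happ_res.
  by apply: famP => W k a /=; rewrite mres_compE.
Defined.

(** The generator (n, a |-> b(n, a)) squares to zero in [ctr_alg]: the sign of [hat] makes the two
    terms b(n, a) n of its second component cancel. *)
Fact ctr_exists : exists g : oalg_hom E ctr_alg,
  forall U (n : N U), g U (iota E U n) = ctr_gen n.
Proof.
have [|g [gE _]] := @ext_univ _ _ _ _ _ E ctr_alg ctr_gen_hom; last by exists g.
move=> U n; congr pair => /=; first exact: iota_sq.
apply: famP => V h a /=; rewrite hat_iota mresN amulNl.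
by rewrite amulZl amulZr amul1l amul1r subrr.
Qed.

Definition ctr_hom := sval (cid ctr_exists).

(** This turns the multiplicativity of [ctr_hom] into the antiderivation rule [ctr_hat]. *)
Lemma ctr_hom1 U (w : E U) : (ctr_hom U w : ctr_mod U).1 = w.
Proof.
move: U w; apply: ext_ind.
- move=> U w H; apply: msep => x /H[V [h [Vx p]]]; exists V, h; split=> //.
  by rewrite -[RHS]p happ_res.
- by move=> U f v w pv pw; rewrite happ_lin /= pv pw.
- by move=> U; rewrite ahom1.
- move=> U n w p; rewrite ahomM /= p.
  by rewrite /ctr_hom (svalP (cid ctr_exists)).
Qed.

(* The interior product by a section of M. *)
Definition ctr U (a : M U) (w : E U) : E U :=
  fev (ctr_hom U w : ctr_mod U).2 (@subset_refl _ U) a.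

Lemma ctr_lin U f (a : M U) (v w : E U) :
  ctr a (f *: v + w) = f *: ctr a v + ctr a w.
Proof. by rewrite /ctr happ_lin /= ores_id. Qed.

Lemma ctrD U (a : M U) (v w : E U) : ctr a (v + w) = ctr a v + ctr a w.
Proof. by rewrite -[v]scale1r ctr_lin !scale1r. Qed.

Lemma ctr0r U (a : M U) : ctr a (0 : E U) = 0.
Proof. by apply: (addrI (ctr a 0)); rewrite -ctrD !addr0. Qed.

Lemma ctrN U (a : M U) (v : E U) : ctr a (- v) = - ctr a v.
Proof. by apply: (addrI (ctr a v)); rewrite -ctrD !subrr ctr0r. Qed.

Lemma ctrB U (a : M U) (v w : E U) : ctr a (v - w) = ctr a v - ctr a w.
Proof. by rewrite ctrD ctrN. Qed.

Lemma ctrZ U f (a : M U) (v : E U) : ctr a (f *: v) = f *: ctr a v.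
Proof. by rewrite -[f *: v]addr0 ctr_lin ctr0r addr0. Qed.

Lemma ctr_res U V (h : V `<=` U) (a : M U) (w : E U) :
  ctr (mres h a) (mres h w) = mres h (ctr a w).
Proof.
rewrite /ctr happ_res /= -(fev_res _ (@subset_refl _ U) h h).
exact: fev_irr.
Qed.

Lemma ctr_hat U (a : M U) (v w : E U) :
  ctr a (amul v w) = amul (ctr a v) w + amul (hat E U v) (ctr a w).
Proof. by rewrite /ctr ahomM /= !mres_id !ctr_hom1. Qed.

Lemma ctr1 U (a : M U) : ctr a (aone E U) = 0.
Proof. by rewrite /ctr ahom1. Qed.

Lemma ctr_fun U f (a : M U) : ctr a (f *: aone E U) = 0.
Proof. by rewrite ctrZ ctr1 scaler0. Qed.

Lemma ctr_iota U (a : M U) (n : N U) : ctr a (iota E U n) = b U n a *: aone E U.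
Proof. by rewrite /ctr /ctr_hom (svalP (cid ctr_exists)) /= mres_id. Qed.

Lemma ctr_iotaM U (a : M U) (n : N U) (w : E U) :
  ctr a (amul (iota E U n) w) = b U n a *: w - amul (iota E U n) (ctr a w).
Proof. by rewrite ctr_hat ctr_iota hat_iota amulNl amulZl amul1l. Qed.

Lemma ctrM k U (a : M U) (v w : E U) : homog k v ->
  ctr a (amul v w) = amul (ctr a v) w + (-1) ^+ k *: amul v (ctr a w).
Proof. by move=> /hat_homog hv; rewrite ctr_hat hv amulZl. Qed.

(** Families are mere maps of sets in a, so linearity in a has to be carried from the generators,
    where it is that of the pairing, to all w. *)
Lemma ctr_linl U f (a a' : M U) (w : E U) :
  ctr (f *: a + a') w = f *: ctr a w + ctr a' w.
Proof.
move: U w f a a'.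
apply: (@ext_ind _ _ _ _ _ _ (fun U w => forall f a a', ctr _ w = _)).
- move=> U w H f a a'; apply: msep => x /H[V [h [Vx p]]]; exists V, h.
  by split=> //; rewrite -ctr_res mres_lin p !ctr_res -mres_lin.
- move=> U f v w pv pw g a a'.
  rewrite !ctr_lin pv pw !scalerDr !scalerA mulrC; abel.
- by move=> U f a a'; rewrite !ctr1 scaler0 addr0.
- move=> U n w p f a a'.
  rewrite !ctr_iotaM p pair_linr amulDr amulZr scalerDl scalerBr scalerA.
  abel.
Qed.

Lemma ctr0l U (w : E U) : ctr 0 w = 0.
Proof. by rewrite -(addNr 0) -scaleN1r ctr_linl scaleN1r addNr. Qed.

Lemma ctrNl U (a : M U) (w : E U) : ctr (- a) w = - ctr a w.
Proof. by rewrite -scaleN1r -[_ *: _]addr0 ctr_linl ctr0l addr0 scaleN1r. Qed.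

Lemma ctrDl U (a a' : M U) (w : E U) : ctr (a + a') w = ctr a w + ctr a' w.
Proof. by rewrite -[a]scale1r ctr_linl !scale1r. Qed.

Lemma ctr_anti U (a a' : M U) (w : E U) : ctr a (ctr a' w) = - ctr a' (ctr a w).
Proof.
move: U w a a'; apply: (@ext_ind _ _ _ _ _ _ (fun U w => forall a a', _ = _)).
- move=> U w H a a'; apply: msep => x /H[V [h [Vx p]]]; exists V, h.
  by split=> //; rewrite mresN -!ctr_res p.
- by move=> U f v w pv pw a a'; rewrite !ctr_lin pv pw scalerN opprD.
- by move=> U a a'; rewrite !ctr1 !ctr0r oppr0.
- move=> U n w p a a'; rewrite !ctr_iotaM !ctrB !ctrZ !ctr_iotaM p amulNr.
  abel.
Qed.

Lemma ctr_sq U (a : M U) (w : E U) : ctr a (ctr a w) = 0.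
Proof.
move: U w a; apply: (@ext_ind _ _ _ _ _ _ (fun U w => forall a, _ = _)).
- move=> U w H a; apply: msep => x /H[V [h [Vx p]]]; exists V, h.
  by split=> //; rewrite mres0 -!ctr_res p.
- by move=> U f v w pv pw a; rewrite !ctr_lin pv pw scaler0 addr0.
- by move=> U a; rewrite !ctr1 !ctr0r.
- move=> U n w p a; rewrite !ctr_iotaM !ctrB !ctrZ !ctr_iotaM p amul0r.
  abel.
Qed.

Lemma ctr_homog0 U (a : M U) (w : E U) : homog 0 w -> ctr a w = 0.
Proof. by move=> /homog0E ->; apply: ctr_fun. Qed.

Lemma ctr_homog k U (a : M U) (w : E U) : homog k.+1 w -> homog k (ctr a w).
Proof.
(* The predecessor makes the induction uniform: in degree 0 the contraction is 0, which is
   homogeneous of degree 0 as well. *)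
suff H : forall k U (w : E U), homog k w -> forall a, homog k.-1 (ctr a w).
  by move=> hw; apply: (H k.+1).
apply: (@ext_ind_homog _ _ _ _ _ _
  (fun k U w => forall a, homog k.-1 (ctr a w))).
- move=> j V v H c; apply: homog_local => x /H[W [h [Wx p]]]; exists W, h.
  by rewrite -ctr_res.
- move=> j V f v u pv pu c; rewrite ctr_lin.
  by apply: homogD; [apply: homogZ; apply: pv|apply: pu].
- by move=> V c; rewrite ctr1; apply: homog0.
- move=> [|j] V n v hv p c; rewrite ctr_iotaM; apply: homogB; try exact: homogZ.
    by rewrite ctr_homog0// amul0r; apply: homog0.
  exact: (homogM (iota_deg E n) (p c)).
Qed.

End Contraction.

(** * The determinant pairing *)

Section Omit.
Variable T : Type.

Lemma omit0 (x : T) s : omit 0 (x :: s) = s.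
Proof. by rewrite /omit /= drop0. Qed.

Lemma omitS i (x : T) s : omit i.+1 (x :: s) = x :: omit i s.
Proof. by []. Qed.

Lemma map_omit (R : Type) (f : T -> R) i s :
  map f (omit i s) = omit i (map f s).
Proof. by rewrite /omit map_cat map_take map_drop. Qed.

Lemma size_omit i (s : seq T) : (i < size s)%N -> size (omit i s) = (size s).-1.
Proof.
elim: s i => [|x s IH] [|i] //; first by rewrite omit0.
by rewrite ltnS omitS [LHS]/= => ilt; rewrite IH//; case: s ilt {IH}.
Qed.

Lemma nth_omit (x0 : T) i j s : nth x0 (omit i s) j = nth x0 s (bump i j).
Proof.
elim: s i j => [|x s IH] i j; first by rewrite /omit /= !nth_nil.
case: i => [|i]; first by rewrite omit0.
by case: j => [|j] //=; rewrite -/(omit i s) IH /bump ltnS addnS.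
Qed.

End Omit.

Section DetPairing.
Context {K : fieldType} {tau : set (set K)} {X : topologicalType}.
Context {O : ringed_space tau X}.
Variables (M N : omod O) (b : pairing M N) (E : exterior N).
Implicit Types (U V W : opn X).
Local Notation ctr := (ctr b).

Lemma ctr_extprod m U (a : M U) (t : seq (N U)) : size t = m ->
  ctr a (extprod E t) =
  \sum_(j < m) ((-1) ^+ j * b U (nth 0 t j) a) *: extprod E (omit j t).
Proof.
elim: t m => [|n t IH] m <- /=; first by rewrite big_ord0 ctr1.
rewrite ctr_iotaM (IH _ erefl) big_ord_recl /= omit0 mul1r; congr (_ + _).
rewrite amul_sumr -sumrN; apply: eq_bigr => i _.
by rewrite exprS mulN1r mulNr scaleNr -amulZr.
Qed.

(** The determinant pairing as an iterated contraction, which makes sense for every section w and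
    not only for products of generators. *)
Definition dpc U (w : E U) (s : seq (M U)) : O U :=
  eps (foldl (fun w a => ctr a w) w s).

Lemma dpc_cons U (w : E U) a s : dpc w (a :: s) = dpc (ctr a w) s.
Proof. by []. Qed.

Lemma dpc_lin U f (v w : E U) s : dpc (f *: v + w) s = f * dpc v s + dpc w s.
Proof.
elim: s v w => [|a s IH] v w; first exact: eps_lin.
by rewrite !dpc_cons ctr_lin IH.
Qed.

Lemma dpcD U (v w : E U) s : dpc (v + w) s = dpc v s + dpc w s.
Proof. by rewrite -[v]scale1r dpc_lin scale1r mul1r. Qed.

Lemma dpc0 U s : dpc (0 : E U) s = 0.
Proof. by apply: (addrI (dpc 0 s)); rewrite -dpcD !addr0. Qed.

Lemma dpcZ U f (v : E U) s : dpc (f *: v) s = f * dpc v s.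
Proof. by rewrite -[f *: v]addr0 dpc_lin dpc0 addr0. Qed.

Lemma dpcN U (v : E U) s : dpc (- v) s = - dpc v s.
Proof. by rewrite -scaleN1r dpcZ mulN1r. Qed.

Lemma dpc_sum U s I (r : seq I) P (F : I -> E U) :
  dpc (\sum_(i <- r | P i) F i) s = \sum_(i <- r | P i) dpc (F i) s.
Proof.
exact: (big_morph (fun w => dpc w s) (fun v w => dpcD v w s) (dpc0 s)).
Qed.

Lemma dpc_res U V (h : V `<=` U) (w : E U) (s : seq (M U)) :
  dpc (mres h w) (map (mres h) s) = ores h (dpc w s).
Proof.
elim: s w => [|a s IH] w; first exact: eps_res.
by rewrite /= !dpc_cons ctr_res IH.
Qed.

Lemma dpc_deg k U (w : E U) (s : seq (M U)) :
  homog k w -> size s != k -> dpc w s = 0.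
Proof.
elim: s k w => [|a s IH] [|k] w //= hw.
- by move=> _; apply: eps_homogS hw.
- by move=> _; rewrite dpc_cons ctr_homog0// dpc0.
- by move=> sk; rewrite dpc_cons; apply: (IH k) => //; apply: ctr_homog.
Qed.

Lemma dpc_swap U (w : E U) a a' s :
  dpc w (a :: a' :: s) = - dpc w (a' :: a :: s).
Proof. by rewrite !dpc_cons ctr_anti dpcN. Qed.

(** Contracting by the first argument is the Laplace expansion of the determinant along its first
    column. *)
Lemma dpc_det U (t : seq (N U)) (s : seq (M U)) : size t = size s ->
  dpc (extprod E t) s =
  \det (\matrix_(i < size s, j < size s) b U (nth 0 t i) (nth 0 s j)).
Proof.
elim: s t => [|a s IH] t ts.
  by case: t ts => // _; rewrite det_mx00 /dpc /= eps1.
rewrite dpc_cons (ctr_extprod _ ts) dpc_sum (expand_det_col _ ord0).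
apply: eq_bigr => i _; rewrite dpcZ mxE /=.
rewrite IH; last by rewrite size_omit ts /= ?ltn_ord.
rewrite /cofactor addn0 [_ ^+ _ * b _ _ _]mulrC -mulrA; congr (_ * (_ * _)).
congr (\det _); apply/matrixP => p q; rewrite !mxE nth_omit.
by [].
Qed.

Definition ctr_pairing : det_pairing b E.
Proof.
apply: (@Build_det_pairing _ _ _ _ M N b E dpc).
- exact: dpc_lin.
- exact: dpc_res.
- exact: dpc_deg.
- by move=> U t s ts; rewrite extprodE; apply: dpc_det.
Defined.

Lemma homog_extprod U (t : seq (N U)) : homog (size t) (extprod E t).
Proof.
elim: t => [|n t IH] /=; first exact: homog_one.
exact: (homogM (iota_deg E n) IH).
Qed.

(** Products of generators span E locally, and on them a pairing is a determinant or, for reasons of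
    degree, zero. Hence the pairing stored in any [ce_differential] may be replaced by [dpc]. *)
Lemma det_pairing_uniq (p : det_pairing b E) U (w : E U) s : p U w s = dpc w s.
Proof.
move: U w s; apply: (@ext_span _ _ _ _ _ _ (fun U w => forall s, _ = _)).
- move=> U w H s; apply: osep => x /H[V [h [Vx e]]]; exists V, h.
  by split=> //; rewrite -dpc_res -dp_res e.
- by move=> U f v w pv pw s; rewrite dp_lin dpc_lin pv pw.
- move=> U t s; have [ts|ts] := eqVneq (size t) (size s).
    by rewrite dpc_det// -(dp_det p)// extprodE.
  have ht := homog_extprod t.
  by rewrite (dp_deg p ht) 1?eq_sym// (dpc_deg ht)// eq_sym.
Qed.

End DetPairing.

(** * Nondegeneracy of contractions and evaluations *)

Section Nondegenerate.
Context {K : fieldType} {tau : set (set K)} {X : topologicalType}.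
Context {O : ringed_space tau X}.
Hypothesis hK : base_field tau.
Implicit Types (U V W : opn X).

(** The reconstruction formula of a pair of dual bases, on which the nondegeneracy of the pairing
    and the Euler operator rest. *)
Definition frame (M N : omod O) (b : pairing M N) V k (e : 'I_k -> N V)
    (a : 'I_k -> M V) : Prop :=
  forall W (h : W `<=` V) (n : N W),
    n = \sum_i b W n (mres h (a i)) *: mres h (e i).

Definition framed (M N : omod O) (b : pairing M N) : Prop :=
  forall x : X, exists V k (e : 'I_k -> N V) (a : 'I_k -> M V),
    oset V x /\ frame b e a.

Variables (M N : omod O) (b : pairing M N) (E : exterior N).
Local Notation ctr := (ctr b).

Lemma pairing_inj U (n n' : N U) : framed b ->
  (forall V (h : V `<=` U) (a : M V), b V (mres h n) a = b V (mres h n') a) ->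
  n = n'.
Proof.
move=> fb H; apply: msep => x Ux; have [V [k [e [a [Vx fr]]]]] := fb x.
exists (opnI U V), (@sub_opnIl _ U V); split=> //.
rewrite [LHS](fr _ (@sub_opnIr _ U V)) [RHS](fr _ (@sub_opnIr _ U V)).
by apply: eq_bigr => i _; rewrite H.
Qed.

Lemma iota_anti U (n n' : N U) :
  amul (iota E U n) (iota E U n') = - amul (iota E U n') (iota E U n).
Proof.
apply/eqP; rewrite -addr_eq0; apply/eqP.
have := iota_sq E (n + n').
by rewrite happD !(amulDl, amulDr) !iota_sq add0r addr0.
Qed.

(** A new factor n adds 1 to the eigenvalue: its own contractions rebuild n by the frame formula,
    and in the other terms moving e_i past n undoes the sign of the antiderivation. *)
Lemma euler V r (e : 'I_r -> N V) (a : 'I_r -> M V) : frame b e a ->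
  forall k W (w : E W), homog k w -> forall h : W `<=` V,
  \sum_i amul (iota E W (mres h (e i))) (ctr (mres h (a i)) w) = k%:R *: w.
Proof.
move=> fr.
apply: (@ext_ind_homog _ _ _ _ _ _ (fun k W w => forall h : W `<=` V, _ = _)).
- move=> k W w H h; apply: msep => x /H[Z [j [Zx p]]]; exists Z, j; split=> //.
  rewrite mresZ; have -> : ores j (k%:R : O W) = k%:R.
    by rewrite -!ocst_nat ocst_res.
  rewrite -(p (subset_trans j h)) mres_sum; apply: eq_bigr => i _.
  by rewrite -amul_res -happ_res -ctr_res !mres_compE.
- move=> k W f v w pv pw h; rewrite scalerDr scalerA mulrC -scalerA.
  rewrite -(pv h) -(pw h).
  rewrite scaler_sumr -big_split /=; apply: eq_bigr => i _.
  by rewrite ctr_lin amul_linr.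
- move=> W h; rewrite scale0r big1// => i _.
  by rewrite ctr1 amul0r.
- move=> k W n w hw p h.
  rewrite -natr1 scalerDl scale1r addrC -amulZr -(p h).
  rewrite {2}(fr W h n) happ_sum amul_suml amul_sumr -big_split /=.
  apply: eq_bigr => i _; rewrite ctr_iotaM amulDr amulZr happZ amulZl.
  by congr (_ + _); rewrite amulNr !amulA iota_anti amulNl opprK.
Qed.

Hypothesis fb : framed b.

(** The contractions are tested over all smaller opens, since M may have too few sections over U;
    local frames then make the Euler operator available. *)
Lemma ctr_inj0 k U (w : E U) : homog k.+1 w ->
  (forall V (h : V `<=` U) (a : M V), ctr a (mres h w) = 0) -> w = 0.
Proof.
move=> hw H; apply: msep => x Ux; have [V [r [e [a [Vx fr]]]]] := fb x.
exists (opnI U V), (@sub_opnIl _ U V); split=> //; rewrite mres0.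
apply: (natmul_eq0 hK (n := k)).
rewrite -(euler fr (homog_res _ hw) (@sub_opnIr _ U V)).
by rewrite big1// => i _; rewrite H amul0r.
Qed.

Lemma ctr_inj k U (v w : E U) : homog k.+1 v -> homog k.+1 w ->
  (forall V (h : V `<=` U) (a : M V),
    ctr a (mres h v) = ctr a (mres h w)) -> v = w.
Proof.
move=> hv hw H; apply/eqP; rewrite -subr_eq0; apply/eqP.
apply: (@ctr_inj0 k); first exact: homogB.
by move=> V h a; rewrite mresB ctrB H subrr.
Qed.

Lemma dpc_inj0 k U (w : E U) : homog k w ->
  (forall V (h : V `<=` U) (s : seq (M V)), size s = k ->
    dpc b (mres h w) s = 0) -> w = 0.
Proof.
elim: k U w => [|k IH] U w hw H.
  rewrite (homog0E hw); have := H U (@subset_refl _ U) [::] erefl.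
  by rewrite mres_id /dpc /= => ->; rewrite scale0r.
apply: (ctr_inj0 hw) => V h a; apply: IH => [|W k' s sk].
  by apply: ctr_homog; apply: homog_res.
have := H W (subset_trans k' h) (mres k' a :: s).
by rewrite /= sk dpc_cons -ctr_res mres_compE; apply.
Qed.

Lemma dpc_inj k U (v w : E U) : homog k v -> homog k w ->
  (forall V (h : V `<=` U) (s : seq (M V)), size s = k ->
    dpc b (mres h v) s = dpc b (mres h w) s) -> v = w.
Proof.
move=> hv hw H; apply/eqP; rewrite -subr_eq0; apply/eqP.
apply: (@dpc_inj0 k); first exact: homogB.
by move=> V h a sa; rewrite mresB dpcD dpcN H// subrr.
Qed.

Lemma iota_inj U : injective (iota E U).
Proof.
move=> n n' H; apply: (pairing_inj fb) => V h a.
have /(congr1 (fun w => eps (ctr a (mres h w)))) := H.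
by rewrite -!happ_res !ctr_iota !eps_fun.
Qed.

(** In degree 1 the Euler operator is the identity and writes w locally as a combination of the e_i,
    with coefficients the contractions by the a_i. The local solutions glue because [iota] is
    injective. *)
Lemma homog1E U (w : E U) : homog 1 w -> exists n, w = iota E U n.
Proof.
move=> hw.
have [|||n nE] := @mglue _ _ _ _ N U (fun V h n => mres h w = iota E V n).
- by move=> V W h hW h' n p; rewrite -(mres_comp h hW h') p happ_res.
- by move=> V h n n' -> /iota_inj.
- move=> x Ux; have [V [r [e [a [Vx fr]]]]] := fb x.
  exists (opnI U V), (@sub_opnIl _ U V).
  set v := mres _ w; have hv : homog 1 v by apply: homog_res.
  pose h := @sub_opnIr _ U V.
  exists (\sum_i eps (ctr (mres h (a i)) v) *: mres h (e i)); split=> //.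
  rewrite -[LHS]scale1r -(euler fr hv h) happ_sum; apply: eq_bigr => i _.
  rewrite {1}[ctr _ _]homog0E ?amulZr ?amul1r ?happZ//.
  exact: ctr_homog.
exists n; apply: msep => x /nE[V [h [Vx p]]]; exists V, h; split=> //.
by rewrite p happ_res.
Qed.

(** The default 0 makes the inverse total; for a framed pairing it is never reached in degree 1. *)
Definition iota_inv U (w : E U) : N U :=
  if pselect (exists n, w = iota E U n) is left H then sval (cid H) else 0.

Lemma iota_invK U (w : E U) : homog 1 w -> iota E U (iota_inv w) = w.
Proof.
move=> /homog1E H; rewrite /iota_inv; case: pselect => // H'.
by rewrite -(svalP (cid H')).
Qed.

End Nondegenerate.

(** * Cartan calculus *)

Section Operators.
Context {K : fieldType} {tau : set (set K)} {X : topologicalType}.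
Context {O : ringed_space tau X}.
Implicit Types (U V W : opn X).

(** What Chevalley-Eilenberg and strong differentials have in common before any product rule is
    known. *)
Record operator (A : galg O) := Operator {
  op :> forall U : opn X, A U -> A U;
  op_res : forall (U V : opn X) (h : V `<=` U) (w : A U),
    op (mres h w) = mres h (op w);
  op_lin : forall (U : opn X) c (v w : A U),
    op (ocst O c *: v + w) = ocst O c *: op v + op w;
  op_deg : forall k (U : opn X) (w : A U), homog k w -> homog k.+1 (op w) }.

(** A bracket and an action without algebraic axioms, so that Cartan's relations can be stated
    before the Jacobi and Leibniz identities are available. *)
Record raw_lie (M : omod O) := RawLie {
  rbr : forall U : opn X, M U -> M U -> M U;
  ract : forall U : opn X, M U -> O U -> O U;
  rbr_res : forall (U V : opn X) (h : V `<=` U) (a a' : M U),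
    rbr (mres h a) (mres h a') = mres h (rbr a a');
  ract_res : forall (U V : opn X) (h : V `<=` U) (a : M U) (f : O U),
    ract (mres h a) (ores h f) = ores h (ract a f) }.

Variables (A : galg O) (d : operator A) (U : opn X).

Lemma opD (v w : A U) : d U (v + w) = d U v + d U w.
Proof. by rewrite -[v]scale1r -(ocst1 U) op_lin ocst1 !scale1r. Qed.

Lemma op0 : d U 0 = 0.
Proof. by apply: (addrI (d U 0)); rewrite -opD !addr0. Qed.

Lemma opN (v : A U) : d U (- v) = - d U v.
Proof. by apply: (addrI (d U v)); rewrite -opD !subrr op0. Qed.

Lemma opB (v w : A U) : d U (v - w) = d U v - d U w.
Proof. by rewrite opD opN. Qed.

Lemma opZsign n (v : A U) : d U ((-1) ^+ n *: v) = (-1) ^+ n *: d U v.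
Proof.
by elim: n v => [|n IH] v; rewrite ?scale1r// exprS -!scalerA !scaleN1r opN IH.
Qed.

End Operators.

Section Cartan.
Context {K : fieldType} {tau : set (set K)} {X : topologicalType}.
Context {O : ringed_space tau X}.
Implicit Types (U V W : opn X).
Hypothesis hK : base_field tau.
Variables (M N : omod O) (b : pairing M N) (E : exterior N).
Variables (d : operator E) (R : raw_lie M).
Local Notation ctr := (ctr b).
Local Notation dpc := (dpc b).
Local Notation br := (rbr R).
Local Notation act := (ract R).

(* Locked, lest the linearity of [ctr] or of [d] be used to unfold it. *)
Definition lied U (a : M U) (w : E U) : E U :=
  locked (ctr a (d U w) + d U (ctr a w)).

Lemma liedE U (a : M U) (w : E U) : lied a w = ctr a (d U w) + d U (ctr a w).
Proof. by rewrite /lied -lock. Qed.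

Lemma lied_res U V (h : V `<=` U) (a : M U) (w : E U) :
  lied (mres h a) (mres h w) = mres h (lied a w).
Proof. by rewrite !liedE op_res !ctr_res op_res mresD. Qed.

Lemma liedD U (a : M U) (v w : E U) : lied a (v + w) = lied a v + lied a w.
Proof. by rewrite !liedE opD !ctrD opD; abel. Qed.

Lemma lied0 U (a : M U) : lied a (0 : E U) = 0.
Proof. by rewrite !liedE op0 ctr0r op0 addr0. Qed.

Lemma liedN U (a : M U) (v : E U) : lied a (- v) = - lied a v.
Proof. by apply: (addrI (lied a v)); rewrite -liedD !subrr lied0. Qed.

Lemma liedB U (a : M U) (v w : E U) : lied a (v - w) = lied a v - lied a w.
Proof. by rewrite liedD liedN. Qed.

Lemma liedZsign n U (a : M U) (v : E U) :
  lied a ((-1) ^+ n *: v) = (-1) ^+ n *: lied a v.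
Proof. by rewrite !liedE opZsign !ctrZ opZsign scalerDr. Qed.

Lemma homog_lied k U (a : M U) (w : E U) : homog k w -> homog k (lied a w).
Proof.
move=> hw; rewrite liedE; apply: homogD; first exact/ctr_homog/op_deg.
case: k hw => [|k] hw; first by rewrite ctr_homog0// op0; apply: homog0.
by apply: op_deg; apply: ctr_homog.
Qed.

(** The value on s of the Lie derivative of w along a: the bracket [a, s_j], which usually stays in
    position j, is moved to the front at the cost of (-1)^j. *)
Definition lie_formula U (a : M U) (w : E U) (s : seq (M U)) : O U :=
  act a (dpc w s) -
  \sum_(j < size s) (-1) ^+ j * dpc w (br a (nth 0 s j) :: omit j s).

(** The right-hand side of [ced_formula], with the bounds read off s so that it can be unfolded
    along s. *)
Definition ce_formula U (w : E U) (s : seq (M U)) : O U :=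
  \sum_(i < size s) (-1) ^+ i * act (nth 0 s i) (dpc w (omit i s)) +
  \sum_(j < size s) \sum_(i < j)
    (-1) ^+ (i + j) *
    dpc w (br (nth 0 s i) (nth 0 s j) :: omit i (omit j s)).

(** The relation i_c L_a = L_a i_c - i_[a,c] on explicit formulas; the last term is the summand of
    index 0. *)
Lemma lie_formula_cons U (a c : M U) (w : E U) s :
  lie_formula a w (c :: s) = lie_formula a (ctr c w) s - dpc w (br a c :: s).
Proof.
rewrite /lie_formula big_ord_recl /= omit0 mul1r.
under eq_bigr => i _ do
  rewrite exprS mulN1r mulNr omitS dpc_swap mulrN opprK /=.
ring.
Qed.

(** The relation i_a d = L_a - d i_a on explicit formulas: the summands involving the first argument
    form the Lie derivative. *)
Lemma ce_formula_cons U (a : M U) (w : E U) s :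
  ce_formula w (a :: s) = lie_formula a w s - ce_formula (ctr a w) s.
Proof.
rewrite /ce_formula /lie_formula !big_ord_recl /= omit0 mul1r big_ord0 add0r.
under eq_bigr => i _ do rewrite exprS mulN1r mulNr omitS dpc_cons /=.
(* Pairs with lower index 0 go to the Lie derivative. In the others a follows the bracket, and is
   swapped with it so as to be contracted first. *)
under [\sum_(i < size s) \sum_(j < _) _]eq_bigr => j _.
  rewrite big_ord_recl /= omitS omit0 add0n exprS mulN1r mulNr.
  under eq_bigr => i _ do
    rewrite /bump !add1n addSn addnS !exprS !mulN1r opprK omitS dpc_swap mulrN
      dpc_cons /=.
  over.
rewrite /= big_split /= !sumrN.
under [X in _ + (- _ + X)]eq_bigr => j _ do rewrite sumrN.
rewrite sumrN; ring.
Qed.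

Definition cartan : Prop :=
  (forall U (a c : M U) (w : E U),
    lied a (ctr c w) - ctr c (lied a w) = ctr (br a c) w) /\
  (forall U (a : M U) f,
    ctr a (d U (f *: aone E U)) = act a f *: aone E U).

Definition chevalley_eilenberg : Prop :=
  forall k U (w : E U) (s : seq (M U)), homog k w -> size s = k.+1 ->
    dpc (d U w) s = ce_formula w s.

(** Evaluated on s, [lied] and d obey the recursions of [lie_formula_cons] and [ce_formula_cons];
    induction on s gives the formula for [lied], and then the one for d. *)
Lemma cartan_ce : cartan -> chevalley_eilenberg.
Proof.
move=> [C1 C2].
have L k U (a : M U) (w : E U) s : homog k w -> size s = k ->
    dpc (lied a w) s = lie_formula a w s.
  elim: s k w => [|c s IH] k w hw /= sk.
    subst k; rewrite !liedE (ctr_homog0 b a hw) op0 addr0 (homog0E hw) C2.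
    by rewrite /lie_formula big_ord0 subr0 /dpc /= !eps_fun.
  case: k sk hw => // k [sk] hw.
  rewrite dpc_cons lie_formula_cons -(IH k)//; last exact: ctr_homog.
  by rewrite [dpc w _]dpc_cons -C1 dpcD dpcN; ring.
move=> k U w s; elim: s k w => [|a s IH] k w hw //= [sk].
rewrite ce_formula_cons -(L k)// liedE dpcD dpc_cons.
case: k hw sk => [|k] hw sk.
  rewrite (ctr_homog0 b a hw) op0 dpc0; case: s sk {IH} => // _.
  by rewrite /ce_formula !big_ord0; ring.
by rewrite (IH k)//; [ring|apply: ctr_homog].
Qed.

(** The same recursions read backwards: the relations hold after evaluation on every s, and
    [dpc_inj] removes the evaluation. *)
Lemma ce_cartan : framed b -> chevalley_eilenberg -> cartan.
Proof.
move=> fb CE; split; last first.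
  move=> U a f; apply: eps_inj.
  - by apply/ctr_homog/op_deg/homog_fun.
  - exact: homog_fun.
  have := CE 0%N U (f *: aone E U) [:: a] (homog_fun _ _) erefl.
  rewrite dpc_cons /dpc /= => ->.
  rewrite /ce_formula !big_ord_recl !big_ord0 /= omit0 /dpc /= !eps_fun.
  ring.
have L k U (a : M U) (w : E U) s : homog k w -> size s = k ->
    dpc (lied a w) s = lie_formula a w s.
  move=> hw sk; rewrite !liedE dpcD -dpc_cons (CE k)//=; last by rewrite sk.
  rewrite ce_formula_cons; case: k hw sk => [|k] hw sk.
    rewrite (ctr_homog0 b a hw) op0 dpc0; case: s sk => // _.
    by rewrite /ce_formula !big_ord0; ring.
  by rewrite (CE k)//; [ring|apply: ctr_homog].
move=> U a c w; move: U w a c.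
apply: (@homog_ind _ _ _ _ _ (fun U w => forall a c, _ = _)).
- move=> U w H a c; apply: msep => x /H[V [h [Vx p]]]; exists V, h; split=> //.
  by rewrite mresB -!(ctr_res, lied_res) p rbr_res ctr_res.
- move=> U v w pv pw a c; by rewrite !(liedD, ctrD) opprD addrACA pv pw.
move=> [|k] U w hw a c.
  by rewrite !(ctr_homog0 _ _ hw) lied0 ctr_homog0 ?subrr//; apply: homog_lied.
apply: (dpc_inj hK fb (k := k)).
- by apply: homogB; [apply/homog_lied/ctr_homog|apply/ctr_homog/homog_lied].
- exact: ctr_homog.
move=> V h s sk.
rewrite mresB -!(ctr_res, lied_res) dpcD dpcN -!dpc_cons.
rewrite (L k)//; last by apply/ctr_homog/homog_res.
rewrite (L k.+1)/= ?sk//; last exact: homog_res.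
by rewrite lie_formula_cons -rbr_res; ring.
Qed.

Hypothesis fb : framed b.
Hypothesis C : cartan.

Let C1 U (a c : M U) (w : E U) :
  ctr c (lied a w) = lied a (ctr c w) - ctr (br a c) w.
Proof. by case: C => /(_ U a c w) <- _; abel. Qed.

Let C2 U (a : M U) f : ctr a (d U (f *: aone E U)) = act a f *: aone E U.
Proof. by case: C. Qed.

Lemma lied_fun U (a : M U) f : lied a (f *: aone E U) = act a f *: aone E U.
Proof. by rewrite !liedE C2 ctr_fun op0 addr0. Qed.

(* [ctr c] sends the defect of the Leibniz rule on (v, w) to the defects on
   (ctr c v, w) and (v, ctr c w), so that the rule holds by induction. *)
Lemma liedM : (forall U (a : M U) f g,
    act a (f * g) = act a f * g + f * act a g) ->
  forall k l U (a : M U) (v w : E U), homog k v -> homog l w ->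
  lied a (amul v w) = amul (lied a v) w + amul v (lied a w).
Proof.
move=> actM k l; have [n] := ubnP (k + l); elim: n k l => // n IH k l.
rewrite ltnS => kln U a v w hv hw.
case E0 : (k + l)%N => [|m].
  have [k0 l0] : k = 0%N /\ l = 0%N by case: k l E0 {kln hv hw} => [|k] [].
  subst k l; rewrite (homog0E hv) (homog0E hw).
  rewrite amulZl amul1l scalerA !lied_fun actM.
  by rewrite !(amulZl, amulZr) !amul1l scalerDl !scalerA.
apply: (ctr_inj hK fb (k := m)).
- by rewrite -E0; apply/homog_lied/homogM.
- by rewrite -E0; apply: homogD; apply: homogM => //; apply: homog_lied.
move=> V h c; rewrite mresD -!amul_res -!lied_res -!amul_res.
have {hv} := homog_res h hv; have {hw} := homog_res h hw.
move: (mres h v) (mres h w) (mres h a) => {a v w} v w a hw hv.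
rewrite C1 ctrD.
rewrite !(ctrM _ _ _ hv) (ctrM _ _ _ (homog_lied a hv)) !C1 liedD liedZsign.
have -> : lied a (amul (ctr c v) w) =
    amul (lied a (ctr c v)) w + amul (ctr c v) (lied a w).
  case: k hv E0 kln => [|k] hv E0 kln.
    by rewrite (ctr_homog0 b c hv) lied0 !amul0l lied0 addr0.
  by apply: (IH k l) => //; apply: ctr_homog.
have -> : lied a (amul v (ctr c w)) =
    amul (lied a v) (ctr c w) + amul v (lied a (ctr c w)).
  case: l hw E0 kln => [|l] hw E0 kln.
    by rewrite (ctr_homog0 b c hw) lied0 !amul0r lied0 addr0.
  by apply: (IH k l) => //; [rewrite -addnS|apply: ctr_homog].
rewrite !(amulDl, amulDr, amulNl, amulNr) !(scalerDr, scalerN); abel.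
Qed.

(** Contraction by a turns d (v w) into L_a (v w) - d (i_a (v w)): the first term is known from
    [liedM], the second has lower degree. *)
Lemma opM : (forall U (a : M U) f g,
    act a (f * g) = act a f * g + f * act a g) ->
  forall k l U (v w : E U), homog k v -> homog l w ->
  d U (amul v w) = amul (d U v) w + (-1) ^+ k *: amul v (d U w).
Proof.
move=> actM k l; have [n] := ubnP (k + l); elim: n k l => // n IH k l.
rewrite ltnS => kln U v w hv hw.
apply: (ctr_inj hK fb (k := (k + l)%N)).
- by apply/op_deg/homogM.
- apply: homogD; first exact: homogM (op_deg d hv) hw.
  by apply: homogZ; rewrite -addnS; apply: homogM (op_deg d hw).
move=> V h a; rewrite mresD mresZ ores_sign -!amul_res -!op_res -!amul_res.
have {hv} := homog_res h hv; have {hw} := homog_res h hw.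
move: (mres h v) (mres h w) => {v w} v w hw hv.
have ctrd (z : E V) : ctr a (d V z) = lied a z - d V (ctr a z).
  by rewrite liedE; abel.
rewrite ctrd (liedM actM _ hv hw) ctrD ctrZ.
rewrite !(ctrM _ _ _ hv) (ctrM _ _ _ (op_deg d hv)) !ctrd opD opZsign.
have -> : d V (amul (ctr a v) w) =
    amul (d V (ctr a v)) w - (-1) ^+ k *: amul (ctr a v) (d V w).
  case: k hv kln => [|k] hv kln.
    by rewrite (ctr_homog0 b a hv) op0 !amul0l op0 scaler0 subr0.
  rewrite exprS mulN1r scaleNr opprK.
  by apply: (IH k l) => //; apply: ctr_homog.
have -> : d V (amul v (ctr a w)) =
    amul (d V v) (ctr a w) + (-1) ^+ k *: amul v (d V (ctr a w)).
  case: l hw kln => [|l] hw kln.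
    by rewrite (ctr_homog0 b a hw) op0 !amul0r op0 scaler0 addr0.
  by apply: (IH k l) => //; [rewrite -addnS|apply: ctr_homog].
rewrite exprS !(amulDl, amulDr, amulNl, amulNr) !(scalerDr, scalerN) !scalerA.
rewrite -signr_odd; case: (odd k) => /=; rewrite ?expr1 ?expr0
  !(mulN1r, mul1r, opprK, scaleN1r, scale1r, scaleNr); abel.
Qed.

Hypothesis jacobi : forall U (a c e : M U),
  br a (br c e) = br (br a c) e + br c (br a e).
Hypothesis act_lie : forall U (a c : M U) f,
  act (br a c) f = act a (act c f) - act c (act a f).

(** In degree 0 this is [act_lie]. A contraction by e lowers the degree, and the brackets with e
    that it creates cancel by [jacobi]. *)
Lemma lied_lie k U (a c : M U) (w : E U) : homog k w ->
  lied a (lied c w) - lied c (lied a w) = lied (br a c) w.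
Proof.
elim: k U a c w => [|k IH] U a c w hw.
  by rewrite (homog0E hw) !lied_fun act_lie scalerBl.
apply: (ctr_inj hK fb (k := k)).
- by apply: homogB; do ![apply: homog_lied].
- exact: homog_lied.
move=> V h e; rewrite mresB -!lied_res -rbr_res.
have {hw} := homog_res h hw.
move: (mres h w) (mres h a) (mres h c) => {a c w} w a c hw.
rewrite !(ctrB, C1, liedB) -(IH _ _ _ _ (ctr_homog b e hw)).
rewrite (jacobi a c e) ctrDl; abel.
Qed.

(** Contraction by c sends [L_a, d] w to [L_a, L_c] w - L_[a,c] w, which is 0 by [lied_lie], minus
    [L_a, d] (i_c w), which is 0 by induction. *)
Lemma lied_op k U (a : M U) (w : E U) : homog k w ->
  lied a (d U w) = d U (lied a w).
Proof.
elim: k U a w => [|k IH] U a w hw.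
all: apply: (ctr_inj hK fb);
  [exact/homog_lied/op_deg/hw|exact/op_deg/homog_lied|].
all: move=> V h c; rewrite -!(op_res, lied_res).
all: have {hw} := homog_res h hw; move: (mres h w) (mres h a) => {a w} w a hw.
all: have ctrd (e : M V) (z : E V) : ctr e (d V z) = lied e z - d V (ctr e z).
all: try by rewrite liedE; abel.
all: rewrite C1 !ctrd liedB C1 -(lied_lie a c hw) opB.
  rewrite !(ctr_homog0 _ _ hw) lied0 op0 lied0; abel.
rewrite (IH _ a _ (ctr_homog b c hw)); abel.
Qed.

(** Since L_a commutes with d, i_a d d = d d i_a, so that induction on the degree applies. *)
Lemma op_sq U (w : E U) : d U (d U w) = 0.
Proof.
move: U w; apply: homog_ind.
- move=> U w H; apply: msep => x /H[V [h [Vx p]]]; exists V, h; split=> //.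
  by rewrite -!op_res p mres0.
- by move=> U v w pv pw; rewrite !opD pv pw addr0.
elim=> [|k IH] U w hw.
all: apply: (ctr_inj hK fb); [exact/op_deg/op_deg/hw|exact: homog0|].
all: move=> V h a; rewrite mres0 ctr0r -!op_res.
all: have {hw} := homog_res h hw; move: (mres h w) => {w} w hw.
all: have ctrd (z : E V) : ctr a (d V z) = lied a z - d V (ctr a z).
all: try by rewrite liedE; abel.
all: rewrite ctrd (lied_op _ hw) ctrd opB.
  by rewrite !(ctr_homog0 _ _ hw) !op0; abel.
by rewrite (IH _ _ (ctr_homog b a hw)); abel.
Qed.

End Cartan.

(** * Duality *)

Section Duality.
Context {K : fieldType} {tau : set (set K)} {X : topologicalType}.
Context {O : ringed_space tau X}.
Implicit Types (U V W : opn X) (N : omod O).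

Lemma dev_irr N U V (a : dual_sec N U) (h h' : V `<=` U) m :
  dev a h m = dev a h' m.
Proof. by rewrite (Prop_irrelevance h h'). Qed.

Lemma dual_pair_res N U V (h : V `<=` U) (a : dual N U) (n : N U) :
  dual_pair (mres h a) (mres h n) = ores h (dual_pair a n).
Proof.
rewrite /dual_pair /= -(dev_res _ (@subset_refl _ U) h h).
exact: dev_irr.
Qed.

Lemma dual_pair_dev N U V (h : V `<=` U) (a : dual N U) (n : N V) :
  dual_pair (mres h a) n = dev (a : dual_sec N U) h n.
Proof. by rewrite /dual_pair /=; apply: dev_irr. Qed.

Lemma dual_pairP N U (a a' : dual N U) :
  (forall V (h : V `<=` U) n,
    dual_pair (mres h a) n = dual_pair (mres h a') n) -> a = a'.
Proof.
move=> H; apply: dual_secP => V h m.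
by have := H V h m; rewrite !dual_pair_dev.
Qed.

Lemma dual_pair_linl N U f (a a' : dual N U) (n : N U) :
  dual_pair (f *: a + a') n = f * dual_pair a n + dual_pair a' n.
Proof. by rewrite /dual_pair /= ores_id. Qed.

Lemma dual_pair_linr N U f (a : dual N U) (n n' : N U) :
  dual_pair a (f *: n + n') = f * dual_pair a n + dual_pair a n'.
Proof. exact: dev_lin. Qed.

Definition dual_pairing N : pairing (dual N) N :=
  @Pairing _ _ _ _ (dual N) N (fun U n a => dual_pair a n)
    (fun U f n n' a => dual_pair_linr f a n n')
    (fun U f n a a' => dual_pair_linl f a a' n)
    (fun U V h n a => dual_pair_res h a n).

Definition eval_pairing N : pairing N (dual N) :=
  @Pairing _ _ _ _ N (dual N) (fun U a n => dual_pair a n)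
    (fun U f a a' n => dual_pair_linl f a a' n)
    (fun U f a n n' => dual_pair_linr f a n n')
    (fun U V h a n => dual_pair_res h a n).

Lemma dual_pair_sum N U (a : dual N U) I (r : seq I) P (F : I -> N U) :
  dual_pair a (\sum_(i <- r | P i) F i) = \sum_(i <- r | P i) dual_pair a (F i).
Proof.
have D x y : dual_pair a (x + y) = dual_pair a x + dual_pair a y.
  by rewrite -[x]scale1r dual_pair_linr mul1r scale1r.
have Z : dual_pair a 0 = 0 by apply: (addrI (dual_pair a 0)); rewrite -D !addr0.
exact: (big_morph (dual_pair a) D Z).
Qed.

Lemma dual_pairZ N U (a : dual N U) f (n : N U) :
  dual_pair a (f *: n) = f * dual_pair a n.
Proof.
have Z : dual_pair a 0 = 0.
  apply: (addrI (dual_pair a 0)); rewrite addr0 -{1}[dual_pair a 0]mul1r.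
  by rewrite -dual_pair_linr scaler0 addr0.
by rewrite -[f *: n]addr0 dual_pair_linr Z addr0.
Qed.

Lemma dual_pair_suml N U (n : N U) I (r : seq I) P (F : I -> dual N U) :
  dual_pair (\sum_(i <- r | P i) F i) n = \sum_(i <- r | P i) dual_pair (F i) n.
Proof. exact: (big_morph (fun a : dual N U => dual_pair a n)). Qed.

Lemma dual_pairZl N U f (a : dual N U) (n : N U) :
  dual_pair (f *: a) n = f * dual_pair a n.
Proof. by rewrite /dual_pair /= ores_id. Qed.

(** By uniqueness, coordinates in a local basis are linear and commute with restriction, so they are
    sections of the dual. The condition P on the rank is kept for [defect10]. *)
Lemma dual_basis (P : nat -> Prop) N : locally_free_rank P N ->
  forall x : X, exists V k (e : 'I_k -> N V) (a : 'I_k -> dual N V),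
  [/\ oset V x, P k, frame (dual_pairing N) e a &
    forall W (h : W `<=` V) i j,
      dual_pair (mres h (a i)) (mres h (e j)) = (i == j)%:R].
Proof.
move=> H x; have [V [k [e [Vx Pk fr]]]] := H x.
pose c W (h : W `<=` V) (n : N W) := sval (cid (fr W h n)).
have cE W (h : W `<=` V) n : n = \sum_i c W h n i *: mres h (e i).
  exact: (svalP (cid (fr W h n))).1.
have cu W (h : W `<=` V) n (g : {ffun 'I_k -> O W}) :
    n = \sum_i g i *: mres h (e i) -> c W h n = g.
  exact: (svalP (cid (fr W h n))).2.
have clin i W (h : W `<=` V) f (m n : N W) :
    c W h (f *: m + n) i = f * c W h m i + c W h n i.
  rewrite (cu _ _ _ [ffun i => f * c W h m i + c W h n i]) ?ffunE//.
  rewrite {1}(cE W h m) {1}(cE W h n) scaler_sumr -big_split /=.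
  by apply: eq_bigr => j _; rewrite ffunE scalerDl scalerA.
have cres i W (Z : opn X) (h : W `<=` V) (hZ : Z `<=` W) (h' : Z `<=` V)
      (n : N W) :
    c Z h' (mres hZ n) i = ores hZ (c W h n i).
  rewrite (cu _ _ _ [ffun i => ores hZ (c W h n i)]) ?ffunE//.
  rewrite {1}(cE W h n) mres_sum; apply: eq_bigr => j _.
  by rewrite ffunE mresZ (mres_comp h hZ h').
pose a i : dual N V := DualSec (clin i) (cres i).
exists V, k, e, a; split=> // [W h n|W h i j].
  rewrite {1}(cE W h n); apply: eq_bigr => i _; congr (_ *: _).
  exact/esym/(dual_pair_dev h (a i)).
rewrite dual_pair_dev /= (cu _ _ _ [ffun l => (l == j)%:R]) ?ffunE//.
rewrite (bigD1 j)//= ffunE eqxx scale1r big1 ?addr0// => l /negPf lj.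
by rewrite ffunE lj scale0r.
Qed.

Variables (N : omod O) (lfN : locally_free_finite_rank N).

Lemma dual_framed : framed (dual_pairing N).
Proof.
move=> x; have [V [k [e [a [Vx _ fr _]]]]] := dual_basis lfN x.
by exists V, k, e, a.
Qed.

Lemma eval_inj U (n n' : N U) :
  (forall V (h : V `<=` U) (a : dual N V),
    dual_pair a (mres h n) = dual_pair a (mres h n')) -> n = n'.
Proof. exact: (pairing_inj dual_framed). Qed.

(** Locally n is the sum of the p(a_i) e_i for dual bases; [eval_inj] makes these local solutions
    unique, hence they glue. *)
Lemma bidual U (p : dual (dual N) U) : exists n : N U,
  forall V (h : V `<=` U) (a : dual N V),
    dual_pair a (mres h n) = dual_pair (mres h p) a.
Proof.
have [|||n nE] := @mglue _ _ _ _ N U (fun V h n =>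
  forall W (k : W `<=` V) (a : dual N W),
    dual_pair a (mres k n) = dual_pair (mres (subset_trans k h) p) a).
- move=> V W h hW h' n H Z k a; rewrite mres_compE H.
  by congr dual_pair; apply: mres_irr.
- move=> V h n n' H H'; apply: eval_inj => W k a.
  by rewrite (H W k) (H' W k).
- move=> x Ux; have [V [k [e [a [Vx _ fr _]]]]] := dual_basis lfN x.
  pose Z := opnI U V; pose h := @sub_opnIr _ U V; pose h' := @sub_opnIl _ U V.
  exists Z, h', (\sum_i dual_pair (mres h' p) (mres h (a i)) *: mres h (e i)).
  split=> // W j c; have hj := subset_trans j h.
  have cE : c = \sum_i dual_pair c (mres hj (e i)) *: mres hj (a i).
    apply: dual_pairP => Y l n; rewrite {1}(fr Y (subset_trans l hj) n).
    rewrite dual_pair_sum mres_sum.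
    rewrite dual_pair_suml; apply: eq_bigr => i _.
    rewrite dual_pairZ mresZ dual_pairZl mulrC -dual_pair_res.
    by rewrite (mres_comp hj l (subset_trans l hj)) mres_compE.
  rewrite mres_sum dual_pair_sum {2}cE dual_pair_sum; apply: eq_bigr => i _.
  rewrite mresZ !dual_pairZ -dual_pair_res mulrC !mres_compE.
  by rewrite (Prop_irrelevance hj (subset_trans j h)).
exists n => V h a; apply: osep => x Vx; have [W [k [Wx H]]] := nE x (h x Vx).
exists (opnI V W), (@sub_opnIl _ V W); split=> //.
rewrite -!dual_pair_res mres_compE.
have := H (opnI V W) (@sub_opnIr _ V W) (mres (@sub_opnIl _ V W) a).
rewrite !mres_compE => E.
rewrite (mres_irr _ (subset_trans (@sub_opnIr _ V W) k)) E.
by congr dual_pair; apply: mres_irr.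
Qed.

(** The composite of p with F is a section of the bidual, hence the evaluation at a section of N.
    This is the passage between psi in degree 1 and the map from the dual to L, in both
    directions. *)
Lemma transpose (P : omod O) (F : omod_hom (dual N) P) :
  exists G : omod_hom (dual P) N, forall U (p : dual P U) (a : dual N U),
    dual_pair a (G U p) = dual_pair p (F U a).
Proof.
have ex U (p : dual P U) : exists n : N U,
    forall V (h : V `<=` U) (a : dual N V),
    dual_pair a (mres h n) = dual_pair (mres h p) (F V a).
  have lin V (h : V `<=` U) f (a a' : dual N V) :
      dual_pair (mres h p) (F V (f *: a + a')) =
      f * dual_pair (mres h p) (F V a) + dual_pair (mres h p) (F V a').
    by rewrite happ_lin dual_pair_linr.
  have res V W (h : V `<=` U) (hW : W `<=` V) (h' : W `<=` U) (a : dual N V) :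
      dual_pair (mres h' p) (F W (mres hW a)) =
      ores hW (dual_pair (mres h p) (F V a)).
    by rewrite happ_res -dual_pair_res (mres_comp h hW h').
  have [n nE] := bidual (DualSec lin res : dual (dual N) U).
  by exists n => V h a; rewrite nE dual_pair_dev.
pose G U p := sval (cid (ex U p)).
have GE U p : forall V (h : V `<=` U) (a : dual N V),
    dual_pair a (mres h (G U p)) = dual_pair (mres h p) (F V a).
  exact: (svalP (cid (ex U p))).
have lin U f (p q : dual P U) : G U (f *: p + q) = f *: G U p + G U q.
  apply: eval_inj => V h a.
  by rewrite GE !mres_lin dual_pair_linl dual_pair_linr !GE.
have res U V (h : V `<=` U) (p : dual P U) : G V (mres h p) = mres h (G U p).
  by apply: eval_inj => W k a; rewrite GE !mres_compE GE.
exists (@Build_omod_hom _ _ _ _ (dual P) N G lin res) => U p a /=.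
by have := GE U p U (@subset_refl _ U) a; rewrite !mres_id.
Qed.

End Duality.

(** * The Lie algebroid of a derivation *)

Section Derivation.
Context {K : fieldType} {tau : set (set K)} {X : topologicalType}.
Context {O : ringed_space tau X}.
Implicit Types (U V W : opn X).
Variables (M N : omod O) (b : pairing M N) (E : exterior N) (d : operator E).
Hypothesis dM : forall k U (v w : E U), homog k v ->
  d U (amul v w) = amul (d U v) w + (-1) ^+ k *: amul v (d U w).
Local Notation ctr := (ctr b).
Local Notation lied := (lied b d).

Lemma der_one U : d U (aone E U) = 0.
Proof.
have := dM (aone E U) (homog_one E U).
rewrite scale1r !amul1l amul1r => H.
by apply: (addrI (d U (aone E U))); rewrite -H addr0.
Qed.

Definition der_act U (a : M U) (f : O U) : O U :=
  eps (ctr a (d U (f *: aone E U))).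

Lemma der_actE U (a : M U) f :
  ctr a (d U (f *: aone E U)) = der_act a f *: aone E U.
Proof. by apply/homog0E/ctr_homog/op_deg/homog_fun. Qed.

Lemma der_act_res U V (h : V `<=` U) (a : M U) (f : O U) :
  der_act (mres h a) (ores h f) = ores h (der_act a f).
Proof. by rewrite /der_act -eps_res -ctr_res -op_res mresZ aone_res. Qed.

Lemma der_act_linl U f (a a' : M U) g :
  der_act (f *: a + a') g = f * der_act a g + der_act a' g.
Proof. by rewrite /der_act ctr_linl eps_lin. Qed.

Lemma der_actD U (a : M U) f g : der_act a (f + g) = der_act a f + der_act a g.
Proof. by rewrite /der_act scalerDl opD ctrD epsD. Qed.

Lemma der_act_cst U (a : M U) c f :
  der_act a (ocst O c * f) = ocst O c * der_act a f.
Proof.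
rewrite /der_act -scalerA -[ocst O c *: (_ *: _)]addr0 op_lin op0 addr0.
by rewrite ctrZ epsZ.
Qed.

Lemma der_actM U (a : M U) f g :
  der_act a (f * g) = der_act a f * g + f * der_act a g.
Proof.
rewrite /der_act.
have -> : (f * g) *: aone E U = amul (f *: aone E U) (g *: aone E U).
  by rewrite amulZl amulZr amul1l scalerA.
rewrite (dM _ (homog_fun E f)) scale1r ctrD.
rewrite (ctrM _ _ _ (op_deg d (homog_fun E f))) (ctrM _ _ _ (homog_fun E f)).
rewrite !ctr_fun amul0r amul0l scaler0 addr0 add0r scale1r.
by rewrite epsD !epsM !eps_fun.
Qed.

(** The product rule for L_a is established for a function here, and for a generator in
    [lied_iotaM]: these are the left factors that [ext_ind] meets. *)
Lemma lied_derZ U (a : M U) f (w : E U) :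
  lied a (f *: w) = der_act a f *: w + f *: lied a w.
Proof.
have -> : f *: w = amul (f *: aone E U) w by rewrite amulZl amul1l.
rewrite !liedE (dM _ (homog_fun E f)) !ctrD expr0 scale1r.
rewrite (ctrM _ _ _ (op_deg d (homog_fun E f))) !(ctrM _ _ _ (homog_fun E f)).
rewrite der_actE !ctr_fun !amul0l !add0r expr0 expr1 !scale1r scaleN1r.
rewrite (dM _ (homog_fun E f)) expr0 scale1r !(amulZl, amul1l).
rewrite scalerDr; abel.
Qed.

Lemma lied_iota U (a : M U) (n : N U) :
  lied a (iota E U n) =
  ctr a (d U (iota E U n)) + d U (b U n a *: aone E U).
Proof. by rewrite liedE ctr_iota. Qed.

Lemma lied_iotaM U (a : M U) (n : N U) (w : E U) :
  lied a (amul (iota E U n) w) =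
  amul (lied a (iota E U n)) w + amul (iota E U n) (lied a w).
Proof.
have hn := iota_deg E n.
rewrite lied_iota !liedE (dM _ hn) ctr_iotaM opB ctrD ctrZ.
rewrite (ctrM _ _ _ (op_deg d hn)) ctr_iotaM (dM _ hn).
have -> : b U n a *: w = amul (b U n a *: aone E U) w.
  by rewrite amulZl amul1l.
have -> : b U n a *: d U w = amul (b U n a *: aone E U) (d U w).
  by rewrite amulZl amul1l.
rewrite (dM _ (homog_fun E _)) expr1 sqrrN expr1n scale1r.
rewrite !(amulDl, amulDr) !scalerDr !scaleN1r scale1r; abel.
Qed.

Lemma ctr_lied_iota U (a c : M U) (n : N U) :
  ctr c (lied a (iota E U n)) = eps (ctr c (lied a (iota E U n))) *: aone E U.
Proof. by apply/homog0E/ctr_homog/homog_lied/iota_deg. Qed.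

Variable R : raw_lie M.
Hypothesis Ract : forall U (a : M U) f, ract R a f = der_act a f.
Hypothesis Rbr : forall U (a c : M U) (n : N U),
  b U n (rbr R a c) = der_act a (b U n c) - eps (ctr c (lied a (iota E U n))).

(** On a generator the commutation relation is [Rbr]; it propagates because L_a is a derivation and
    contractions are antiderivations. *)
Lemma der_cartan : cartan b d R.
Proof.
split; last by move=> U a f; rewrite Ract der_actE.
move=> U a c w; move: U w a c.
apply: (@ext_ind _ _ _ _ _ _ (fun U w => forall a c, _ = _)).
- move=> U w H a c; apply: msep => x /H[V [h [Vx p]]]; exists V, h; split=> //.
  by rewrite mresB -!(ctr_res, lied_res) p rbr_res ctr_res.
- move=> U f v w pv pw a c.
  rewrite !ctr_lin !liedD !lied_derZ !(ctrD, ctrZ) -pv -pw.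
  by rewrite scalerBr; abel.
- by move=> U a c; rewrite !ctr1 lied0 liedE der_one ctr1 op0 !ctr0r addr0 ctr0r
    subr0.
- move=> U n w p a c.
  rewrite lied_iotaM !ctr_iotaM ctrD ctr_iotaM liedB lied_derZ lied_iotaM.
  rewrite (ctrM _ _ _ (homog_lied b d a (iota_deg E n))) ctr_lied_iota.
  rewrite Rbr -p amulDr amulNr scalerBl amulZl amul1l expr1 scaleN1r.
  by abel.
Qed.

End Derivation.

(** * The algebroid structure on the dual defined by a derivation of square zero *)

Section DualAlgebroid.
Context {K : fieldType} {tau : set (set K)} {X : topologicalType}.
Context {O : ringed_space tau X}.
Implicit Types (U V W : opn X).
Variables (N : omod O) (E : exterior N) (d : operator E).
Hypothesis dM : forall k U (v w : E U), homog k v ->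
  d U (amul v w) = amul (d U v) w + (-1) ^+ k *: amul v (d U w).
Hypothesis dd : forall U (w : E U), d U (d U w) = 0.
Local Notation b := (dual_pairing N).
Local Notation ctr := (ctr b).
Local Notation lied := (lied b d).
Local Notation act := (@der_act _ _ _ _ _ _ b E d _).

(** The value of [a, c] at n, as forced by [L_a, i_c] = i_[a,c] on the generator n. *)
Definition der_br_fun U (a c : dual N U) (n : N U) : O U :=
  act a (dual_pair c n) - eps (ctr c (lied a (iota E U n))).

Lemma der_br_fun_lin U (a c : dual N U) f (m n : N U) :
  der_br_fun a c (f *: m + n) = f * der_br_fun a c m + der_br_fun a c n.
Proof.
rewrite /der_br_fun happ_lin dual_pair_linr liedD (lied_derZ b dM).
rewrite !ctrD !ctrZ ctr_iota /= !(epsD, epsZ) eps1.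
by rewrite der_actD (der_actM _ dM); ring.
Qed.

Lemma der_br_fun_res U V (h : V `<=` U) (a c : dual N U) (n : N U) :
  der_br_fun (mres h a) (mres h c) (mres h n) = ores h (der_br_fun a c n).
Proof.
rewrite /der_br_fun oresD oresN dual_pair_res der_act_res happ_res.
by rewrite lied_res ctr_res eps_res.
Qed.

Program Definition der_br U (a c : dual N U) : dual N U :=
  @DualSec _ _ _ _ N U (fun V h n => der_br_fun (mres h a) (mres h c) n) _ _.
Next Obligation. by move=> U a c V h f m n; apply: der_br_fun_lin. Qed.
Next Obligation.
move=> U a c V W h hW h' m.
by rewrite -der_br_fun_res !(mres_comp h hW h').
Qed.

Lemma der_brE U V (h : V `<=` U) (a c : dual N U) n :
  dual_pair (mres h (der_br a c)) n = der_br_fun (mres h a) (mres h c) n.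
Proof. by rewrite dual_pair_dev. Qed.

Lemma der_brE1 U (a c : dual N U) n :
  dual_pair (der_br a c) n = der_br_fun a c n.
Proof.
by rewrite -[der_br a c](mres_id (@subset_refl _ U)) der_brE !mres_id.
Qed.

Lemma der_br_res U V (h : V `<=` U) (a c : dual N U) :
  der_br (mres h a) (mres h c) = mres h (der_br a c).
Proof.
by apply: dual_pairP => W k n; rewrite mres_compE !der_brE !mres_compE.
Qed.

Definition der_raw_lie : raw_lie (dual N) :=
  @RawLie _ _ _ _ (dual N) der_br (der_act b d) der_br_res
    (@der_act_res _ _ _ _ _ _ b E d).

Lemma der_raw_cartan : cartan b d der_raw_lie.
Proof. by apply: der_cartan => // U a c n; apply: der_brE1. Qed.

Let C U (a c : dual N U) (w : E U) :
  lied a (ctr c w) - ctr c (lied a w) = ctr (der_br a c) w.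
Proof. by case: der_raw_cartan => /(_ U a c w). Qed.

(** Turns identities between sections of the dual into identities between operators on E. *)
Lemma dual_ctrP U (a a' : dual N U) :
  (forall V (h : V `<=` U) n,
    ctr (mres h a) (iota E V n) = ctr (mres h a') (iota E V n)) -> a = a'.
Proof.
move=> H; apply: dual_pairP => V h n.
have /(congr1 (@eps _ _ _ _ _ E V)) := H V h n.
by rewrite !ctr_iota !eps_fun.
Qed.

Lemma der_lied_op U (a : dual N U) (w : E U) : lied a (d U w) = d U (lied a w).
Proof. by rewrite !liedE dd ctr0r add0r opD dd addr0. Qed.

Lemma der_lied_lie U (a c : dual N U) (w : E U) :
  lied a (lied c w) - lied c (lied a w) = lied (der_br a c) w.
Proof.
rewrite [lied (der_br a c) w]liedE -!C opB [lied c w]liedE liedD.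
by rewrite [lied c (lied a w)]liedE !der_lied_op; abel.
Qed.

(** Contraction by [a, [c, e]] is the iterated commutator [L_a, [L_c, i_e]], so this is the Jacobi
    identity for operators, given [L_a, L_c] = L_[a,c]. *)
Lemma der_jacobi U (a c e : dual N U) :
  der_br a (der_br c e) = der_br (der_br a c) e + der_br c (der_br a e).
Proof.
apply: dual_ctrP => V h n; rewrite mresD -!der_br_res.
move: (mres h a) (mres h c) (mres h e) => {a c e} a c e.
by rewrite ctrDl -!C -!der_lied_lie !(liedB, ctrB); abel.
Qed.

Lemma der_alt U (a : dual N U) : der_br a a = 0.
Proof.
apply: dual_pairP => V h n; rewrite der_brE /der_br_fun mres0.
rewrite liedE ctrD ctr_sq add0r ctr_iota /= -/(der_act b d _ _) subrr.
by [].
Qed.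

Lemma der_brDr U (a c e : dual N U) :
  der_br a (c + e) = der_br a c + der_br a e.
Proof.
apply: dual_ctrP => V h n; rewrite !mresD -!der_br_res !mresD ctrDl -!C.
rewrite !ctrDl liedD; abel.
Qed.

Lemma der_br_leibniz U (a c : dual N U) f :
  der_br a (f *: c) = f *: der_br a c + act a f *: c.
Proof.
apply: dual_pairP => V h n; rewrite !mresD !mresZ -!der_br_res -der_act_res.
rewrite dual_pair_linl dual_pairZl !mresZ !der_brE1 /der_br_fun dual_pairZl.
rewrite (der_actM _ dM) -[_ *: mres h c]addr0 ctr_linl ctr0l eps_lin eps0.
ring.
Qed.

Lemma der_br_anti U (a c : dual N U) : der_br a c = - der_br c a.
Proof.
apply: dual_ctrP => V h n; rewrite mresN ctrNl -!der_br_res.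
move: (mres h a) (mres h c) => {a c} a c; rewrite -!C !liedE !ctrD.
by rewrite !(ctr_anti _ a c) opN; abel.
Qed.

Lemma der_brNr U (a c : dual N U) : der_br a (- c) = - der_br a c.
Proof.
have Z : der_br a 0 = 0.
  by apply: (addrI (der_br a 0)); rewrite -der_brDr !addr0.
by apply: (addrI (der_br a c)); rewrite -der_brDr !subrr.
Qed.

Lemma der_act_lie U (a c : dual N U) f :
  act (der_br a c) f = act a (act c f) - act c (act a f).
Proof.
have /(congr1 (@eps _ _ _ _ _ E U)) := der_lied_lie a c (f *: aone E U).
by rewrite !(lied_fun der_raw_cartan) /= epsD epsN !eps_fun.
Qed.

Lemma der_brDl U (a c e : dual N U) :
  der_br (c + e) a = der_br c a + der_br e a.
Proof. by rewrite !(der_br_anti _ a) der_brDr opprD. Qed.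

Lemma der_br_cst U (a c : dual N U) k :
  der_br a (ocst O k *: c) = ocst O k *: der_br a c.
Proof.
rewrite der_br_leibniz -[ocst O k]mulr1 der_act_cst.
have -> : act a 1 = 0 by rewrite /der_act scale1r (der_one dM) ctr0r eps0.
by rewrite !mulr0 scale0r addr0.
Qed.

Program Definition der_der U (a : dual N U) : @der _ _ _ O U :=
  @Build_der _ _ _ O U (fun V h f => act (mres h a) f) _ _ _ _.
Next Obligation. by move=> *; apply: der_actD. Qed.
Next Obligation. by move=> *; apply: der_act_cst. Qed.
Next Obligation. by move=> *; apply: (der_actM _ dM). Qed.
Next Obligation.
by move=> U a V W h hW h' f; rewrite -der_act_res (mres_comp h hW h').
Qed.

Definition dual_algebroid : lie_algebroid_on (dual N).
Proof.
apply: (@Build_lie_algebroid_on _ _ _ O (dual N) der_br der_der).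
- exact: der_br_res.
- by move=> U c D D' F; rewrite der_brDl !(der_br_anti _ F) der_br_cst scalerN.
- by move=> U c D D' F; rewrite der_brDr der_br_cst.
- exact: der_alt.
- move=> U D F G; rewrite der_jacobi (der_br_anti _ G) (der_br_anti D G).
  by rewrite der_brNr; abel.
- move=> U V h D W hW hW' f.
  exact: (congr1 (fun a => act a f) (mres_comp h hW hW' D)).
- move=> U g D D' V h f.
  by rewrite /dapp /der_der mres_lin der_act_linl.
- by move=> U D D' V h f; rewrite /dapp /der_der -der_br_res der_act_lie.
- by move=> U D D' f; rewrite /dapp /der_der mres_id; apply: der_br_leibniz.
Defined.

Lemma dual_algebroid_act U (a : dual N U) f :
  anchor_act dual_algebroid a f = act a f.
Proof. by rewrite /anchor_act /dapp /= -[dual_res _ a]/(mres _ a) mres_id. Qed.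

End DualAlgebroid.

(** * Gerstenhaber algebras *)

Section Gerstenhaber.
Context {K : fieldType} {tau : set (set K)} {X : topologicalType}.
Context {O : ringed_space tau X}.
Implicit Types (U V W : opn X).
Variables (A : galg O) (G : gerstenhaber_on A).

Section Fixed.
Variable U : opn X.

Lemma gbrDl (a b c : A U) : gbr G (a + b) c = gbr G a c + gbr G b c.
Proof. by rewrite -[a]scale1r -(ocst1 U) gbr_linl ocst1 !scale1r. Qed.

Lemma gbrDr (a b c : A U) : gbr G c (a + b) = gbr G c a + gbr G c b.
Proof. by rewrite -[a]scale1r -(ocst1 U) gbr_linr ocst1 !scale1r. Qed.

Lemma gbr0l (a : A U) : gbr G 0 a = 0.
Proof. by apply: (addrI (gbr G 0 a)); rewrite -gbrDl !addr0. Qed.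

Lemma gbr0r (a : A U) : gbr G a 0 = 0.
Proof. by apply: (addrI (gbr G a 0)); rewrite -gbrDr !addr0. Qed.

Lemma gbrNr (a b : A U) : gbr G a (- b) = - gbr G a b.
Proof. by apply: (addrI (gbr G a b)); rewrite -gbrDr !subrr gbr0r. Qed.

Lemma gbrZsignr n (a b : A U) :
  gbr G a ((-1) ^+ n *: b) = (-1) ^+ n *: gbr G a b.
Proof.
elim: n b => [|n IH] b; rewrite ?scale1r//.
by rewrite exprS -!scalerA !scaleN1r gbrNr IH.
Qed.

Lemma gbr_cstr k (a b : A U) : gbr G a (ocst O k *: b) = ocst O k *: gbr G a b.
Proof. by rewrite -[_ *: b]addr0 gbr_linr gbr0r addr0. Qed.

Lemma gbr_fun f g : gbr G (f *: aone A U) (g *: aone A U) = 0.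
Proof. exact: (gbr_deg G (homog_fun A f) (homog_fun A g)). Qed.

Lemma gbr_deg1 i (a b : A U) : homog 1 a -> homog i b -> homog i (gbr G a b).
Proof. exact: (@gbr_deg _ _ _ _ _ G 1 i). Qed.

Lemma gbr_anti1 i (a b : A U) : homog 1 a -> homog i b ->
  gbr G a b = - gbr G b a.
Proof.
move=> ha hb; rewrite (gbr_anti G ha hb).
by rewrite -signr_odd oddM /= scale1r.
Qed.

Lemma gbr_jacobi1 (a b c : A U) : homog 1 a -> homog 1 b ->
  gbr G a (gbr G b c) = gbr G (gbr G a b) c + gbr G b (gbr G a c).
Proof.
by move=> ha hb; rewrite (gbr_jacobi G _ ha hb) -signr_odd oddM /= scale1r.
Qed.

Lemma gbr_leibnizZ i f (a c : A U) : homog i a ->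
  gbr G a (f *: c) = amul (gbr G a (f *: aone A U)) c + f *: gbr G a c.
Proof.
move=> ha; rewrite -[in LHS](amul1l c) -amulZl.
rewrite (gbr_leibniz G _ ha (homog_fun A f)) muln0 scale1r.
by rewrite [amul (f *: _) (gbr _ _ _)]amulZl amul1l.
Qed.

End Fixed.

End Gerstenhaber.

(** * Functoriality of exterior algebras and pullback *)

Section GradedHoms.
Context {K : fieldType} {tau : set (set K)} {X : topologicalType}.
Context {O : ringed_space tau X}.
Implicit Types (U V W : opn X).

Lemma galg_hom_homog (A B : galg O) (F : galg_hom A B) k U (a : A U) :
  homog k a -> homog k (F U a).
Proof. by rewrite /homog -ghom_pr => ->. Qed.

Lemma galg_hom_fun (A B : oalg O) (F : oalg_hom A B) U f :
  F U (f *: aone A U) = f *: aone B U.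
Proof. by rewrite happZ ahom1. Qed.

Variables (M N : omod O) (EM : exterior M) (EN : exterior N).

Lemma eps_galg_hom (F : galg_hom EM EN) U (w : EM U) : eps (F U w) = eps w.
Proof.
move: U w; apply: ext_ind.
- move=> U w H; apply: osep => x /H[V [h [Vx p]]]; exists V, h.
  by split=> //; rewrite -!eps_res -happ_res.
- by move=> U f v w pv pw; rewrite happ_lin !eps_lin pv pw.
- by move=> U; rewrite ahom1 !eps1.
- move=> U n w _; rewrite ahomM !epsM eps_iota mul0r.
  rewrite (eps_homogS (k := 0)) ?mul0r//.
  exact/galg_hom_homog/iota_deg.
Qed.

(** The universal property ignores the grading, so its preservation is proved afterwards, for
    homogeneous sections and then for all. *)
Lemma extend (f : omod_hom M N) : exists F : galg_hom EM EN,
  forall U (m : M U), F U (iota EM U m) = iota EN U (f U m).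
Proof.
have [|g [gE _]] := @ext_univ _ _ _ _ _ EM EN (omod_comp (iota EN) f).
  by move=> U m; apply: iota_sq.
have gh : forall k U (w : EM U), homog k w -> homog k (g U w).
  apply: (@ext_ind_homog _ _ _ _ _ _ (fun k U w => homog k (g U w))).
  - move=> k U w H; apply: homog_local => x /H[V [h [Vx p]]]; exists V, h.
    by rewrite -happ_res.
  - move=> k U r v w pv pw; rewrite happ_lin.
    by apply: homogD => //; apply: homogZ.
  - by move=> U; rewrite ahom1; apply: homog_one.
  - move=> k U m w _ p; rewrite ahomM gE.
    exact: (homogM (iota_deg EN (f U m)) p).
have pr : forall i U (a : EM U), g U (gpr EM i U a) = gpr EN i U (g U a).
  move=> i; apply: homog_ind.
  - move=> U w H; apply: msep => x /H[V [h [Vx p]]]; exists V, h; split=> //.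
    by rewrite -!happ_res.
  - by move=> U v w pv pw; rewrite !happD pv pw.
  - move=> k U w hw; rewrite (gpr_homog _ hw) (gpr_homog _ (gh _ _ _ hw)).
    by case: eqP => // _; rewrite happ0.
by exists (@Build_galg_hom _ _ _ _ EM EN g pr) => U m /=; rewrite gE.
Qed.

End GradedHoms.

Section Intertwine.
Context {K : fieldType} {tau : set (set K)} {X : topologicalType}.
Context {O : ringed_space tau X}.
Implicit Types (U V W : opn X).
Variables (M M' N N' : omod O) (b : pairing M N) (b' : pairing M' N').
Variables (E : exterior N) (E' : exterior N') (psi : galg_hom E E').
Variables (rho : omod_hom M' M) (f : forall U, N U -> N' U).
Hypothesis psi_iota : forall U (n : N U), psi U (iota E U n) = iota E' U (f n).
Hypothesis adj : forall U (n : N U) (a : M' U), b' U (f n) a = b U n (rho U a).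

(** By [adj], f and rho are transposes of each other, so psi is a pullback along rho: both sides
    obey the same product rule in w and agree on generators. *)
Lemma ctr_intertwine U (a : M' U) (w : E U) :
  ctr b' a (psi U w) = psi U (ctr b (rho U a) w).
Proof.
move: U w a; apply: (@ext_ind _ _ _ _ _ _ (fun U w => forall a, _ = _)).
- move=> U w H a; apply: msep => x /H[V [h [Vx p]]]; exists V, h.
  by split=> //; rewrite -ctr_res -!happ_res p happ_res ctr_res.
- by move=> U r v w pv pw a; rewrite ctr_lin !happ_lin ctr_lin pv pw.
- by move=> U a; rewrite ctr1 ahom1 ctr1 happ0.
- move=> U n w p a.
  rewrite ctr_iotaM ahomM psi_iota ctr_iotaM happB happZ.
  by rewrite ahomM psi_iota p adj.
Qed.

Lemma dpc_intertwine U (w : E U) (s : seq (M' U)) :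
  dpc b' (psi U w) s = dpc b w (map (rho U) s).
Proof.
elim: s w => [|a s IH] w /=; first exact: eps_galg_hom.
by rewrite !dpc_cons ctr_intertwine IH.
Qed.

End Intertwine.

Section FromAlgebroid.
Context {K : fieldType} {tau : set (set K)} {X : topologicalType}.
Context {O : ringed_space tau X}.
Implicit Types (U V W : opn X).

Section Raw.
Variables (M : omod O) (A : lie_algebroid_on M).

Lemma anchor_act_mres U V (h : V `<=` U) (D : M U) f :
  anchor_act A (mres h D) f = dapp (anchor A D) h f.
Proof. exact: anchor_res. Qed.

Lemma anchor_act_res U V (h : V `<=` U) (D : M U) f :
  anchor_act A (mres h D) (ores h f) = ores h (anchor_act A D f).
Proof. by rewrite anchor_act_mres; apply: dapp_res. Qed.

Definition algebroid_raw_lie : raw_lie M :=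
  @RawLie _ _ _ _ M (@lbr _ _ _ _ _ A) (@anchor_act _ _ _ _ _ A)
    (@lbr_res _ _ _ _ _ A) anchor_act_res.

Lemma lbrDl U (D D' F : M U) : lbr A (D + D') F = lbr A D F + lbr A D' F.
Proof. by rewrite -[D]scale1r -(ocst1 U) lbr_linl ocst1 !scale1r. Qed.

Lemma lbrDr U (D D' F : M U) : lbr A F (D + D') = lbr A F D + lbr A F D'.
Proof. by rewrite -[D]scale1r -(ocst1 U) lbr_linr ocst1 !scale1r. Qed.

Lemma lbr_anti U (D D' : M U) : lbr A D D' = - lbr A D' D.
Proof.
apply/eqP; rewrite -addr_eq0; apply/eqP.
by have := lbr_alt A (D + D'); rewrite lbrDl !lbrDr !lbr_alt add0r addr0.
Qed.

Lemma lbrNr U (D D' : M U) : lbr A D (- D') = - lbr A D D'.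
Proof.
have Z : lbr A D 0 = 0 by apply: (addrI (lbr A D 0)); rewrite -lbrDr !addr0.
by apply: (addrI (lbr A D D')); rewrite -lbrDr !subrr.
Qed.

Lemma lbr_jacobiE U (D F G : M U) :
  lbr A D (lbr A F G) = lbr A (lbr A D F) G + lbr A F (lbr A D G).
Proof.
have := lbr_jacobi A D F G.
rewrite (lbr_anti G (lbr A D F)) (lbr_anti G D) lbrNr => H.
by apply/eqP; rewrite -subr_eq0 -H; apply/eqP; abel.
Qed.

Lemma anchor_actM U (D : M U) f g :
  anchor_act A D (f * g) = anchor_act A D f * g + f * anchor_act A D g.
Proof. exact: dapp_mul. Qed.

Lemma anchor_act_lie U (D D' : M U) f :
  anchor_act A (lbr A D D') f =
  anchor_act A D (anchor_act A D' f) - anchor_act A D' (anchor_act A D f).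
Proof. exact: anchor_lie. Qed.

End Raw.

Section CE.
Variables (M N : omod O) (b : pairing M N) (A : lie_algebroid_on M).
Variables (E : exterior N).

Definition ce_op (d : ce_differential b A E) : operator E :=
  @Operator _ _ _ _ E (ced d) (@ced_res _ _ _ _ _ _ _ _ _ d)
    (@ced_lin _ _ _ _ _ _ _ _ _ d) (@ced_deg _ _ _ _ _ _ _ _ _ d).

Lemma ce_op_formula (d : ce_differential b A E) :
  chevalley_eilenberg b (ce_op d) (algebroid_raw_lie A).
Proof.
move=> k U w s hw sk; have := ced_formula d hw sk.
rewrite det_pairing_uniq /ce_formula sk => ->.
congr (_ + _); apply: eq_bigr => i _; first by rewrite det_pairing_uniq.
by apply: eq_bigr => j _; rewrite det_pairing_uniq.
Qed.

Definition op_ce (d : operator E) :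
  chevalley_eilenberg b d (algebroid_raw_lie A) -> ce_differential b A E.
Proof.
move=> CE; apply: (@Build_ce_differential _ _ _ _ _ _ b A E (ctr_pairing b E)
  (op d)).
- exact: op_res.
- exact: op_lin.
- exact: op_deg.
- by move=> k U w s hw sk; rewrite /= (CE _ _ _ _ hw sk) /ce_formula sk.
Defined.

End CE.

Definition sd_op (A : galg O) (G : gerstenhaber_on A)
    (d : strong_differential G) : operator A :=
  @Operator _ _ _ _ A (sd d) (@sd_res _ _ _ _ _ _ d) (@sd_lin _ _ _ _ _ _ d)
    (@sd_deg _ _ _ _ _ _ d).

End FromAlgebroid.

(** * The Lie algebroid of a Gerstenhaber bracket *)

Section FromGerstenhaber.
Context {K : fieldType} {tau : set (set K)} {X : topologicalType}.
Context {O : ringed_space tau X}.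
Implicit Types (U V W : opn X).
Hypothesis hK : base_field tau.
Variables (M N : omod O) (b : pairing M N) (fb : framed b).
Variables (E : exterior N) (G : gerstenhaber_on E).

Let dE1 U (n : N U) : homog 1 (iota E U n) := iota_deg E n.

Definition gbr1 U (D D' : N U) : N U :=
  iota_inv (gbr G (iota E U D) (iota E U D')).

Lemma gbr1E U (D D' : N U) :
  iota E U (gbr1 D D') = gbr G (iota E U D) (iota E U D').
Proof. by apply: (iota_invK fb); apply: gbr_deg1. Qed.

Lemma gbr1_anti U (D D' : N U) : gbr1 D D' = - gbr1 D' D.
Proof.
apply: (iota_inj fb (E := E)); rewrite happN !gbr1E.
exact: gbr_anti1.
Qed.

Lemma gbr1Nr U (D D' : N U) : gbr1 D (- D') = - gbr1 D D'.
Proof. by apply: (iota_inj fb (E := E)); rewrite !(happN, gbr1E) gbrNr. Qed.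

Lemma gbr1_jacobi U (D F H : N U) :
  gbr1 D (gbr1 F H) = gbr1 (gbr1 D F) H + gbr1 F (gbr1 D H).
Proof.
apply: (iota_inj fb (E := E)); rewrite happD !gbr1E.
exact: gbr_jacobi1.
Qed.

Definition gact U (D : N U) (f : O U) : O U :=
  eps (gbr G (iota E U D) (f *: aone E U)).

Lemma gactE U (D : N U) f :
  gbr G (iota E U D) (f *: aone E U) = gact D f *: aone E U.
Proof. by apply: homog0E; apply: gbr_deg1 => //; apply: homog_fun. Qed.

Lemma gact_res U V (h : V `<=` U) (D : N U) f :
  gact (mres h D) (ores h f) = ores h (gact D f).
Proof. by rewrite /gact -eps_res -gbr_res mresZ aone_res happ_res. Qed.

Lemma gactD U (D : N U) f g : gact D (f + g) = gact D f + gact D g.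
Proof. by rewrite /gact scalerDl gbrDr epsD. Qed.

Lemma gact_cst U (D : N U) c f : gact D (ocst O c * f) = ocst O c * gact D f.
Proof. by rewrite /gact -scalerA gbr_cstr epsZ. Qed.

Lemma gactM U (D : N U) f g : gact D (f * g) = gact D f * g + f * gact D g.
Proof.
rewrite {1}/gact -scalerA (gbr_leibnizZ G _ _ (dE1 D)) !gactE.
by rewrite epsD epsM epsZ !eps_fun.
Qed.

(** The Leibniz rule acts on the second argument, so [g D, f] is first rewritten as - [f, g D]; the
    term with [f, g] is zero. *)
Lemma gact_linl U g (D D' : N U) f :
  gact (g *: D + D') f = g * gact D f + gact D' f.
Proof.
rewrite /gact happ_lin gbrDl epsD; congr (_ + _).
have h0 := homog_fun E f; have hg := homogZ g (dE1 D).
rewrite (gbr_anti1 G hg h0) (gbr_leibnizZ G _ _ h0) gbr_fun amul0l add0r.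
by rewrite (gbr_anti1 G (dE1 D) h0) !epsN epsZ mulrN.
Qed.

Program Definition gder U (D : N U) : @der _ _ _ O U :=
  @Build_der _ _ _ O U (fun V h f => gact (mres h D) f) _ _ _ _.
Next Obligation. by move=> *; apply: gactD. Qed.
Next Obligation. by move=> *; apply: gact_cst. Qed.
Next Obligation. by move=> *; apply: gactM. Qed.
Next Obligation.
by move=> U D V W h hW h' f; rewrite -gact_res (mres_comp h hW h').
Qed.

Lemma gact_lie U (D D' : N U) f :
  gact (gbr1 D D') f = gact D (gact D' f) - gact D' (gact D f).
Proof.
have := gbr_jacobi1 G (f *: aone E U) (dE1 D) (dE1 D').
rewrite !gactE -gbr1E gactE => /(congr1 (@eps _ _ _ _ _ E U)).
by rewrite epsD !eps_fun => ->; ring.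
Qed.

Definition gerst_algebroid : lie_algebroid_on N.
Proof.
apply: (@Build_lie_algebroid_on _ _ _ O N gbr1 gder).
- move=> U V h D D'; apply: (iota_inj fb (E := E)).
  by rewrite gbr1E !happ_res gbr_res gbr1E.
- move=> U c D D' F; apply: (iota_inj fb (E := E)).
  by rewrite !(gbr1E, happ_lin) gbr_linl.
- move=> U c D D' F; apply: (iota_inj fb (E := E)).
  by rewrite !(gbr1E, happ_lin) gbr_linr.
- move=> U D; apply: (iota_inj fb (E := E)); rewrite gbr1E happ0.
  (* With [n := 1] the factor is 2: graded antisymmetry only yields [D, D] = - [D, D]. *)
  apply: (natmul_eq0 hK (n := 1)); apply/eqP.
  by rewrite scaler_nat mulr2n addr_eq0 -(gbr_anti1 G (dE1 D) (dE1 D)).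
- move=> U D F H; rewrite gbr1_jacobi (gbr1_anti _ H) (gbr1_anti D H).
  by rewrite gbr1Nr; abel.
- move=> U V h D W hW hW' f; rewrite /dapp /gder.
  by rewrite (mres_comp h hW hW').
- by move=> U g D D' V h f; rewrite /dapp /gder mres_lin gact_linl.
- move=> U D D' V h f; rewrite /dapp /gder -gact_lie; congr gact.
  apply: (iota_inj fb (E := E)).
  by rewrite happ_res !gbr1E -gbr_res !happ_res.
- move=> U D D' f; apply: (iota_inj fb (E := E)).
  rewrite gbr1E happD !happZ (gbr_leibnizZ G _ _ (dE1 D)) gactE gbr1E.
  by rewrite amulZl amul1l /dapp /gder mres_id addrC.
Defined.

Lemma gerst_algebroid_act U (D : N U) f :
  anchor_act gerst_algebroid D f = gact D f.
Proof. by rewrite /anchor_act /= mres_id. Qed.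

Definition gerst_schouten : schouten gerst_algebroid E.
Proof.
apply: (@Build_schouten _ _ _ _ N gerst_algebroid E G).
- by move=> U D D'; rewrite gbr1E.
- by move=> U D f; rewrite gactE gerst_algebroid_act.
- by move=> U f g; apply: gbr_fun.
Defined.

End FromGerstenhaber.

(** * From strong differential algebras to bialgebroids *)

Section LowDegree.
Context {K : fieldType} {tau : set (set K)} {X : topologicalType}.
Context {O : ringed_space tau X}.
Variables (M N : omod O) (b : pairing M N) (E : exterior N).
Variables (d : operator E) (R : raw_lie M).
Hypothesis CE : chevalley_eilenberg b d R.

Lemma ce_fun (U : opn X) (a : M U) f :
  dpc b (d U (f *: aone E U)) [:: a] = ract R a f.
Proof.
rewrite (@CE 0%N)//; last exact: homog_fun.
rewrite /ce_formula !big_ord_recl !big_ord0 /= omit0.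
by rewrite /dpc /= eps_fun; ring.
Qed.

Lemma ce_iota (U : opn X) (a c : M U) (n : N U) :
  dpc b (d U (iota E U n)) [:: a; c] =
  ract R a (b U n c) - ract R c (b U n a) - b U n (rbr R a c).
Proof.
rewrite (@CE 1%N)//; last exact: iota_deg.
rewrite /ce_formula !big_ord_recl !big_ord0 /= /dpc /= !ctr_iota !eps_fun /=.
ring.
Qed.

End LowDegree.

Section DegreeOne.
Context {K : fieldType} {tau : set (set K)} {X : topologicalType}.
Context {O : ringed_space tau X}.
Variables (P M N : omod O) (b : pairing P N) (fb : framed b).
Variables (EM : exterior M) (EN : exterior N) (F : galg_hom EM EN).

Lemma galg_hom_deg1 : exists f : omod_hom M N,
  forall U (m : M U), F U (iota EM U m) = iota EN U (f U m).
Proof.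
pose f U (m : M U) : N U := iota_inv (F U (iota EM U m)).
have fE U (m : M U) : F U (iota EM U m) = iota EN U (f U m).
  by rewrite (iota_invK fb)//; apply/galg_hom_homog/iota_deg.
have lin U r (m n : M U) : f U (r *: m + n) = r *: f U m + f U n.
  by apply: (iota_inj fb (E := EN)); rewrite happ_lin -!fE !happ_lin.
have res (U V : opn X) (h : V `<=` U) (m : M U) :
    f V (mres h m) = mres h (f U m).
  by apply: (iota_inj fb (E := EN)); rewrite happ_res -!fE !happ_res.
by exists (@Build_omod_hom _ _ _ _ M N f lin res).
Qed.

End DegreeOne.

Section StrongToBialgebroid.
Context {K : fieldType} {tau : set (set K)} {X : topologicalType}.
Context {O : ringed_space tau X}.
Hypothesis hK : base_field tau.
Variables (L : lie_algebroid O) (hL : locally_free_finite_rank L).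
Variables (N : omod O) (hN : locally_free_finite_rank N).
Variables (EL : exterior L) (GL : schouten L EL).
Variables (ELd : exterior (dual L)) (dL : de_rham L ELd) (E : exterior N).
Variable S : strong_gerstenhaber_on GL dL E.
Implicit Types (U V W : opn X).

Local Notation bN := (dual_pairing N).
Local Notation bL := (eval_pairing L).
Let fN : framed bN := dual_framed hN.
Let d := sd_op (sg_diff S).
Let dM k U (v w : E U) : homog k v ->
  d U (amul v w) = amul (d U v) w + (-1) ^+ k *: amul v (d U w).
Proof. exact: sd_mul. Qed.
Let dd U (w : E U) : d U (d U w) = 0.
Proof. exact: sd_sq. Qed.
Let A := gerst_algebroid hK fN (sg_gerst S).
Let Ad := dual_algebroid dM dd.

Lemma strong_alg_mor (f : omod_hom N L) :
  (forall U (D : N U), sg_phi S U (iota E U D) = iota EL U (f U D)) ->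
  is_lie_mor A L f.
Proof.
move=> fE; split=> [U D D'|U D V h g].
  apply: (iota_inj (dual_framed hL) (E := EL)).
  rewrite -fE /= (gbr1E fN) (sg_phi_mor S).
  by rewrite !fE -(sn_br GL).
rewrite -anchor_act_mres -[RHS]/(gact (sg_gerst S) (mres h D) g).
rewrite /gact -(eps_galg_hom (sg_phi S)) (sg_phi_mor S) fE galg_hom_fun.
by rewrite (sn_anchor GL) eps_fun happ_res.
Qed.

Variables (F : omod_hom (dual L) N) (rho : omod_hom (dual N) L).
Hypothesis FE : forall U l, sg_psi S U (iota ELd U l) = iota E U (F U l).
Hypothesis rhoE : forall U (a : dual N U) (l : dual L U),
  dual_pair l (rho U a) = dual_pair a (F U l).

Let psi_op U (w : ELd U) :
  d U (sg_psi S U w) = sg_psi S U (ce_op (b := bL) dL U w).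
Proof. exact: (esym (sg_psi_mor S w)). Qed.

Let CE := ce_op_formula (b := bL) dL.

Let psi_dpc U (w : ELd U) s :
  dpc bN (sg_psi S U w) s = dpc bL w (map (rho U) s).
Proof.
by apply: (dpc_intertwine (f := F)) => // V l a; rewrite /= rhoE.
Qed.

(** The relation psi d_L = d psi, read on functions, matches the anchors; read on generators, in
    [strong_coalg_mor], it matches the brackets. *)
Lemma strong_coalg_act U (a : dual N U) f :
  der_act bN d a f = anchor_act L (rho U a) f.
Proof.
rewrite /der_act -(galg_hom_fun (sg_psi S)) psi_op.
rewrite -[LHS]/(dpc bN (sg_psi S U _) [:: a]) psi_dpc.
exact: (ce_fun CE).
Qed.

Lemma strong_coalg_mor : is_lie_mor Ad L rho.
Proof.
split=> [U a c|U a V h f]; last first.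
  by rewrite -anchor_act_mres -happ_res -strong_coalg_act.
apply: (eval_inj hL) => V h l; rewrite -happ_res -!lbr_res -!happ_res.
move: (mres h a) (mres h c) => {a c} a c.
rewrite rhoE -[lbr Ad a c]/(der_br dM a c) der_brE1 /der_br_fun lied_iota.
rewrite ctrD epsD.
rewrite -/(der_act bN d _ _) -[bN V _ a]/(dual_pair a _) !strong_coalg_act.
rewrite -!rhoE -FE psi_op.
(* The remaining contraction is a pulled back form evaluated on (a, c), which the formula for d_L
   computes on (rho a, rho c). *)
rewrite -[eps (ctr _ c _)]/(dpc bN (sg_psi S V _) [:: a; c]) psi_dpc.
by rewrite (ce_iota CE) /=; ring.
Qed.

Lemma strong_ce : chevalley_eilenberg bN d (algebroid_raw_lie Ad).
Proof.
apply: cartan_ce; have [C1 C2] := der_raw_cartan dM; split=> [|U a f].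
  exact: C1.
by rewrite C2 /= -[anchor_act _ _ _]/(anchor_act Ad a f) dual_algebroid_act.
Qed.

Lemma strong_compat U (D D' : N U) :
  d U (iota E U (lbr A D D')) =
  gbr (sg_gerst S) (d U (iota E U D)) (iota E U D') +
  gbr (sg_gerst S) (iota E U D) (d U (iota E U D')).
Proof.
rewrite /= (gbr1E fN) (sd_br (sg_diff S) _ (iota_deg E D)).
by rewrite expr2 mulrNN mulr1 scale1r.
Qed.

Lemma strong_bialgebroid (f : omod_hom N L) :
  (forall U (D : N U), sg_phi S U (iota E U D) = iota EL U (f U D)) ->
  exists B : lie_bialgebroid_on L E, corresponds B S.
Proof.
move=> fE.
pose alg := Build_rel_lie_algebroid_on (strong_alg_mor fE).
pose coalg := Build_rel_lie_algebroid_on strong_coalg_mor.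
exists (@Build_lie_bialgebroid_on _ _ _ _ L N E alg coalg
  (gerst_schouten hK fN (sg_gerst S)) (op_ce strong_ce) strong_compat).
split=> // U l; exists (F U l); split=> [|V h a]; first exact: FE.
by rewrite -[rla_map _]/rho rhoE happ_res.
Qed.

End StrongToBialgebroid.

Section ToBialgebroid.
Context {K : fieldType} {tau : set (set K)} {X : topologicalType}.
Context {O : ringed_space tau X}.

Lemma bialgebroid_of_strong (hK : base_field tau)
    (L : lie_algebroid O) (hL : locally_free_finite_rank L)
    (N : omod O) (hN : locally_free_finite_rank N)
    (EL : exterior L) (GL : schouten L EL)
    (ELd : exterior (dual L)) (dL : de_rham L ELd) (E : exterior N)
    (S : strong_gerstenhaber_on GL dL E) :
  exists B : lie_bialgebroid_on L E, corresponds B S.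
Proof.
have [f fE] := galg_hom_deg1 (dual_framed hL) (sg_phi S).
have [F FE] := galg_hom_deg1 (dual_framed hN) (sg_psi S).
have [rho rhoE] := transpose hL F.
exact: (strong_bialgebroid hK hL hN FE rhoE fE).
Qed.

End ToBialgebroid.

(** * From bialgebroids to strong differential algebras *)

Section BiderivationInduction.
Context {K : fieldType} {tau : set (set K)} {X : topologicalType}.
Context {O : ringed_space tau X}.
Variables (N : omod O) (E : exterior N).
Implicit Types (U V W : opn X).

(** [Z i a c] stands for the vanishing at (a, c), with a of degree i, of a graded biderivation: [ZM]
    reflects its Leibniz rule and [ZC] its graded symmetry. *)
Variable Z : nat -> forall U, E U -> E U -> Prop.
Hypothesis Zloc : forall i U (a c : E U),
  (forall x, oset U x -> exists (V : opn X) (h : V `<=` U),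
     oset V x /\ Z i (mres h a) (mres h c)) -> Z i a c.
Hypothesis ZD : forall i U (a c c' : E U),
  Z i a c -> Z i a c' -> Z i a (c + c').
Hypothesis ZM : forall i j U (a c c' : E U), homog i a -> homog j c ->
  Z i a c -> Z i a c' -> Z i a (amul c c').
Hypothesis ZC : forall i j U (a c : E U), homog i a -> homog j c ->
  Z i a c -> Z j c a.

Lemma biderivation_ext i U (a : E U) : homog i a ->
  (forall V (h : V `<=` U) f, Z i (mres h a) (f *: aone E V)) ->
  (forall V (h : V `<=` U) n, Z i (mres h a) (iota E V n)) ->
  forall c, Z i a c.
Proof.
move=> ha Zf Zn c.
suff H : forall V (c : E V) (h : V `<=` U), Z i (mres h a) c.
  by have := H U c (@subset_refl _ U); rewrite mres_id.
apply: ext_ind.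
- move=> V v H h; apply: Zloc => x /H[W [k [Wx p]]]; exists W, k; split=> //.
  by rewrite mres_compE; apply: p.
- move=> V f v w pv pw h; apply: ZD; last exact: pw.
  rewrite -[v]amul1l -amulZl.
  by apply: (ZM (homog_res h ha) (homog_fun E f)) => //; apply: pv.
- by move=> V h; rewrite -[aone E V]scale1r; apply: Zf.
- move=> V n w p h.
  by apply: (ZM (homog_res h ha) (iota_deg E n)) => //; apply: p.
Qed.

Hypothesis Z11 : forall U (n n' : N U), Z 1 (iota E U n) (iota E U n').
Hypothesis Z10 : forall U (n : N U) f, Z 1 (iota E U n) (f *: aone E U).
Hypothesis Z00 : forall U f g, Z 0 (f *: aone E U) (g *: aone E U).

(** With a function or a generator fixed on the left, the second argument is extended first; [ZC]
    then swaps the arguments, and the other one is extended. *)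
Lemma biderivation_ind i U (a c : E U) : homog i a -> Z i a c.
Proof.
have Z1 V (n : N V) v : Z 1 (iota E V n) v.
  apply: (biderivation_ext (iota_deg E n)) => W h u; rewrite -happ_res.
    exact: Z10.
  exact: Z11.
have Z0 V f v : Z 0 (f *: aone E V) v.
  apply: (biderivation_ext (homog_fun E f)) => W h u; rewrite mresZ aone_res.
    exact: Z00.
  exact: (ZC (iota_deg E u) (homog_fun E _) (Z10 _ _)).
move=> ha; apply: (biderivation_ext ha) => V h u.
  exact: (ZC (homog_fun E u) (homog_res h ha) (Z0 _ _ _)).
exact: (ZC (iota_deg E u) (homog_res h ha) (Z1 _ _ _)).
Qed.

End BiderivationInduction.

Lemma signE (R : pzRingType) n : (-1) ^+ n = if odd n then -1 else 1 :> R.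
Proof. by rewrite -signr_odd; case: odd; rewrite ?expr1 ?expr0. Qed.

Section GerstenhaberMorphism.
Context {K : fieldType} {tau : set (set K)} {X : topologicalType}.
Context {O : ringed_space tau X}.
Variables (M N : omod O) (EM : exterior M) (EN : exterior N).
Variables (GM : gerstenhaber_on EM) (GN : gerstenhaber_on EN).
Variable F : galg_hom EM EN.
Implicit Types (U V W : opn X).

Lemma gerstenhaber_mor_ext :
  (forall U (m m' : M U), F U (gbr GM (iota EM U m) (iota EM U m')) =
    gbr GN (F U (iota EM U m)) (F U (iota EM U m'))) ->
  (forall U (m : M U) f, F U (gbr GM (iota EM U m) (f *: aone EM U)) =
    gbr GN (F U (iota EM U m)) (f *: aone EN U)) ->
  is_gerstenhaber_mor GM GN F.
Proof.
move=> F11 F10.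
suff H : forall i U (a c : EM U), homog i a ->
    F U (gbr GM a c) = gbr GN (F U a) (F U c).
  move=> U a c; move: U a c.
  apply: (@homog_ind _ _ _ _ _ (fun U a => forall c, _ = _))
    => [U a p c|U a a' p p' c|i U a ha c].
  - apply: msep => x /p[V [h [Vx q]]]; exists V, h; split=> //.
    by rewrite -happ_res -!gbr_res q -!happ_res.
  - by rewrite gbrDl !happD p p' gbrDl.
  - exact: H ha.
apply: (@biderivation_ind _ _ _ _ _ EM
  (fun i U a c => F U (gbr GM a c) = gbr GN (F U a) (F U c))).
- move=> i U a c H; apply: msep => x /H[V [h [Vx p]]]; exists V, h.
  by split=> //; rewrite -happ_res -!gbr_res -!happ_res.
- by move=> i U a c c' p p'; rewrite gbrDr !happD p p' gbrDr.
- move=> i j U a c c' ha hc p p'.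
  have ha' := galg_hom_homog F ha; have hc' := galg_hom_homog F hc.
  rewrite ahomM (gbr_leibniz GN _ ha' hc') (gbr_leibniz GM _ ha hc).
  by rewrite happD happZ !ahomM p p'.
- move=> i j U a c ha hc p.
  have ha' := galg_hom_homog F ha; have hc' := galg_hom_homog F hc.
  by rewrite (gbr_anti GN hc' ha') (gbr_anti GM hc ha) happN happZ p.
- exact: F11.
- by move=> U m f; rewrite F10 galg_hom_fun.
- by move=> U f g; rewrite !galg_hom_fun !gbr_fun happ0.
Qed.

End GerstenhaberMorphism.

(** * Compatibility of the differential with the whole bracket *)

Section BracketDerivation.
Context {K : fieldType} {tau : set (set K)} {X : topologicalType}.
Context {O : ringed_space tau X}.
Hypothesis hK : base_field tau.
Variables (N : omod O) (hN : locally_free_rank (fun n => n <> 1) N).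
Variables (E : exterior N) (G : gerstenhaber_on E) (d : operator E).
Implicit Types (U V W : opn X).
Hypothesis dM : forall k U (v w : E U), homog k v ->
  d U (amul v w) = amul (d U v) w + (-1) ^+ k *: amul v (d U w).

Definition defect i U (a c : E U) : E U :=
  d U (gbr G a c) - gbr G (d U a) c - (-1) ^+ i.+1 *: gbr G a (d U c).

Lemma defect_res i U V (h : V `<=` U) (a c : E U) :
  defect i (mres h a) (mres h c) = mres h (defect i a c).
Proof.
by rewrite /defect !op_res !gbr_res !op_res !mresB mresZ ores_sign.
Qed.

Lemma defectDr i U (a c c' : E U) :
  defect i a (c + c') = defect i a c + defect i a c'.
Proof. by rewrite /defect !(gbrDr, opD) scalerDr; abel. Qed.

(** The exponent has the parity of i + j - 1, the degree of the bracket; for i = j = 0 that degree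
    does not exist, but the bracket is zero. *)
Lemma op_gbrM i j U (a c e : E U) : homog i a -> homog j c ->
  d U (amul (gbr G a c) e) =
  amul (d U (gbr G a c)) e + (-1) ^+ (i + j).+1 *: amul (gbr G a c) (d U e).
Proof.
move=> ha hc; have := gbr_deg G ha hc; case: (i + j)%N => [->|k hk].
  by rewrite !(op0, amul0l) scaler0 addr0.
by rewrite (dM _ hk) !exprS !mulN1r opprK.
Qed.

(** The bracket with a has degree i - 1 and d has degree 1, so [defect i a] is a derivation of
    degree i: hence the sign. The cancellations depend on the parities of i and j only. *)
Lemma defectM i j U (a c e : E U) : homog i a -> homog j c ->
  defect i a (amul c e) =
  amul (defect i a c) e + (-1) ^+ (i * j) *: amul c (defect i a e).
Proof.
move=> ha hc; rewrite /defect (dM _ hc) gbrDr gbrZsignr.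
rewrite (gbr_leibniz G _ ha hc) (gbr_leibniz G _ (op_deg d ha) hc).
rewrite (gbr_leibniz G _ ha (op_deg d hc)) (gbr_leibniz G _ ha hc).
rewrite opD opZsign (op_gbrM _ ha hc) (dM _ hc) !signE ?(oddS, oddM, oddD).
by case: (odd i); case: (odd j); rewrite /= ?(amulDl, amulDr, amulNl, amulNr,
  scalerDr, scaleN1r, scale1r); abel.
Qed.

Lemma defect_anti i j U (a c : E U) : homog i a -> homog j c ->
  defect i a c = - ((-1) ^+ (i.+1 * j.+1) *: defect j c a).
Proof.
move=> ha hc; rewrite /defect (gbr_anti G ha hc).
rewrite (gbr_anti G (op_deg d ha) hc) (gbr_anti G ha (op_deg d hc)).
rewrite opN opZsign !signE ?(oddS, oddM, oddD).
by case: (odd i); case: (odd j);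
  rewrite /= ?(scalerDr, scaleN1r, scale1r); abel.
Qed.

Lemma homog_defect i j k U (a c : E U) : homog i a -> homog j c ->
  (i + j)%N = k -> homog k (defect i a c).
Proof.
move=> ha hc ij; rewrite /defect; apply: homogB; first apply: homogB.
- have := gbr_deg G ha hc; rewrite ij; case: k ij => [|k] _ h.
    by rewrite h op0; apply: homog0.
  exact: op_deg.
- by rewrite -ij; exact: (gbr_deg G (op_deg d ha) hc).
- by apply: homogZ; have := gbr_deg G ha (op_deg d hc); rewrite addnS ij.
Qed.

Hypothesis compat : forall U (D D' : N U),
  d U (gbr G (iota E U D) (iota E U D')) =
  gbr G (d U (iota E U D)) (iota E U D') +
  gbr G (iota E U D) (d U (iota E U D')).

Let b := dual_pairing N.

Let bE U (n : N U) a : b U n a = dual_pair a n.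
Proof. by []. Qed.

Let basis := dual_basis hN.

Let fN : framed b.
Proof.
by move=> x; have [V [k [e [a [Vx _ fr _]]]]] := basis x; exists V, k, e, a.
Qed.

Lemma defect11 U (D D' : N U) : defect 1 (iota E U D) (iota E U D') = 0.
Proof. by rewrite /defect compat signE /= scale1r; abel. Qed.

(* Here the rank 1 is excluded: [compat] for D and f D' only gives
   defect (D, f) D' = 0. *)
Lemma defect10 U (D : N U) f : defect 1 (iota E U D) (f *: aone E U) = 0.
Proof.
have h1 : homog 1 (defect 1 (iota E U D) (f *: aone E U)).
  exact: homog_defect (iota_deg E D) (homog_fun E f) _.
have [m mE] := homog1E fN h1; rewrite mE.
have H V (h : V `<=` U) (D' : N V) :
    amul (iota E V (mres h m)) (iota E V D') = 0.
  rewrite happ_res -mE -defect_res mresZ aone_res -happ_res.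
  have := defectM (iota E V D') (iota_deg E (mres h D))
    (homog_fun E (ores h f)).
  by rewrite amulZl amul1l -happZ !defect11 amul0r scaler0 addr0.
rewrite (_ : m = 0) ?happ0//; apply: msep => x Ux.
have [V [k [e [a [Vx k1 fr dual_ea]]]]] := basis x.
exists (opnI U V), (@sub_opnIl _ U V); split=> //.
pose h := @sub_opnIr _ U V; set n := mres _ m; rewrite mres0.
rewrite (fr _ h n) big1// => i _.
(* A second basis vector exists: the rank is not 1, and not 0 either since i exists. *)
have [j ij] : exists j : 'I_k, j != i.
  case: k k1 e a fr dual_ea i => [|[|k]] // _ e a fr dual_ea i.
    by case: i.
  by exists (lift i ord0); rewrite eq_sym neq_lift.
(* Contracting n e_j = 0 by a_j and then by a_i leaves minus the i-th coordinate of n. *)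
have /(congr1 (fun w => eps (ctr b (mres h (a i)) (ctr b (mres h (a j)) w)))) :=
  H _ (@sub_opnIl _ U V) (mres h (e j)).
rewrite -/n ctr_iotaM ctr_iota ctrB !ctrZ ctr_iota ctr0r ctr0r amulZr amul1r.
rewrite ctrZ ctr_iota epsD epsN !epsZ eps0 eps1 !bE !dual_ea eqxx.
rewrite eq_sym (negPf ij) mul0r mulr0 mul1r mulr1 add0r => /eqP.
by rewrite oppr_eq0 => /eqP ->; rewrite scale0r.
Qed.

(** In positive rank, the defects of f with e_0 and with g e_0 vanish by [defect10], so defect (f,
    g) e_0 = 0 and contraction by a_0 concludes. In rank 0 there is nothing in degree 1, so d kills
    functions. *)
Lemma defect00 U f g : defect 0 (f *: aone E U) (g *: aone E U) = 0.
Proof.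
have h0 := homog_defect (homog_fun E f) (homog_fun E g) erefl.
apply: msep => x Ux; have [V [k [e [a [Vx k1 fr dual_ea]]]]] := basis x.
exists (opnI U V), (@sub_opnIl _ U V); split=> //.
pose h := @sub_opnIr _ U V; rewrite -defect_res !mresZ !aone_res mres0.
move: (ores _ f) (ores _ g) => {f g h0} f g.
case: k k1 e a fr dual_ea => [|k] k1 e a fr dual_ea.
  have z (u : N (opnI U V)) : u = 0 by rewrite (fr _ h u) big_ord0.
  have dz u : d (opnI U V) (u *: aone E _) = 0.
    have [m ->] := homog1E fN (op_deg d (homog_fun E u)).
    by rewrite (z m) happ0.
  by rewrite /defect !dz gbr_fun op0 gbr0l gbr0r scaler0 !subr0.
have h0 := homog_defect (homog_fun E f) (homog_fun E g) erefl.
have d01 r (D : N (opnI U V)) : defect 0 (r *: aone E _) (iota E _ D) = 0.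
  rewrite (defect_anti (homog_fun E r) (iota_deg E D)) defect10.
  by rewrite scaler0 oppr0.
have := defectM (iota E _ (mres h (e ord0))) (homog_fun E f) (homog_fun E g).
rewrite amulZl amul1l -happZ !d01 amul0r scaler0 addr0.
rewrite (homog0E h0) amulZl amul1l.
move/(congr1 (fun w => eps (ctr b (mres h (a ord0)) w))).
rewrite ctr0r eps0 ctrZ ctr_iota epsZ eps_fun bE dual_ea eqxx mulr1 => <-.
by rewrite scale0r.
Qed.

Lemma op_bracket i U (a c : E U) : homog i a ->
  d U (gbr G a c) = gbr G (d U a) c + (-1) ^+ i.+1 *: gbr G a (d U c).
Proof.
suff H : homog i a -> defect i a c = 0.
  move=> /H/eqP; rewrite /defect -addrA -opprD subr_eq0 => /eqP //.
apply: (@biderivation_ind _ _ _ _ _ E (fun i U a c => defect i a c = 0))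
  => {i U a c}.
- move=> i U a c H; apply: msep => x /H[V [h [Vx p]]]; exists V, h.
  by rewrite -defect_res p mres0.
- by move=> i U a c c' p p'; rewrite defectDr p p' addr0.
- move=> i j U a c c' ha hc p p'.
  by rewrite (defectM _ ha hc) p p' amul0l amul0r scaler0 addr0.
- by move=> i j U a c ha hc p; rewrite (defect_anti hc ha) p scaler0 oppr0.
- exact: defect11.
- exact: defect10.
- exact: defect00.
Qed.

End BracketDerivation.

(** * The trivial strong structure and the one corresponding to a bialgebroid *)

Section BialgebroidToStrong.
Context {K : fieldType} {tau : set (set K)} {X : topologicalType}.
Context {O : ringed_space tau X}.
Variables (L : lie_algebroid O) (EL : exterior L) (GL : schouten L EL).
Variables (ELd : exterior (dual L)) (dL : de_rham L ELd).
Variables (N : omod O) (E : exterior N).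
Implicit Types (U V W : opn X).

Section Trivial.
Variable G : gerstenhaber_on E.

(** The graded commutativity of the exterior product is taken over from G. *)
Definition zero_gerstenhaber : gerstenhaber_on E.
Proof.
apply: (@Build_gerstenhaber_on _ _ _ _ E (@gmulC _ _ _ _ _ G) (fun U _ _ => 0)).
- by move=> *; rewrite mres0.
- by move=> *; rewrite scaler0 addr0.
- by move=> *; rewrite scaler0 addr0.
- by move=> i j U a c _ _; case: (i + j)%N => // k; apply: homog0.
- by move=> *; rewrite scaler0 oppr0.
- by move=> *; rewrite scaler0 addr0.
- by move=> *; rewrite amul0l amul0r scaler0 addr0.
Defined.

Definition zero_strong_differential : strong_differential zero_gerstenhaber.
Proof.
apply: (@Build_strong_differential _ _ _ _ E zero_gerstenhaber (fun U _ => 0)).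
- by move=> *; rewrite mres0.
- by move=> *; rewrite scaler0 addr0.
- by move=> *; apply: homog0.
- by [].
- by move=> *; rewrite amul0l amul0r scaler0 addr0.
- by move=> *; rewrite scaler0 addr0.
Defined.

Lemma extend_zero (P Q : omod O) (EP : exterior P) (EQ : exterior Q) :
  exists F : galg_hom EP EQ, forall U (w : EP U), F U w = eps w *: aone EQ U.
Proof.
have [F FE] := extend EP EQ (zero_hom P Q); exists F; apply: ext_ind.
- move=> U w H; apply: msep => x /H[V [h [Vx p]]]; exists V, h; split=> //.
  by rewrite -happ_res p mresZ aone_res eps_res.
- by move=> U f v w pv pw; rewrite happ_lin pv pw eps_lin scalerDl scalerA.
- by move=> U; rewrite ahom1 eps1 scale1r.
- by move=> U n w _; rewrite ahomM FE happ0 amul0l epsM eps_iota mul0r scale0r.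
Qed.

Lemma eps_op (P : omod O) (EP : exterior P) (d : operator EP) U (w : EP U) :
  eps (d U w) = 0.
Proof.
move: U w; apply: homog_ind.
- move=> U w H; apply: osep => x /H[V [h [Vx p]]]; exists V, h; split=> //.
  by rewrite -eps_res -op_res p ores0.
- by move=> U v w pv pw; rewrite opD epsD pv pw addr0.
- by move=> i U w hw; apply/eps_homogS/op_deg/hw.
Qed.

(** Both phi and psi factor through the augmentation: brackets of functions vanish in G_L, and d_L
    takes values of zero augmentation. *)
Lemma trivial_strong : inhabited (strong_gerstenhaber_on GL dL E).
Proof.
have [phi phiE] := extend_zero E EL; have [psi psiE] := extend_zero ELd E.
split; apply: (@Build_strong_gerstenhaber_on _ _ _ _ L EL GL ELd dL E
  zero_gerstenhaber phi _ zero_strong_differential psi).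
- by move=> U a c; rewrite /= happ0 !phiE gbr_fun.
- move=> U w; rewrite psiE.
  by rewrite -[dL U w]/(ce_op (b := eval_pairing L) dL U w) eps_op scale0r.
Qed.

End Trivial.

Hypothesis hK : base_field tau.
Hypothesis hN : locally_free_rank (fun n => n <> 1) N.
Variable B : lie_bialgebroid_on L E.

Let hN' : locally_free_finite_rank N.
Proof.
by move=> x; have [V [n [e [Vx _ fr]]]] := hN x; exists V, n, e.
Qed.

Local Notation bN := (dual_pairing N).
Local Notation bL := (eval_pairing L).
Let fN : framed bN := dual_framed hN'.
Let A := lb_coalg B.
Let rho := rla_map A.
Let d := ce_op (b := bN) (lb_diff B).
Let dLo := ce_op (b := bL) dL.
Let R := algebroid_raw_lie A.

Let CE : chevalley_eilenberg bN d R.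
Proof. exact: ce_op_formula. Qed.

Let CEL : chevalley_eilenberg bL dLo (algebroid_raw_lie L).
Proof. exact: ce_op_formula. Qed.

Let C : cartan bN d R.
Proof. exact: ce_cartan. Qed.

Lemma bialgebroid_opM k U (v w : E U) : homog k v ->
  d U (amul v w) = amul (d U v) w + (-1) ^+ k *: amul v (d U w).
Proof.
move: U w v; apply: (@homog_ind _ _ _ _ _ (fun U w => forall v, _ -> _)).
- move=> U w H v hv; apply: msep => x /H[V [h [Vx p]]]; exists V, h; split=> //.
  rewrite mresD mresZ ores_sign -!amul_res -!op_res -!amul_res p//.
  exact: homog_res.
- move=> U w w' p p' v hv; rewrite !(amulDr, opD) p// p'// scalerDr; abel.
- move=> l U w hw v hv; apply: (opM hK fN C _ hv hw).
  exact: anchor_actM.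
Qed.

Lemma bialgebroid_op_sq U (w : E U) : d U (d U w) = 0.
Proof.
apply: (op_sq hK fN C); first exact: lbr_jacobiE.
exact: anchor_act_lie.
Qed.

Lemma bialgebroid_op_bracket i U (a c : E U) : homog i a ->
  d U (gbr (lb_bracket B) a c) =
  gbr (lb_bracket B) (d U a) c + (-1) ^+ i.+1 *: gbr (lb_bracket B) a (d U c).
Proof.
apply: (op_bracket hN bialgebroid_opM) => V D D'.
by rewrite sn_br; apply: (lb_compat B).
Qed.

Definition bialgebroid_strong_differential : strong_differential (lb_bracket B).
Proof.
apply: (@Build_strong_differential _ _ _ _ E (lb_bracket B) d).
- exact: op_res.
- exact: op_lin.
- exact: op_deg.
- exact: bialgebroid_op_sq.
- exact: bialgebroid_opM.
- exact: bialgebroid_op_bracket.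
Defined.

Lemma bialgebroid_phi : exists phi : galg_hom E EL,
  (forall U (D : N U),
    phi U (iota E U D) = iota EL U (rla_map (lb_alg B) U D)) /\
  is_gerstenhaber_mor (lb_bracket B) GL phi.
Proof.
have [phi phiE] := extend E EL (rla_map (lb_alg B)); exists phi; split=> //.
have [Fbr Fact] := rla_mor (lb_alg B).
apply: gerstenhaber_mor_ext => U D => [D'|f].
  by rewrite sn_br !phiE sn_br Fbr.
rewrite (sn_anchor (lb_bracket B)) galg_hom_fun phiE (sn_anchor GL).
by rewrite /anchor_act Fact.
Qed.

Lemma ce_formula_intertwine (F : galg_hom ELd E) :
  (forall U w s, dpc bN (F U w) s = dpc bL w (map (rho U) s)) ->
  forall U (w : ELd U) (s : seq (dual N U)),
  ce_formula bN R (F U w) s =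
  ce_formula bL (algebroid_raw_lie L) w (map (rho U) s).
Proof.
move=> FE U w s; have [rbr ract] := rla_mor A.
rewrite /ce_formula size_map; congr (_ + _); apply: eq_bigr => i _.
  rewrite FE map_omit (nth_map 0)//= /anchor_act ract.
  by [].
apply: eq_bigr => j _; rewrite FE /= !map_omit rbr.
by rewrite !(nth_map 0)// (ltn_trans (ltn_ord j)).
Qed.

(** psi extends the transpose of rho. It commutes with the differentials because, evaluated on any
    s, both sides are given by Chevalley-Eilenberg formulas that correspond under rho, a morphism of
    algebroids. *)
Lemma bialgebroid_psi : exists psi : galg_hom ELd E,
  (forall U w, psi U (dLo U w) = d U (psi U w)) /\
  forall U (l : dual L U), exists D : N U,
    psi U (iota ELd U l) = iota E U D /\
    forall V (h : V `<=` U) (a : dual N V),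
      dual_pair a (mres h D) = dual_pair (mres h l) (rho V a).
Proof.
have [F FE] := transpose hN' rho; have [psi psiE] := extend ELd E F.
exists psi; split; last first.
  move=> U l; exists (F U l); split=> // V h a.
  by rewrite -happ_res FE.
have psi_dpc U w s : dpc bN (psi U w) s = dpc bL w (map (rho U) s).
  by apply: (dpc_intertwine (f := F)) => // V l a; rewrite /= -FE.
apply: homog_ind.
- move=> U w H; apply: msep => x /H[V [h [Vx p]]]; exists V, h; split=> //.
  by rewrite -!(happ_res, op_res) p.
- by move=> U v w pv pw; rewrite !(opD, happD) pv pw.
move=> k U w hw; have hpw := galg_hom_homog psi hw.
apply: (dpc_inj hK fN (k := k.+1)).
- exact/galg_hom_homog/op_deg.
- exact: op_deg.
move=> V h s sk; rewrite -!(happ_res, op_res).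
rewrite psi_dpc (@CEL k) ?size_map//; last exact: homog_res.
rewrite -(ce_formula_intertwine psi_dpc) -(@CE k)//.
exact/galg_hom_homog/homog_res.
Qed.

Lemma strong_of_bialgebroid :
  exists S : strong_gerstenhaber_on GL dL E, corresponds B S.
Proof.
have [phi [phiE phi_mor]] := bialgebroid_phi.
have [psi [psi_op psiE]] := bialgebroid_psi.
exists (@Build_strong_gerstenhaber_on _ _ _ _ L EL GL ELd dL E (lb_bracket B)
  phi phi_mor bialgebroid_strong_differential psi psi_op).
by split.
Qed.

End BialgebroidToStrong.
Local Close Scope ring_scope.
Local Close Scope classical_set_scope.

Theorem theorem5p10 (K : fieldType) (tau : set (set K)) (hK : base_field tau)
    (X : topologicalType) (O : ringed_space tau X)
    (L : lie_algebroid O) (hL : locally_free_finite_rank L)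
    (L' : omod O) (hL' : locally_free_finite_rank L')
    (EL : exterior L) (GL : schouten L EL)
    (ELd : exterior (dual L)) (dL : de_rham L ELd)
    (E' : exterior L') :
  [/\ inhabited (lie_bialgebroid_on L E') <->
        inhabited (strong_gerstenhaber_on GL dL E'),
      forall S : strong_gerstenhaber_on GL dL E',
        exists B : lie_bialgebroid_on L E', corresponds B S
    & locally_free_rank (fun n => n <> 1) L' ->
      forall B : lie_bialgebroid_on L E',
        exists S : strong_gerstenhaber_on GL dL E', corresponds B S].

Proof.
split.
- split=> [[B]|[S]].
    (* In every rank the zero structure is the witness here; the correspondence of structures is the
       content of the other two clauses. *)
    exact: (trivial_strong GL dL (lb_bracket B)).
  by have [B _] := bialgebroid_of_strong hK hL hL' S.
- by move=> S; apply: bialgebroid_of_strong.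
- by move=> rk B; apply: strong_of_bialgebroid.
Qed.
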